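(* Consider $\mathrm{Spin}(7)$-instantons for $\Theta$ on $E\setminus Z\cong(0,\infty)_r\times X$ of the form $x(r)\sum_{i=1}^3\eta_i\otimes T_i$. For $y_0\in[0,+\infty)$ let $A_{y_0}$ be the unique such instanton which extends smoothly over $Z$ as a connection on $E\times\mathbb{C}^2$ and has $x(r)=r^2\tilde y(r)$ with $\tilde y$ real analytic and $\tilde y(0)=y_0$, and let $A_{\lim}$ be the unique such instanton which extends smoothly over $Z$ as a connection on $\pi^*E\to E$ with $x(r)=1+O(r^2)$ as $r\to0$. Then these can be explicitly written as $$A_{y_0}=\frac{y_0\,t^2(r)}{1+2y_0\int_0^rt(u)\,du}\sum_{i=1}^3\eta_i\otimes T_i\qquad\text{and}\qquad A_{\lim}=\frac{t^2(r)}{2\int_0^rt(u)\,du}\sum_{i=1}^3\eta_i\otimes T_i.$$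
   Context: Geometry. $(Z,g_Z)$ is a compact oriented spin Einstein $4$-orbifold with scalar curvature $s>0$ and anti-self-dual Weyl curvature; smoothness is understood in the orbifold sense at singular points. $X\to Z$ is the principal $\mathrm{SU}(2)$-(orbi)bundle lifting the $\mathrm{SO}(3)$-frame bundle of $\Lambda^2_+Z$, and $E=X\times_{\mathrm{SU}(2)}\mathbb{C}^2$ is the positive spinor bundle, with projection $\pi:E\to Z$; $Z\subset E$ is the zero section. Fixing a unit vector $e\in\mathbb{C}^2$, the map $(r,p)\mapsto[p,re]$ identifies $(0,\infty)_r\times X\cong E\setminus Z$. Let $T_1,T_2,T_3$ be the basis of $\mathfrak{su}(2)$ with $[T_i,T_j]=2\epsilon_{ijk}T_k$, and let $\eta=\sum_i\eta_i\otimes T_i\in\Omega^1(X,\mathfrak{su}(2))$ be the connection on $X$ induced by the Levi-Civita connection of $g_Z$. The horizontal $2$-forms $\omega_i$ are defined by $F_\eta=d\eta+\frac12[\eta\wedge\eta]=-\frac{s}{24}\sum_i\omega_i\otimes T_i$, i.e. $d\eta_i=-\frac{s}{24}\omega_i-2\eta_j\wedge\eta_k$ for $(i,j,k)$ cyclic; they form an orthogonal basis of the self-dual $2$-forms on $\ker\eta$ with $|\omega_i|=\sqrt2$ with respect to $\pi^*g_Z$. Fix $\nu_0>0$ and let $t(r),\nu(r)$, $r\ge0$, solve $\frac{d}{dr}\nu^2=6t$, $\frac{dt}{dr}=1-\frac{2t^2}{\nu^2}$ with $t(0)=0$, $\nu(0)=\nu_0$ (so $\nu^4(\nu^2-5t^2)^3=\nu_0^{10}$).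 Set $\varphi=t^3\eta_{123}-t\nu^2\frac{s}{48}\sum_i\eta_i\wedge\omega_i$, $\ \psi=\frac{\nu^4}{6}(\frac{s}{48})^2\sum_i\omega_i\wedge\omega_i-\nu^2t^2\frac{s}{48}(\eta_{12}\wedge\omega_3+\eta_{23}\wedge\omega_1+\eta_{31}\wedge\omega_2)$, $\ \Theta=dr\wedge\varphi+\psi$. Then $\Theta$ is closed and extends smoothly over the zero section $Z=\{r=0\}$ to a torsion-free $\mathrm{Spin}(7)$-structure on $E$ with metric $g_\Theta=dr^2+t^2\sum_i\eta_i\otimes\eta_i+\frac{s\nu^2}{48}\pi^*g_Z$ and orientation $\Theta\wedge\Theta$. Gauge theory. A connection $A$ is a $\mathrm{Spin}(7)$-instanton if $*F_A=-F_A\wedge\Theta$. Over $E\setminus Z$ the bundle $\pi^*E$ is tautologically trivialized (at $(r,p)$ the frame $p$ identifies $E_{\pi(p)}\cong\mathbb{C}^2$), so connections on it are $\mathfrak{su}(2)$-valued $1$-forms; extension over $Z$ is up to gauge. A connection $x(r)\sum_i\eta_i\otimes T_i$ is a $\mathrm{Spin}(7)$-instanton if and only if $\frac{dx}{dr}=-\frac{2}{t}x\left(x-\left(1-\frac{2t^2}{\nu^2}\right)\right)$. *)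

(* Defs.v *)
From HB Require Import structures.
From mathcomp Require Import all_boot all_order all_algebra all_fingroup.
From mathcomp Require Import all_classical all_reals all_analysis.

Set Implicit Arguments.
Unset Strict Implicit.
Unset Printing Implicit Defensive.

Import Order.TTheory GRing.Theory Num.Theory.
Import numFieldNormedType.Exports.

Local Open Scope classical_set_scope.
Local Open Scope ring_scope.

(* The quaternions H = R^4, coordinates along 1, i, j, k.  They serve as model
   of C^2, with e = 1; SU(2) is the unit sphere acting by left multiplication,
   su(2) = Im H, and T_1, T_2, T_3 = i, j, k, so that [T_i, T_j] = 2 T_k for
   (i, j, k) cyclic. *)
Section Quaternions.
Variable R : realType.
Local Notation H := 'rV[R]_4.

Definition qmul (x y : H) : H :=
  let x0 := x 0 0 in let x1 := x 0 1 in let x2 := x 0 2 in let x3 := x 0 3 in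
  let y0 := y 0 0 in let y1 := y 0 1 in let y2 := y 0 2 in let y3 := y 0 3 in
  \row_(m < 4) [:: x0 * y0 - x1 * y1 - x2 * y2 - x3 * y3;
                   x0 * y1 + x1 * y0 + x2 * y3 - x3 * y2;
                   x0 * y2 + x2 * y0 + x3 * y1 - x1 * y3;
                   x0 * y3 + x3 * y0 + x1 * y2 - x2 * y1]`_m.

Definition qconj (x : H) : H := \row_m (if m == 0 then x 0 m else - x 0 m).
Definition qim (x : H) : H := \row_m (if m == 0 then 0 else x 0 m).

(* The Euclidean norm; the library norm on matrices is the sup norm. *)
Definition qnorm (x : H) : R := Num.sqrt (\sum_m x 0 m ^+ 2).
Definition qinv (x : H) : H := (qnorm x ^+ 2)^-1 *: qconj x.
Definition qcomm (x y : H) : H := qmul x y - qmul y x.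

Definition imag (i : 'I_3) : 'I_4 := lift ord0 i.

End Quaternions.

Section Forms.
Variable R : realType.

(* A k-covector on R^n is evaluated on the k rows of a matrix. *)
Definition form (k n : nat) := 'M[R]_(k, n) -> R.
Definition dform (k n : nat) := 'rV[R]_n -> form k n.

Definition wedge k l n (a : form k n) (b : form l n) : form (k + l) n :=
  fun M => (k`! * l`!)%:R^-1 *
    \sum_(s : 'S_(k + l))
      (-1) ^+ s * a (usubmx (row_perm s M)) * b (dsubmx (row_perm s M)).

Definition dwedge k l n (a : dform k n) (b : dform l n) : dform (k + l) n :=
  fun p => wedge (a p) (b p).

Definition diff1 n (a : dform 1 n.+1) : dform 2 n.+1 :=
  fun p M => 'D_(row 0 M) (fun p' => a p' (row 1 M) : R^o) p
           - 'D_(row 1 M) (fun p' => a p' (row 0 M) : R^o) p.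

Definition basis_vec n (i : 'I_n) : 'rV[R]_n := delta_mx 0 i.

(* The Hodge star of a 2-covector a on R^8 with Gram matrix G, for the
   orientation with sign eps relative to the coordinates: the volume form
   eps * sqrt(det G) * det contracted with the bivector obtained from a by
   raising both indices. *)
Definition hodge2 (G : 'M[R]_8) (eps : R) (a : form 2 8) : form 6 8 :=
  fun M =>
    let up := invmx G
      *m \matrix_(i, j) a (col_mx (basis_vec i) (basis_vec j)) *m invmx G in
    2^-1 * \sum_(i < 8) \sum_(j < 8)
      up i j * (eps * Num.sqrt (\det G)
        * \det (col_mx (col_mx (basis_vec i) (basis_vec j)) M : 'M[R]_8)).

End Forms.

Section Smoothness.
Variable R : realType.

(* C^k and C^oo maps on an open set of a finite-dimensional space. *)
Fixpoint class_C (k : nat) (V W : normedModType R) (D : set V) (f : V -> W)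
    : Prop :=
  if k is k'.+1 then
    (forall p, D p -> differentiable f p) /\
    (forall v, class_C k' D (fun p => 'D_v f p))
  else forall p, D p -> {for p, continuous f}.

Definition smooth (V W : normedModType R) (D : set V) (f : V -> W) :=
  forall k, class_C k D f.

Definition smooth_1form (V W : normedModType R) (D : set V)
    (a : V -> V -> W) :=
  (forall p, D p -> forall (c : R) v w, a p (c *: v + w) = c *: a p v + a p w)
  /\ (forall v, smooth D (fun p => a p v)).

(* dA + [A /\ A] / 2 for a 1-form A with values in a Lie algebra. *)
Definition curvature (V W : normedModType R) (br : W -> W -> W)
    (A : V -> V -> W) (p v w : V) : W :=
  'D_v (fun p' => A p' w) p - 'D_w (fun p' => A p' v) p + br (A p v) (A p w).

Definition real_analytic_on (D : set R) (f : R -> R) :=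
  forall r0, D r0 -> exists (c : R^nat) (rho : R), 0 < rho /\
    forall r, D r -> `|r - r0| < rho -> pseries c (r - r0) @ \oo --> f r.

End Smoothness.

(* Effective 4-orbifolds, given by an atlas of uniformizing charts
   phi_a : U_a -> U_a / G_a ~ phi_a(U_a), with U_a open in R^4. *)
Section Orbifolds.
Variable R : realType.
Local Notation V := 'rV[R]_4.

Record orbifold_atlas (Z : topologicalType) := OrbifoldAtlas {
  chart : Type;
  dom : chart -> set V;
  grp : chart -> finGroupType;
  act : forall a, grp a -> V -> V;
  proj : chart -> V -> Z;
  dom_open : forall a, open (dom a);
  dom_connected : forall a, connected (dom a);
  dom_nonempty : forall a, dom a !=set0;
  act_dom : forall a (g : grp a) z, dom a z -> dom a (act g z);
  act_smooth : forall a (g : grp a), smooth (dom a) (act g);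
  act1 : forall a z, dom a z -> act (1%g : grp a) z = z;
  actM : forall a (g h : grp a) z, dom a z -> act (g * h)%g z = act g (act h z);
  act_effective : forall a (g : grp a),
    (forall z, dom a z -> act g z = z) -> g = 1%g;
  proj_continuous : forall a z, dom a z -> {for z, continuous (proj a)};
  proj_open : forall a (O : set V), open O -> O `<=` dom a ->
    open (proj a @` O);
  proj_orbits : forall a z z', dom a z -> dom a z' ->
    (proj a z = proj a z' <-> exists g : grp a, act g z = z');
  proj_cover : forall x : Z, exists a, exists2 z, dom a z & proj a z = x;
}.

Definition embedding Z (O : orbifold_atlas Z) (a b : chart O) (la : V -> V) :=
  [/\ forall z, dom a z -> dom b (la z),
      smooth (dom a) la,
      forall z z', dom a z -> dom a z' -> la z = la z' -> z = z',
      forall z v, dom a z -> 'D_v la z = 0 -> v = 0 &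
      forall z, dom a z -> proj b (la z) = proj a z].

Definition atlas_compatible Z (O : orbifold_atlas Z) :=
  forall (a b : chart O) z z', dom a z -> dom b z' -> proj a z = proj b z' ->
  exists c : chart O, exists la mu : V -> V,
    [/\ embedding c a la, embedding c b mu &
        exists2 w, dom c w & proj c w = proj a z].

(* Cartan's moving frames: the metric and the orientation over U_a are given by
   a positively oriented orthonormal coframe (e^0, e^1, e^2, e^3); th z v is
   the matrix of the connection 1-forms th^i_j, with
   de^i = - sum_j th^i_j /\ e^j. *)
Section Frames.
Variables (cof : V -> 'M[R]_4) (th : V -> V -> 'M[R]_4).

Definition coframe (z v : V) : V := v *m cof z.

Definition frame (z : V) (i : 'I_4) : V := row i (invmx (cof z)).

Definition levi_civita (D : set V) :=
  [/\ smooth_1form D th,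
      forall z v, D z -> (th z v)^T = - th z v &
      forall z v w, D z ->
        'D_v (fun z' => coframe z' w) z - 'D_w (fun z' => coframe z' v) z
        + (coframe z w *m (th z v)^T - coframe z v *m (th z w)^T) = 0].

Definition riemann (z : V) (i j k l : 'I_4) : R :=
  curvature (fun x y : 'M[R]_4 => x *m y - y *m x) th z
    (frame z k) (frame z l) i j.

Definition ricci (z : V) (j l : 'I_4) : R := \sum_i riemann z i j i l.
Definition scalar_curvature (z : V) : R := \sum_j ricci z j j.

Definition kron (i j : 'I_4) : R := (i == j)%:R.

Definition weyl (z : V) (i j k l : 'I_4) : R :=
  riemann z i j k l
  - (ricci z i k * kron j l - ricci z i l * kron j k
     - ricci z j k * kron i l + ricci z j l * kron i k) / 2
  + scalar_curvature z / 6 * (kron i k * kron j l - kron i l * kron j k).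

Definition levi_symbol (i j k l : 'I_4) : R :=
  \det (\matrix_(m < 4, n < 4) kron (tnth [tuple i; j; k; l] m) n).

Definition einstein (D : set V) := forall z, D z -> forall j l,
  ricci z j l = scalar_curvature z / 4 * kron j l.

Definition weyl_asd (D : set V) := forall z, D z -> forall i j k l,
  2^-1 * \sum_m \sum_n levi_symbol i j m n * weyl z m n k l = - weyl z i j k l.

(* The connection on X, in the section of X over U_a lifting the frame
   sigma_i = e^0 /\ e^i + e^j /\ e^k ((i, j, k) cyclic) of Lambda^2_+.  Since
   Lambda^2_+ is associated with the adjoint representation, T_i giving
   sigma_i, it is the su(2)-valued 1-form A such that
   nabla sigma_j = sum_i (ad A)_ij sigma_i, for nabla e^i = - sum_j th^i_j e^j.
   Equivalently, th(v) is the sum of left multiplication by A(v) and of a right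
   multiplication. *)
Definition spin_connection (z v : V) : V :=
  \row_m (if unlift ord0 m is Some i then
    - (th z v ord0 (imag i) + th z v (imag (ordS i)) (imag (ordS (ordS i)))) / 2
    else 0).

End Frames.

(* Z is a nonempty compact oriented spin Einstein 4-orbifold with scalar
   curvature s and anti-self-dual Weyl curvature.  Over each chart the
   Spin(4)-bundle is trivialized by a lift of the frame.  Spin(4) is
   SU(2) x SU(2), acting on R^4 = H by v |-> g v h^-1; the first factor is the
   one acting on Lambda^2_+.  The spin structure is a lift (g, h) of the frame
   change along each embedding of charts, these lifts being a cocycle. *)
Record asd_einstein_spin_orbifold (s : R) := AsdEinsteinSpinOrbifold {
  space : topologicalType;
  space_nonempty : [set: space] !=set0;
  space_compact : compact [set: space];
  space_hausdorff : hausdorff_space space;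
  atlas :> orbifold_atlas space;
  atlas_compat : atlas_compatible atlas;
  cof : chart atlas -> V -> 'M[R]_4;
  cof_smooth : forall a, smooth (dom a) (cof a);
  cof_unit : forall a z, dom a z -> cof a z \in unitmx;
  lc : chart atlas -> V -> V -> 'M[R]_4;
  lc_levi_civita : forall a, levi_civita (cof a) (lc a) (dom a);
  scal_s : forall a z, dom a z -> scalar_curvature (cof a) (lc a) z = s;
  is_einstein : forall a, einstein (cof a) (lc a) (dom a);
  is_weyl_asd : forall a, weyl_asd (cof a) (lc a) (dom a);
  spin_pos : chart atlas -> chart atlas -> (V -> V) -> V -> V;
  spin_neg : chart atlas -> chart atlas -> (V -> V) -> V -> V;
  spin_smooth : forall a b la, embedding a b la ->
    smooth (dom a) (spin_pos a b la) /\ smooth (dom a) (spin_neg a b la);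
  spin_unit : forall a b la, embedding a b la -> forall z, dom a z ->
    qnorm (spin_pos a b la z) = 1 /\ qnorm (spin_neg a b la z) = 1;
  spin_lift : forall a b la, embedding a b la -> forall z v, dom a z ->
    coframe (cof b) (la z) ('D_v la z) =
    qmul (qmul (spin_pos a b la z) (coframe (cof a) z v))
         (qconj (spin_neg a b la z));
  spin_cocycle : forall a b c la mu, embedding a b la -> embedding b c mu ->
    forall z, dom a z ->
    spin_pos a c (mu \o la) z =
      qmul (spin_pos b c mu (la z)) (spin_pos a b la z) /\
    spin_neg a c (mu \o la) z =
      qmul (spin_neg b c mu (la z)) (spin_neg a b la z);
  (* maps with the same restriction to U_a are the same embedding *)
  spin_local : forall a b la la', embedding a b la ->
    (forall z, dom a z -> la z = la' z) -> forall z, dom a z ->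
    spin_pos a b la z = spin_pos a b la' z /\
    spin_neg a b la z = spin_neg a b la' z;
}.

End Orbifolds.

(* The spinor bundle E.  Its orbifold charts are U_a x H, with transition maps
   (z, q) |-> (la z, g(z) q).  Over U_a the bundle X is U_a x SU(2), and
   (r, p) in (0, oo) x X corresponds to q = r p. *)
Section SpinorBundle.
Variables (R : realType) (s : R) (Z : asd_einstein_spin_orbifold s).
Local Notation V := 'rV[R]_4.
Local Notation P := 'rV[R]_8.
Implicit Types (a b : chart Z) (p v w : P).

Definition base p : V := lsubmx (p : 'rV[R]_(4 + 4)).
Definition fibre p : V := rsubmx (p : 'rV[R]_(4 + 4)).

Definition domE a : set P := [set p | dom a (base p)].
Definition domE0 a : set P := [set p | dom a (base p) /\ fibre p != 0].

Definition embeddingE a b (la : V -> V) p : P :=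
  row_mx (la (base p)) (qmul (spin_pos a b la (base p)) (fibre p)) : 'rV_(4 + 4).

Definition radius p : R := qnorm (fibre p).

(* eta = p^-1 dp + p^-1 A p, and p^-1 dp = Im (q^-1 dq) *)
Definition etaH a p v : V :=
  qim (qmul (qinv (fibre p)) (fibre v))
  + qmul (qmul (qinv (fibre p)) (spin_connection (lc a) (base p) (base v)))
         (fibre p).

Definition eta a (i : 'I_3) : dform R 1 8 := fun p v => etaH a p v 0 (imag i).

Definition omega a (i : 'I_3) : dform R 2 8 := fun p M =>
  - (24 / s) * (diff1 (eta a i) p M
     + 2 * dwedge (eta a (ordS i)) (eta a (ordS (ordS i))) p M).

Definition dr : dform R 1 8 := fun p v => 'D_v (fun p' => radius p' : R^o) p.

Section Spin7.
Variables (t nu : R -> R).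

Definition phi a : dform R 3 8 := fun p M =>
  let r := radius p in
  t r ^+ 3
    * dwedge (dwedge (eta a 0) (eta a 1)) (eta a 2) p M
  - t r * nu r ^+ 2 * (s / 48)
    * \sum_(i < 3) dwedge (eta a i) (omega a i) p M.

Definition psi a : dform R 4 8 := fun p M =>
  let r := radius p in
  nu r ^+ 4 / 6 * (s / 48) ^+ 2
    * \sum_(i < 3) dwedge (omega a i) (omega a i) p M
  - nu r ^+ 2 * t r ^+ 2 * (s / 48)
    * \sum_(i < 3) dwedge (dwedge (eta a i) (eta a (ordS i)))
                          (omega a (ordS (ordS i))) p M.

Definition Theta a : dform R 4 8 := fun p M =>
  dwedge dr (phi a) p M + psi a p M.

Definition metric a p v w : R :=
  let r := radius p in
  dr p v * dr p w + t r ^+ 2 * \sum_(i < 3) eta a i p v * eta a i p w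
  + s * nu r ^+ 2 / 48
    * \sum_(m < 4) coframe (cof a) (base p) (base v) 0 m
                 * coframe (cof a) (base p) (base w) 0 m.

Definition gram a p : 'M[R]_8 :=
  \matrix_(i, j) metric a p (basis_vec R i) (basis_vec R j).

Definition orientation a p : R :=
  Num.sg (dwedge (Theta a) (Theta a) p (1%:M : 'M[R]_8)).

(* A family of H-valued 1-forms, one on each chart of E minus Z, standing for a
   connection in the tautological trivialization of the pullback of E. *)
Definition connection := chart Z -> P -> P -> V.

Definition su2_1form (D : set P) (A : P -> P -> V) :=
  smooth_1form D A /\ forall p v, D p -> A p v 0 0 = 0.

Definition smooth_connection (A : connection) :=
  forall a, su2_1form (domE0 a) (A a).

Definition connection_eq (A B : connection) :=
  forall a p v, domE0 a p -> A a p v = B a p v.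

Definition su2_curvature (A : connection) a (i : 'I_3) : dform R 2 8 :=
  fun p M => curvature (@qcomm R) (A a) p (row 0 M) (row 1 M) 0 (imag i).

Definition spin7_instanton (A : connection) :=
  smooth_connection A /\
  forall a p, domE0 a p -> forall (i : 'I_3) (M : 'M[R]_(6, 8)),
    hodge2 (gram a p) (orientation a p) (su2_curvature A a i p) M =
    - dwedge (su2_curvature A a i) (Theta a) p M.

(* x(r) sum_i eta_i (x) T_i *)
Definition radial_connection (x : R -> R) : connection :=
  fun a p v => x (radius p) *: etaH a p v.

Definition gauge_map (u : chart Z -> P -> V) :=
  [/\ forall a, smooth (domE0 a) (u a),
      forall a p, domE0 a p -> qnorm (u a p) = 1 &
      forall a b la, embedding a b la -> forall p, domE0 a p ->
        u b (embeddingE a b la p) = u a p].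

Definition gauge_transform (u : chart Z -> P -> V) (A : connection)
    : connection :=
  fun a p v => qmul (qmul (u a p) (A a p v)) (qconj (u a p))
             - qmul ('D_v (u a) p) (qconj (u a p)).

Definition smoothly_extends (A : connection) :=
  forall a, exists2 B : P -> P -> V, su2_1form (domE a) B &
    forall p v, domE0 a p -> B p v = A a p v.

(* Extension over the zero section is understood up to gauge. *)
Definition extends_on_trivial (A : connection) :=
  exists2 u, gauge_map u & smoothly_extends (gauge_transform u A).

(* The tautological trivialization of the pullback of E differs from the
   trivialization induced from that of E over U_a, which extends over the zero
   section, by the frame p = q / |q|. *)
Definition taut_frame : chart Z -> P -> V :=
  fun _ p => (radius p)^-1 *: fibre p.

Definition extends_on_pullback (A : connection) :=
  exists2 u, gauge_map u &
    smoothly_extends (gauge_transform taut_frame (gauge_transform u A)).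

Definition is_A_y0 (y0 : R) (A : connection) :=
  [/\ spin7_instanton A, extends_on_trivial A &
      exists x y : R -> R,
        [/\ connection_eq A (radial_connection x),
            forall r, 0 < r -> x r = r ^+ 2 * y r,
            real_analytic_on [set r | 0 <= r] y & y 0 = y0]].

Definition is_A_lim (A : connection) :=
  [/\ spin7_instanton A, extends_on_pullback A &
      exists x : R -> R, connection_eq A (radial_connection x) /\
        exists C : R, \forall r \near 0^'+, `|x r - 1| <= C * r ^+ 2].

End Spin7.
End SpinorBundle.

Definition spin7_profile (R : realType) (nu0 : R) (t nu : R -> R) :=
  [/\ t 0 = 0 /\ nu 0 = nu0,
      t @ 0^'+ --> t 0 /\ nu @ 0^'+ --> nu 0,
      forall r : R, 0 < r -> {for r, continuous nu},
      forall r : R, 0 < r -> is_derive r 1 (fun u => nu u ^+ 2 : R^o) (6 * t r) &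
      forall r : R, 0 < r ->
        is_derive r 1 (t : R -> R^o) (1 - 2 * t r ^+ 2 / nu r ^+ 2)].

(* Main.v *)
(** In the coframe of g_Theta made of dr, the t eta_i and a multiple of the
    horizontal coframe rotated by q / |q|, Theta is the Cayley form with constant
    coefficients.  The curvature of x(r) eta has in it the components
    [x' / t], [2 (x^2 - x) / t^2] and [- 2 x / nu^2] along three 2-forms, and the
    instanton equation is the single linear relation
    [x' / t + 2 (x^2 - x) / t^2 + 4 x / nu^2 = 0] between them.  For
    [w = x / t^2] this is [w' = - 2 t w^2], solved by
    [w = k / (c + 2 k int_0^r t)]; the behaviour of x as r tends to 0 selects
    (c, k) = (1, y0) for A_y0 and (0, 1) for A_lim.

    Conversely, t, 1 / nu^2 and the quotients of them that occur in these
    solutions satisfy quadratic systems of differential equations, hence are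
    sums of power series in r of a definite parity.  Each coefficient of the
    extended connection is therefore a power series in r^2 = |q|^2, which is
    smooth across the zero section: in the given trivialization of A_y0, and in
    the gauge q / |q| for A_lim. *)

Require Import Defs.
From HB Require Import structures.
From mathcomp Require Import all_boot all_order all_algebra all_fingroup.
From mathcomp Require Import all_classical all_reals all_analysis.
From mathcomp Require Import ring lra.

Set Implicit Arguments.
Unset Strict Implicit.
Unset Printing Implicit Defensive.

Import Order.TTheory GRing.Theory Num.Theory.
Import numFieldNormedType.Exports.

Local Open Scope classical_set_scope.
Local Open Scope ring_scope.

(** * Signed sums of determinant monomials *)

(** The single relation comes from the splitting of 2-forms under Spin(7): [*a + a /\ Theta] sees
    only the 7-dimensional summand, and [dr /\ t eta_i], [t^2 eta_j /\ eta_k] and the rescaled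
    [omega_i] have parallel components there, in the ratio 1 : 1 : -2, where -2 is minus the squared
    norm of the third form. In the adapted coframe every form involved has constant coefficients, so
    these facts become computations on signed lists of indices. The orientation of that coframe is
    never determined: its sign enters both the Hodge star and the orientation given by
    [Theta /\ Theta], and cancels.

    At r = 0 the profile is only known to be right-continuous, and the instanton equation is
    singular there. Hence Taylor coefficients are defined by recursion from the values of the
    unknowns, the remainder is estimated by moving the centre of expansion through r > 0, and
    uniqueness comes from a monotone quantity. The integral of t causes no difficulty:
    [(nu^2)' = 6 t] makes it [(nu^2 - nu0^2) / 6], one more unknown of the quadratic system. *)

Section Laplace.
Variable R : comNzRingType.

(** Expanding both block determinants over permutations turns the sum over [s] into the determinant
    of a matrix whose two blocks of rows have been permuted separately. The two signs cancel, so
    each of the [k! l!] pairs contributes [\det X]. This matches the normalization of [wedge]. *)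
Lemma laplace_expansion k l (X : 'M[R]_(k + l)) :
  \sum_(s : 'S_(k + l)) (-1) ^+ s * \det (ulsubmx (row_perm s X))
     * \det (drsubmx (row_perm s X)) = (k`! * l`!)%:R * \det X.
Proof.
transitivity (\sum_(sg : 'S_k) \sum_(ta : 'S_l)
  (-1) ^+ sg * (-1) ^+ ta *
   \det (col_mx (row_perm sg (usubmx X^T)) (row_perm ta (dsubmx X^T)))).
  under [RHS]eq_bigr => sg _ do under eq_bigr => ta _ do rewrite mulr_sumr.
  under [RHS]eq_bigr => sg _ do rewrite exchange_big.
  rewrite exchange_big; apply: eq_bigr => s _ /=.
  rewrite -mulrA [X in _ * (X * _)]/determinant [X in _ * (_ * X)]/determinant.
  rewrite mulr_suml mulr_sumr; apply: eq_bigr => sg _.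
  rewrite !mulr_sumr; apply: eq_bigr => ta _.
  rewrite big_split_ord /=.
  under [in RHS]eq_bigr => i _ do rewrite col_mxEu !mxE.
  under [X in _ = _ * (_ * (_ * X))]eq_bigr => i _ do rewrite col_mxEd !mxE.
  under eq_bigr => i _ do rewrite !mxE.
  under [X in _ * (_ * (_ * X)) = _]eq_bigr => i _ do rewrite !mxE.
  move: (\prod_(i < k) _) (\prod_(i < l) _) => u v.
  by move: ((-1) ^+ s) ((-1) ^+ sg) ((-1) ^+ ta) => e1 e2 e3; ring.
transitivity (\sum_(sg : 'S_k) \sum_(ta : 'S_l) \det X).
  apply: eq_bigr => sg _; apply: eq_bigr => ta _.
  have -> : col_mx (row_perm sg (usubmx X^T)) (row_perm ta (dsubmx X^T))
    = block_mx (perm_mx sg) 0 0 (perm_mx ta) *m X^T.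
    rewrite -[in RHS](vsubmxK X^T) mul_block_col !mul0mx addr0 add0r.
    by rewrite !row_permE.
  rewrite det_mulmx det_ublock !det_perm det_tr mulrA.
  rewrite -[X in X * \det _]/(_ * ((-1) ^+ sg * (-1) ^+ ta)).
  by rewrite mulrACA -!expr2 !sqrr_sign !mul1r.
rewrite !sumr_const !card_Sn -mulrnA mulr_natl.
by rewrite mulnC.
Qed.

Lemma det_row_linear n (i0 : 'I_n) (A : 'rV[R]_n -> 'M[R]_n) :
  (forall u, row i0 (A u) = u) -> (forall u v, row' i0 (A u) = row' i0 (A v)) ->
  forall u, \det (A u) = \sum_j u 0 j * \det (A (delta_mx 0 j)).
Proof.
move=> hr hr' u; rewrite (expand_det_row _ i0); apply: eq_bigr => j _.
have rE v k : A v i0 k = v 0 k by rewrite -[in RHS](hr v) mxE.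
rewrite rE; congr (_ * _).
rewrite (expand_det_row (A (delta_mx 0 j)) i0) (bigD1 j) //= rE mxE !eqxx mul1r.
rewrite big1 ?addr0 => [|k /negPf kj]; last by rewrite rE mxE kj andbF mul0r.
rewrite /cofactor; congr (_ * \det _); apply/matrixP => a b.
by have /matrixP /(_ a (lift j b)) := hr' u (delta_mx 0 j); rewrite !mxE.
Qed.

End Laplace.

(** * Computing in the exterior algebra with signed lists of indices *)

Fixpoint insert_sign (a : nat) (l : seq nat) : bool * seq nat :=
  if l is b :: l' then
    if (a <= b)%N then (false, a :: l)
    else (~~ (insert_sign a l').1, b :: (insert_sign a l').2)
  else (false, [:: a]).

(** Insertion sort recording the parity of the transpositions made; [true] stands for a minus sign.
    A repeated index causes no sign change, which is harmless because its monomial vanishes. *)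
Fixpoint sort_sign (l : seq nat) : bool * seq nat :=
  if l is a :: l' then
    ((sort_sign l').1 (+) (insert_sign a (sort_sign l').2).1,
     (insert_sign a (sort_sign l').2).2)
  else (false, [::]).

Lemma size_insert_sign a l : size (insert_sign a l).2 = (size l).+1.
Proof. by elim: l => //= b l IH; case: ifP => //= _; rewrite IH. Qed.

Lemma size_sort_sign l : size (sort_sign l).2 = size l.
Proof. by elim: l => //= a l IH; rewrite size_insert_sign IH. Qed.

(** A sum of monomials with coefficients +1 or -1 in a fixed coframe. Keeping it as data lets
    [vm_compute] perform wedge products and Hodge stars before any real number appears. *)
Definition signed_terms := seq (bool * seq nat).

Definition swedge (L1 L2 : signed_terms) : signed_terms :=
  [seq x <- [seq (x.1 (+) y.1 (+) (sort_sign (x.2 ++ y.2)).1,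
                  (sort_sign (x.2 ++ y.2)).2) | x <- L1, y <- L2] | uniq x.2].

Definition complement8 (s : seq nat) : seq nat :=
  [seq x <- iota 0 8 | x \notin s].

(** The Hodge star of an oriented orthonormal coframe of R^8: the sign is that of the permutation
    listing the indices and then their complement. *)
Definition shodge (L : signed_terms) : signed_terms :=
  [seq (x.1 (+) (sort_sign (x.2 ++ complement8 x.2)).1, complement8 x.2)
  | x <- L].

Section Monomials.
Variable R : realType.

(** The wedge product of the coordinate covectors listed in [s], as the minor of [M] on those
    columns; [inord] only makes it total. *)
Definition mono k n (s : seq nat) : Defs.form R k n.+1 :=
  fun M => \det (\matrix_(i < k, j < k) M i (inord (nth 0%N s j))).

Definition seval k n (L : signed_terms) : Defs.form R k n.+1 :=
  fun M => \sum_(x <- L) (-1) ^+ x.1 * mono x.2 M.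

Lemma wedge_mono k l n (s1 s2 : seq nat) : size s1 = k ->
  wedge (@mono k n s1) (@mono l n s2) = @mono (k + l) n (s1 ++ s2).
Proof.
move=> hs; apply/funext => M; rewrite /wedge /mono.
set X := (X in _ = \det X).
have h : ((k`! * l`!)%:R : R) != 0.
  by rewrite pnatr_eq0 -lt0n muln_gt0 !fact_gt0.
apply: (mulfI h); rewrite mulrA divff // mul1r -laplace_expansion.
apply: eq_bigr => s _; rewrite -!mulrA; apply: congr1.
have -> : ulsubmx (row_perm s X)
    = \matrix_(i, j) usubmx (row_perm s M) i (inord (nth 0%N s1 j)).
  apply/matrixP => i j; rewrite !mxE; congr (M _ (inord _)).
  by rewrite nth_cat /= hs ltn_ord.
have -> // : drsubmx (row_perm s X)
    = \matrix_(i, j) dsubmx (row_perm s M) i (inord (nth 0%N s2 j)).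
apply/matrixP => i j; rewrite !mxE; congr (M _ (inord _)).
by rewrite nth_cat /= hs ltnNge leq_addr /= addKn.
Qed.

Lemma mono_swap k n pre a b suf (M : 'M[R]_(k, n.+1)) :
  (size pre + 2 <= k)%N ->
  mono (pre ++ a :: b :: suf) M = - mono (pre ++ b :: a :: suf) M.
Proof.
move=> hk.
have h0 : (size pre < k)%N by rewrite (leq_trans _ hk) // addn2.
have h1 : ((size pre).+1 < k)%N by rewrite (leq_trans _ hk) // addn2.
pose i0 := Ordinal h0; pose i1 := Ordinal h1.
rewrite /mono; set A := (X in \det X = _); set B := (X in _ = - \det X).
have -> : A = xcol i0 i1 B.
  apply/matrixP => i j; rewrite !mxE; congr (M _ (inord _)).
  case: tpermP => [->|->|/eqP hj0 /eqP hj1] /=.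
  - by rewrite !nth_cat ltnn subnn /= ltnNge leqnSn /= subSnn.
  - by rewrite !nth_cat ltnn subnn /= ltnNge leqnSn /= subSnn.
  - rewrite !nth_cat; case: ltnP => // hj.
    have : (j - size pre != 0)%N.
      apply: contraNneq hj0 => h; rewrite -val_eqE /= eqn_leq hj andbT.
      by rewrite -subn_eq0 h.
    have : (j - size pre != 1)%N.
      apply: contraNneq hj1 => h; rewrite -val_eqE /=.
      by rewrite -(subnK hj) h.
    by case: (j - size pre)%N => [|[|]].
have ne : i0 != i1 by rewrite -val_eqE /= neq_ltn ltnSn.
by rewrite xcolE det_mulmx det_perm odd_tperm ne mulrN1.
Qed.

Lemma mono_dup k n s (M : 'M[R]_(k, n.+1)) : size s = k -> ~~ uniq s ->
  mono s M = 0.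
Proof.
move=> hs /(uniqPn 0%N) [i [j [hij hj heq]]]; rewrite hs in hj.
have hi := ltn_trans hij hj.
rewrite /mono -det_tr.
apply: (@determinant_alternate _ _ _ (Ordinal hi) (Ordinal hj)).
  by rewrite -val_eqE /= neq_ltn hij.
by move=> m; rewrite !mxE /= heq.
Qed.

Lemma mono_insert k n pre a l (M : 'M[R]_(k, n.+1)) :
  (size pre + (size l).+1 <= k)%N ->
  mono (pre ++ a :: l) M
  = (-1) ^+ (insert_sign a l).1 * mono (pre ++ (insert_sign a l).2) M.
Proof.
elim: l pre => [|b l IH] pre /= hk; first by rewrite mul1r.
case: ifP => _ /=; first by rewrite mul1r.
rewrite mono_swap; last by rewrite (leq_trans _ hk) // leq_add2l.
rewrite -cat_rcons IH; last by rewrite size_rcons addSnnS.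
by rewrite cat_rcons signrN mulNr.
Qed.

Lemma mono_sort k n pre l (M : 'M[R]_(k, n.+1)) :
  (size pre + size l <= k)%N ->
  mono (pre ++ l) M = (-1) ^+ (sort_sign l).1 * mono (pre ++ (sort_sign l).2) M.
Proof.
elim: l pre => [|a l IH] pre /= hk; first by rewrite mul1r.
rewrite -cat_rcons IH; last by rewrite size_rcons addSnnS.
rewrite cat_rcons mono_insert ?size_sort_sign //.
by rewrite signr_addb mulrA.
Qed.

Lemma wedge_suml k l n (I : Type) (r : seq I) (c : I -> R)
    (a : I -> Defs.form R k n) (b : Defs.form R l n) :
  wedge (fun M => \sum_(i <- r) c i * a i M) b
  = fun M => \sum_(i <- r) c i * wedge (a i) b M.
Proof.
apply/funext => M; rewrite /wedge.
under [RHS]eq_bigr => i _ do rewrite mulrCA mulr_sumr.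
rewrite -mulr_sumr exchange_big; congr (_ * _); apply: eq_bigr => s _ /=.
rewrite mulr_sumr mulr_suml; by apply: eq_bigr => i _; move: ((-1) ^+ s) => e; ring.
Qed.

Lemma wedge_sumr k l n (I : Type) (r : seq I) (c : I -> R)
    (a : Defs.form R k n) (b : I -> Defs.form R l n) :
  wedge a (fun M => \sum_(i <- r) c i * b i M)
  = fun M => \sum_(i <- r) c i * wedge a (b i) M.
Proof.
apply/funext => M; rewrite /wedge.
under [RHS]eq_bigr => i _ do rewrite mulrCA mulr_sumr.
rewrite -mulr_sumr exchange_big; congr (_ * _); apply: eq_bigr => s _ /=.
rewrite mulr_sumr; by apply: eq_bigr => i _; move: ((-1) ^+ s) => e; ring.
Qed.

Lemma wedgeZl k l n (c : R) (a : Defs.form R k n) (b : Defs.form R l n) :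
  wedge (fun M => c * a M) b = fun M => c * wedge a b M.
Proof.
have := @wedge_suml k l n unit [:: tt] (fun=> c) (fun=> a) b.
have E f : \sum_(i <- [:: tt]) f i = f tt :> R by rewrite big_seq1.
by under eq_fun do rewrite E; under [RHS]eq_fun do rewrite E.
Qed.

Lemma wedgeZr k l n (c : R) (a : Defs.form R k n) (b : Defs.form R l n) :
  wedge a (fun M => c * b M) = fun M => c * wedge a b M.
Proof.
have := @wedge_sumr k l n unit [:: tt] (fun=> c) a (fun=> b).
have E f : \sum_(i <- [:: tt]) f i = f tt :> R by rewrite big_seq1.
by under eq_fun do rewrite E; under [RHS]eq_fun do rewrite E.
Qed.

Lemma wedge_pullback k l n m (C : 'M[R]_(n, m)) (a : Defs.form R k m)
    (b : Defs.form R l m) M :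
  wedge (fun N => a (N *m C)) (fun N => b (N *m C)) M = wedge a b (M *m C).
Proof.
rewrite /wedge; congr (_ * _); apply: eq_bigr => s _.
have -> : row_perm s (M *m C) = row_perm s M *m C by rewrite !row_permE mulmxA.
by rewrite -[row_perm s M in RHS]vsubmxK mul_col_mx col_mxKu col_mxKd.
Qed.

Lemma wedge_seval k l n (L1 L2 : signed_terms) :
  all (fun x => size x.2 == k) L1 -> all (fun x => size x.2 == l) L2 ->
  wedge (@seval k n L1) (@seval l n L2) = @seval (k + l) n (swedge L1 L2).
Proof.
move=> /allP h1 /allP h2; apply/funext => M.
rewrite wedge_suml {2}/seval /swedge big_filter [RHS]big_mkcond /=.
rewrite big_allpairs_dep /= !big_seq.
apply: eq_bigr => x xL1; rewrite wedge_sumr mulr_sumr !big_seq.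
apply: eq_bigr => y yL2 /=.
have /eqP hx := h1 _ xL1; have /eqP hy := h2 _ yL2.
have hs : size (x.2 ++ y.2) = (k + l)%N by rewrite size_cat hx hy.
rewrite wedge_mono // (@mono_sort _ _ [::] (x.2 ++ y.2)) /= ?hs //.
rewrite !mulrA -!signr_addb.
by case: ifPn => // hu; rewrite mono_dup ?mulr0 // size_sort_sign.
Qed.

(** Moving columns p and q to the front makes the matrix block lower triangular with an identity
    block, since the first two rows vanish on the complementary columns. *)
Lemma mono_hodge (p q : nat) (N : 'M[R]_(6, 8)) :
  (p < 8)%N -> (q < 8)%N -> p != q ->
  \det (col_mx (col_mx (basis_vec R (inord p)) (basis_vec R (inord q))) N
        : 'M[R]_8)
  = (-1) ^+ (sort_sign (p :: q :: complement8 [:: p; q])).1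
    * mono (complement8 [:: p; q]) N.
Proof.
move=> hp hq pq.
set X := col_mx _ N; set rest := complement8 [:: p; q].
have sorted_pq : (sort_sign (p :: q :: rest)).2 = iota 0 8
    /\ size rest = 6%N.
  (* A finite check over all pairs of distinct indices below 8. *)
  rewrite /rest.
  move: p q hp hq pq {X rest}.
  by do 8 (case => [|]; [do 8 (case => [//|]); by []|]).
have [hs hr] := sorted_pq.
have -> : \det X = @mono 8 7 (iota 0 8) X.
  rewrite /mono; congr (\det _); apply/matrixP => i j; rewrite [RHS]mxE.
  by rewrite nth_iota ?ltn_ord // add0n inord_val.
have h := @mono_sort 8 7 [::] (p :: q :: rest) X; rewrite /= in h.
rewrite -[X in mono X]hs; set sg := (sort_sign _).1.
have {}h : mono (p :: q :: rest) X
    = (-1) ^+ sg * mono (sort_sign (p :: q :: rest)).2 X.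
  by apply: h; rewrite hr.
have -> : mono (sort_sign (p :: q :: rest)).2 X
    = (-1) ^+ sg * mono (p :: q :: rest) X.
  by rewrite h mulrA -expr2 sqrr_sign mul1r.
congr (_ * _).
rewrite /mono; set A := (A in \det A = _).
have nin (x y : nat) : (x < 8)%N -> (y < 8)%N ->
    (inord x == inord y :> 'I_8) = (x == y).
  by move=> hx hy; rewrite -val_eqE /= !inordK.
have hrest (j : 'I_6) : [/\ (nth 0%N rest j < 8)%N, nth 0%N rest j != p
   & nth 0%N rest j != q].
  have : nth 0%N rest j \in rest by rewrite mem_nth // hr.
  rewrite mem_filter mem_iota add0n !inE negb_or.
  by case/andP => /andP[-> ->] /andP[_ ->].
have -> : A = block_mx (1%:M : 'M[R]_(1 + 1)) 0
   (\matrix_(i < 6, j < 2) A (rshift 2 i) (lshift 6 j))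
   (\matrix_(i < 6, j < 6) N i (inord (nth 0%N rest j))).
  apply/matrixP => i j.
  case: (split_ordP i) => i' ->; case: (split_ordP j) => j' ->.
  - rewrite block_mxEul mxE /X col_mxEu [RHS]mxE.
    case: (split_ordP i') => i1 ->; rewrite ?col_mxEu ?col_mxEd !mxE (ord1 i1) eqxx /=.
      case: j' => [[|[|//]]] hj /=; rewrite nin //; rewrite ?eqxx //.
      by rewrite eq_sym (negPf pq).
    case: j' => [[|[|//]]] hj /=; rewrite nin //; rewrite ?eqxx //.
    by rewrite (negPf pq).
  - rewrite block_mxEur mxE /X col_mxEu [RHS]mxE.
    have [h8 np nq] := hrest j'.
    case: (split_ordP i') => i1 ->; rewrite ?col_mxEu ?col_mxEd !mxE (ord1 i1) eqxx /=.
      by rewrite nin // (negPf np).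
    by rewrite nin // (negPf nq).
  - by rewrite block_mxEdl [RHS]mxE.
  - by rewrite block_mxEdr [LHS]mxE /X col_mxEd [RHS]mxE.
by rewrite det_lblock det1 mul1r.
Qed.

End Monomials.

(** * The Cayley form and the instanton equation on a Euclidean space *)

Section Hodge.
Variable R : realType.
Implicit Types (C : 'M[R]_8) (M : 'M[R]_(6, 8)).

Definition cvol M (u v : 'rV[R]_8) : R :=
  \det (col_mx (col_mx u v) M : 'M[R]_8).

Lemma cvol_swap M u v : cvol M v u = - cvol M u v.
Proof.
rewrite /cvol; set A := (X in \det X = _); set B := (X in _ = - \det X).
pose i0 : 'I_(1 + 1 + 6) := lshift 6 (lshift 1 (ord0 : 'I_1)).
pose i1 : 'I_(1 + 1 + 6) := lshift 6 (rshift 1 (ord0 : 'I_1)).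
have -> : A = xrow i0 i1 B.
  apply/matrixP => i j; rewrite [RHS]mxE.
  case: tpermP => [->|->|/eqP h0 /eqP h1].
  - by rewrite /A /B /i0 /i1 !col_mxEu col_mxEd.
  - by rewrite /A /B /i0 /i1 !col_mxEu col_mxEd.
  - rewrite /A /B; case: (split_ordP (i : 'I_(1 + 1 + 6))) h0 h1 => i' ->.
      rewrite !col_mxEu; case: (split_ordP i') => i'' ->; rewrite (ord1 i'').
        by rewrite eqxx.
      by move=> _; rewrite eqxx.
    by rewrite !col_mxEd.
by rewrite xrowE det_mulmx det_perm odd_tperm mulN1r.
Qed.

Lemma cvol_suml M u v :
  cvol M u v = \sum_i u 0 i * cvol M (basis_vec R i) v.
Proof.
rewrite /cvol; pose i0 : 'I_(1 + 1 + 6) := lshift 6 (lshift 1 (ord0 : 'I_1)).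
apply: (@det_row_linear R (1 + 1 + 6) i0 (fun u => col_mx (col_mx u v) M)) => [w|w w'].
  by apply/rowP => j; rewrite mxE /i0 !col_mxEu.
apply/matrixP => i j; rewrite !mxE.
have : lift i0 i != i0 by rewrite eq_sym neq_lift.
case: (split_ordP (lift i0 i : 'I_(1 + 1 + 6))) => i' -> //.
case: (split_ordP i') => i'' ->; first by rewrite (ord1 i'') eqxx.
by move=> _; rewrite !col_mxEd.
Qed.

Lemma cvol_sum M u v : cvol M u v
  = \sum_i \sum_j u 0 i * v 0 j * cvol M (basis_vec R i) (basis_vec R j).
Proof.
rewrite cvol_suml; apply: eq_bigr => i _.
rewrite -[cvol _ _ _]opprK -cvol_swap cvol_suml -sumrN mulr_sumr.
by apply: eq_bigr => j _; rewrite -mulrN -cvol_swap mulrA.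
Qed.

Lemma cvol_mulmx M u v C :
  cvol M u v * \det C = cvol (M *m C) (u *m C) (v *m C).
Proof.
rewrite /cvol -det_mulmx; congr (\det _).
by rewrite -!mul_col_mx.
Qed.

Lemma mulmx_delta (n : nat) (A B : 'M[R]_n) (p q i j : 'I_n) :
  (A *m delta_mx p q *m B) i j = A i p * B q j.
Proof.
rewrite -(mul_delta_mx (ord0 : 'I_1)) mulmxA -colE -mulmxA -rowE.
by rewrite mxE big_ord1 !mxE.
Qed.

Lemma det2 (A : 'M[R]_2) : \det A = A 0 0 * A 1 1 - A 0 1 * A 1 0.
Proof.
rewrite (expand_det_row _ ord0) !big_ord_recl big_ord0 addr0 /cofactor /=.
rewrite !det_mx11 !mxE expr0 expr1 mul1r mulN1r mulrN.
by congr (A _ _ * A _ _ - A _ _ * A _ _); apply/val_inj.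
Qed.

Lemma mono2E n (p q : nat) (u v : 'rV[R]_n.+1) :
  mono [:: p; q] (col_mx u v)
  = u 0 (inord p) * v 0 (inord q) - u 0 (inord q) * v 0 (inord p).
Proof.
rewrite /mono det2 !mxE /=.
have -> : (0 : 'I_2) = lshift 1 (0 : 'I_1) by exact/val_inj.
have -> : (1 : 'I_2) = rshift 1 (0 : 'I_1) by exact/val_inj.
rewrite -!/(unsplit (inl _)) -!/(unsplit (inr _)) !unsplitK; ring.
Qed.

(** The rows of [C] are the components of the coordinate vectors in an orthonormal coframe. Raising
    indices with the inverse Gram matrix yields the dual vectors, the rows p and q of the inverse of
    [C]; the factor 1/2 absorbs the two orders. Since the square root of the Gram determinant is the
    absolute value of [\det C], only its sign survives. *)
Lemma hodge2_mono C eps p q M : C \in unitmx ->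
  (p < 8)%N -> (q < 8)%N -> p != q ->
  hodge2 (C *m C^T) eps (fun N => mono [:: p; q] (N *m C)) M
  = eps * Num.sg (\det C)
    * ((-1) ^+ (sort_sign (p :: q :: complement8 [:: p; q])).1
       * mono (complement8 [:: p; q]) (M *m C)).
Proof.
move=> hC hp hq pq; rewrite /hodge2.
set p' : 'I_8 := inord p; set q' : 'I_8 := inord q.
set D := invmx C.
have subE (A B : 'M[R]_8) i j : (A - B) i j = A i j - B i j by rewrite !mxE.
have hA : \matrix_(i, j) mono [:: p; q] (col_mx (basis_vec R i) (basis_vec R j) *m C)
  = C *m (delta_mx p' q' - delta_mx q' p') *m C^T.
  apply/matrixP => i j; rewrite mxE mul_col_mx mono2E mulmxBr mulmxBl.
  rewrite subE !mulmx_delta -!rowE !mxE -/p' -/q'; ring.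
have hG : invmx (C *m C^T) = D^T *m D.
  have hu : C *m C^T \in unitmx by rewrite unitmx_mul unitmx_tr hC.
  apply: (can_inj (mulKmx hu)).
  rewrite mulmxV // mulmxA -(mulmxA C) -trmx_mul mulVmx // trmx1 mulmx1.
  by rewrite mulmxV.
set up := (X in \sum_i \sum_j X i j * _).
have hup i j : up i j = D p' i * D q' j - D q' i * D p' j.
  rewrite /up hA hG.
  have -> : D^T *m D *m (C *m (delta_mx p' q' - delta_mx q' p') *m C^T) *m
      (D^T *m D) = D^T *m (delta_mx p' q' - delta_mx q' p') *m D.
    rewrite !mulmxA -(mulmxA D^T D C) mulVmx // mulmx1.
    by rewrite -(mulmxA _ C^T D^T) -trmx_mul mulVmx // trmx1 mulmx1.
  by rewrite mulmxBr mulmxBl subE !mulmx_delta !mxE.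
set vol := eps * Num.sqrt _.
have -> : 2^-1 * (\sum_i \sum_j up i j * (vol * \det (col_mx (col_mx
     (basis_vec R i) (basis_vec R j)) M : 'M[R]_8)))
   = vol * cvol M (row p' D) (row q' D).
  transitivity (2^-1 * (vol * cvol M (row p' D) (row q' D)
     - vol * cvol M (row q' D) (row p' D))).
    congr (_ * _); rewrite !cvol_sum !mulr_sumr -sumrB; apply: eq_bigr => i _.
    rewrite !mulr_sumr -sumrB; apply: eq_bigr => j _.
    rewrite hup !mxE /cvol.
    by move: (\det _) => d; ring.
  by rewrite (cvol_swap _ (row p' D)); field.
rewrite /vol det_mulmx det_tr -expr2 sqrtr_sqr normrEsg.
have -> : eps * (Num.sg (\det C) * \det C) * cvol M (row p' D) (row q' D)
  = eps * Num.sg (\det C) * (cvol M (row p' D) (row q' D) * \det C) by ring.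
congr (_ * _); rewrite cvol_mulmx -!row_mul mulVmx //.
by rewrite !row1 -mono_hodge.
Qed.

Lemma hodge2_sum (G : 'M[R]_8) eps (I : Type) (r : seq I) (c : I -> R)
    (a : I -> Defs.form R 2 8) M :
  hodge2 G eps (fun N => \sum_(x <- r) c x * a x N) M
  = \sum_(x <- r) c x * hodge2 G eps (a x) M.
Proof.
rewrite /hodge2.
have -> : \matrix_(i, j) (\sum_(x <- r) c x * a x (col_mx (basis_vec R i)
   (basis_vec R j))) = \sum_(x <- r) c x *: \matrix_(i, j) a x (col_mx
   (basis_vec R i) (basis_vec R j)).
  apply/matrixP => i j; rewrite mxE summxE; apply: eq_bigr => x _.
  by rewrite !mxE.
rewrite mulmx_sumr mulmx_suml.
transitivity (2^-1 * \sum_(i < 8) \sum_(j < 8) \sum_(x <- r) c x *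
   ((invmx G *m \matrix_(i, j) a x (col_mx (basis_vec R i) (basis_vec R j))
      *m invmx G) i j * (eps * Num.sqrt (\det G)
   * \det (col_mx (col_mx (basis_vec R i) (basis_vec R j)) M : 'M[R]_8)))); last first.
  under [RHS]eq_bigr => x _ do rewrite mulrCA.
  rewrite -mulr_sumr; apply: congr1.
  under eq_bigr => i _ do rewrite exchange_big.
  rewrite exchange_big /=; apply: eq_bigr => x _; rewrite mulr_sumr.
  by apply: eq_bigr => i _; rewrite mulr_sumr.
apply: congr1; apply: eq_bigr => i _; apply: eq_bigr => j _.
rewrite summxE mulr_suml; apply: eq_bigr => x _.
rewrite -scalemxAr -scalemxAl; move: (invmx G *m _ *m invmx G) => Y.
have -> : (c x *: Y) i j = c x * Y i j by rewrite mxE.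
by rewrite -!mulrA.
Qed.

Definition index_pair (s : seq nat) :=
  if s is [:: p; q] then [&& (p < 8)%N, (q < 8)%N & p != q] else false.

Lemma hodge2_seval C eps L M : C \in unitmx ->
  all (fun x => index_pair x.2) L ->
  hodge2 (C *m C^T) eps (fun N => seval L (N *m C)) M
  = eps * Num.sg (\det C) * seval (shodge L) (M *m C).
Proof.
move=> hC /allP hL; rewrite /seval hodge2_sum /shodge big_map mulr_sumr.
rewrite !big_seq; apply: eq_bigr => x /hL.
case: x => b [|p [|q [|]]] //= /and3P[hp hq pq].
rewrite hodge2_mono // signr_addb /=.
by move: ((-1) ^+ b) => e; ring.
Qed.

End Hodge.

Section Cayley.
Variable R : realType.

(* The indices are 0..3 for the horizontal coframe, 4 for dr and 5, 6, 7 for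
   the vertical coframe t eta_i. *)
Definition cayley : signed_terms := [::
  (false, [:: 4; 5; 6; 7]); (false, [:: 0; 1; 2; 3]);
  (true, [:: 0; 1; 4; 5]); (true, [:: 2; 3; 4; 5]);
  (true, [:: 0; 2; 4; 6]); (false, [:: 1; 3; 4; 6]);
  (true, [:: 0; 3; 4; 7]); (true, [:: 1; 2; 4; 7]);
  (true, [:: 0; 3; 5; 6]); (true, [:: 1; 2; 5; 6]);
  (true, [:: 0; 1; 6; 7]); (true, [:: 2; 3; 6; 7]);
  (false, [:: 0; 2; 5; 7]); (true, [:: 1; 3; 5; 7])]%N.

Definition dr_f (i : nat) : signed_terms := [:: (false, [:: 4; 5 + i])]%N.
Definition f_f (i : nat) : signed_terms :=
  [:: (false, [:: 5 + i.+1 %% 3; 5 + i.+2 %% 3])]%N.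
Definition om (i : nat) : signed_terms :=
  [:: (false, [:: 0; i.+1]); (false, [:: (i.+1 %% 3).+1; (i.+2 %% 3).+1])]%N.

(** The 6-form [*a + a /\ Theta] for [a = dr /\ t eta_i], whose vanishing for a curvature form is
    the instanton equation. *)
Definition defect (i : nat) : signed_terms :=
  shodge (dr_f i) ++ swedge (dr_f i) cayley.

(** All lists produced are sorted, so the identities hold term by term with the monomials replaced
    by arbitrary values [m], and [ring] suffices after the lists are computed. The 7-dimensional
    summand is met in the direction of [dr_f + f_f - om], whose inner products with the three forms
    are 1, 1 and -2. *)
Lemma cayley_defect (m : seq nat -> R) (ev := fun L : signed_terms =>
    \sum_(x <- L) (-1) ^+ x.1 * m x.2) (i : nat) : (i < 3)%N ->
  ev (shodge (f_f i)) + ev (swedge (f_f i) cayley)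
    = ev (shodge (dr_f i)) + ev (swedge (dr_f i) cayley) /\
  ev (shodge (om i)) + ev (swedge (om i) cayley)
    = - 2 * (ev (shodge (dr_f i)) + ev (swedge (dr_f i) cayley)).
Proof.
rewrite /ev; case: i => [|[|[|i]]] hi; [split|split|split|exfalso; by []].
- set L1 := shodge _; set L2 := swedge _ _; set L3 := shodge _; set L4 := swedge _ _.
  vm_compute in L1, L2, L3, L4; rewrite /L1 /L2 /L3 /L4 !big_cons !big_nil; simpl; ring.
- set L1 := shodge _; set L2 := swedge _ _; set L3 := shodge _; set L4 := swedge _ _.
  vm_compute in L1, L2, L3, L4; rewrite /L1 /L2 /L3 /L4 !big_cons !big_nil; simpl; ring.
- set L1 := shodge _; set L2 := swedge _ _; set L3 := shodge _; set L4 := swedge _ _.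
  vm_compute in L1, L2, L3, L4; rewrite /L1 /L2 /L3 /L4 !big_cons !big_nil; simpl; ring.
- set L1 := shodge _; set L2 := swedge _ _; set L3 := shodge _; set L4 := swedge _ _.
  vm_compute in L1, L2, L3, L4; rewrite /L1 /L2 /L3 /L4 !big_cons !big_nil; simpl; ring.
- set L1 := shodge _; set L2 := swedge _ _; set L3 := shodge _; set L4 := swedge _ _.
  vm_compute in L1, L2, L3, L4; rewrite /L1 /L2 /L3 /L4 !big_cons !big_nil; simpl; ring.
- set L1 := shodge _; set L2 := swedge _ _; set L3 := shodge _; set L4 := swedge _ _.
  vm_compute in L1, L2, L3, L4; rewrite /L1 /L2 /L3 /L4 !big_cons !big_nil; simpl; ring.
Qed.

Lemma seval_defect k n (N : 'M[R]_(k, n.+1)) (i : nat) : (i < 3)%N ->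
  [/\ seval (shodge (dr_f i)) N + seval (swedge (dr_f i) cayley) N
      = seval (defect i) N,
    seval (shodge (f_f i)) N + seval (swedge (f_f i) cayley) N
      = seval (defect i) N &
    seval (shodge (om i)) N + seval (swedge (om i) cayley) N
      = - 2 * seval (defect i) N].
Proof.
move=> hi; have [h1 h2] := cayley_defect (fun s => mono s N) hi.
have h : seval (shodge (dr_f i)) N + seval (swedge (dr_f i) cayley) N
  = seval (defect i) N by exact/esym/big_cat.
by split; [|rewrite -h|rewrite -h].
Qed.

Definition basis_rows k n (s : seq nat) : 'M[R]_(k, n.+1) :=
  \matrix_(i < k, j < n.+1) (j == inord (nth 0%N s i))%:R.

Lemma mono_basis_rows k n s : size s = k -> uniq s ->
  all (fun x => x < n.+1)%N s -> mono s (basis_rows k n s) = 1.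
Proof.
move=> hs hu /allP hb; rewrite /mono -[RHS](det1 R k); congr (\det _).
apply/matrixP => i j; rewrite !mxE.
have h (a : 'I_k) : (nth 0%N s a < n.+1)%N by apply/hb/mem_nth; rewrite hs.
by rewrite -val_eqE /= !inordK // nth_uniq ?hs // eq_sym val_eqE.
Qed.

Lemma mono_basis_rows0 k n s s' x : size s = k -> size s' = k ->
  all (fun x => x < n.+1)%N s' -> (x < n.+1)%N ->
  x \in s -> x \notin s' -> mono s (basis_rows k n s') = 0.
Proof.
move=> hs hs' /allP hb hx xs xs'; rewrite /mono.
have hj : (index x s < k)%N by rewrite -hs index_mem.
rewrite (expand_det_col _ (Ordinal hj)) big1 // => i _.
rewrite !mxE /= nth_index //.
have hi : nth 0%N s' i \in s' by apply/mem_nth; rewrite hs'.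
rewrite -val_eqE /= !inordK //; last exact: hb.
case: eqP => [xi|_]; last by rewrite mul0r.
by rewrite -xi (negPf xs') in hi.
Qed.

(** All terms of the wedge product contain the index 4, whereas the Hodge dual is the single
    monomial avoiding 4 and 5 + i. Evaluation on the corresponding six basis vectors isolates it. *)
Lemma defect_neq0 i : (i < 3)%N ->
  seval (defect i) (basis_rows 6 7 (complement8 [:: 4; 5 + i]%N)) != 0.
Proof.
move=> hi; rewrite /seval.
have key (L : signed_terms) (s : seq nat) b (L' : signed_terms) :
    L = (b, s) :: L' -> size s = 6%N -> uniq s -> all (fun x => x < 8)%N s ->
    all (fun y => (size y.2 == 6%N) && has (fun x => (x < 8)%N && (x \notin s)) y.2) L' ->
    \sum_(x <- L) (-1) ^+ x.1 * mono x.2 (basis_rows 6 7 s) != 0.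
  move=> -> hs hu hb /allP hL; rewrite big_cons big_seq big1.
    by rewrite addr0 mono_basis_rows // mulr1 signr_eq0.
  move=> y /hL /andP[/eqP hy /hasP [x xy /andP [hx xs]]].
  by rewrite (mono_basis_rows0 (x := x)) ?mulr0.
case: i hi => [|[|[|//]]] _.
- exact: (key _ _ (head (false, [::]) (defect 0)).1 (behead (defect 0))).
- exact: (key _ _ (head (false, [::]) (defect 1)).1 (behead (defect 1))).
- exact: (key _ _ (head (false, [::]) (defect 2)).1 (behead (defect 2))).
Qed.

(** The Cayley form is self-dual: each of its fourteen monomials pairs with its complement only,
    always with a plus sign. *)
Lemma cayley_orientation (C : 'M[R]_8) :
  wedge (fun N => seval cayley (N *m C)) (fun N => seval cayley (N *m C))
    (1%:M : 'M[R]_(4 + 4, 8)) = 14 * \det C.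
Proof.
rewrite wedge_pullback wedge_seval //.
have -> : (1%:M : 'M[R]_(4 + 4, 8)) *m C = C by exact: mul1mx.
have -> : \det C = mono (iota 0 8) C.
  rewrite /mono; congr (\det _); apply/matrixP => i j; rewrite [RHS]mxE.
  by rewrite nth_iota ?ltn_ord // add0n inord_val.
rewrite /seval; set L := swedge _ _.
have -> : L = nseq 14 (false, iota 0 8) by vm_compute.
move: (iota 0 8) => s.
rewrite (eq_bigr (fun x : bool * seq nat => (-1) ^+ x.1 * mono x.2 C)) //.
rewrite !big_cons big_nil /=; move: (mono _ _) => d; ring.
Qed.

Lemma cayley_instanton (C : 'M[R]_8) (i : nat) (al be ga : R)
   (F := fun N : 'M[R]_(2, 8) => al * seval (dr_f i) (N *m C)
     + be * seval (f_f i) (N *m C) + ga * seval (om i) (N *m C))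
   (Th := fun N : 'M[R]_(4, 8) => seval cayley (N *m C)) :
  C \in unitmx -> (i < 3)%N ->
  (forall M, hodge2 (C *m C^T)
     (Num.sg (wedge Th Th (1%:M : 'M[R]_(4 + 4, 8)))) F M = - wedge F Th M)
  <-> al + be - 2 * ga = 0.
Proof.
move=> hC hi.
have dC : \det C != 0 by rewrite -unitfE -unitmxE.
pose I3 : seq (R * signed_terms) := [:: (al, dr_f i); (be, f_f i); (ga, om i)].
have FE : F = fun N => \sum_(x <- I3) x.1 * seval x.2 (N *m C).
  by apply/funext => N; rewrite !big_cons big_nil addr0 addrA.
have h3 x : x \in I3 -> all (fun y => index_pair y.2) x.2
   && all (fun y => size y.2 == 2%N) x.2.
  rewrite !inE => /or3P[] /eqP -> /=.
  - by case: (i) hi => [|[|[|]]].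
  - by case: (i) hi => [|[|[|]]].
  - by case: (i) hi => [|[|[|]]].
have key M : hodge2 (C *m C^T)
     (Num.sg (wedge Th Th (1%:M : 'M[R]_(4 + 4, 8)))) F M + wedge F Th M
   = (al + be - 2 * ga) * seval (defect i) (M *m C).
  rewrite cayley_orientation FE hodge2_sum.
  rewrite wedge_suml -big_split /=.
  transitivity (\sum_(x <- I3) x.1 * (seval (shodge x.2) (M *m C)
     + seval (swedge x.2 cayley) (M *m C))).
    rewrite !big_seq; apply: eq_bigr => x /h3 /andP[hx1 hx2].
    (* The sign of [\det C] occurs once from the orientation and once from the Hodge star, so its
       square, 1, remains. *)
    rewrite -mulrDr hodge2_seval // sgrM -(mulrA (Num.sg 14)) -expr2 sqr_sg dC.
    by rewrite gtr0_sg // mulr1 mul1r wedge_pullback wedge_seval.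
  rewrite !big_cons big_nil; cbn [fst snd].
  have [-> -> ->] := seval_defect (M *m C) hi.
  by move: (seval _ _) => d; ring.
split => [h|h M].
  (* Six vectors whose components in the coframe are the basis rows on which the defect does not
     vanish. *)
  have := key (basis_rows 6 7 (complement8 [:: 4; 5 + i]%N) *m invmx C).
  rewrite h addNr mulmxKV // => /esym/eqP.
  by rewrite mulf_eq0 (negPf (defect_neq0 hi)) orbF => /eqP.
by apply/eqP; rewrite -addr_eq0 key h mul0r.
Qed.

End Cayley.

(** * Quadratic systems of ordinary differential equations *)

Section ScalarDerivatives.
Variables (R : realType) (V : normedModType R).
Implicit Types (f g : V -> R) (x v : V).

Lemma derD f g x v df dg : is_derive x v f df -> is_derive x v g dg ->
  is_derive x v (fun y => f y + g y) (df + dg).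
Proof. by move=> *; exact: is_deriveD. Qed.

Lemma derN f x v df : is_derive x v f df ->
  is_derive x v (fun y => - f y) (- df).
Proof. by move=> *; exact: is_deriveN. Qed.

Lemma derB f g x v df dg : is_derive x v f df -> is_derive x v g dg ->
  is_derive x v (fun y => f y - g y) (df - dg).
Proof. by move=> *; exact: is_deriveB. Qed.

Lemma derM f g x v df dg : is_derive x v f df -> is_derive x v g dg ->
  is_derive x v (fun y => f y * g y) (df * g x + f x * dg).
Proof.
move=> hf hg; have h := is_deriveM hf hg; apply: is_derive_eq h _.
by rewrite addrC mulrC.
Qed.

Lemma derC (c : R) x v : is_derive x v (fun=> c) 0.
Proof. exact: is_derive_cst. Qed.

Lemma derZ (c : R) f x v df : is_derive x v f df ->
  is_derive x v (fun y => c * f y) (c * df).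
Proof.
by move=> h; apply: is_derive_eq (derM (derC c x v) h) _; rewrite mul0r add0r.
Qed.

Lemma derX n f x v df : is_derive x v f df ->
  is_derive x v (fun y => f y ^+ n) (n%:R * f x ^+ n.-1 * df).
Proof.
move=> h; elim: n => [|n IH].
  by rewrite !mul0r (_ : (fun=> _) = fun=> 1)//; exact: derC.
rewrite (_ : (fun y => f y ^+ n.+1) = fun y => f y * f y ^+ n); last first.
  by apply/funext => y; rewrite exprS.
apply: is_derive_eq (derM h IH) _; case: n {IH} => [|n] /=.
  by rewrite expr0 !mul0r mulr0 addr0 mulr1 !mul1r.
rewrite -(natr1 n.+1) exprS; ring.
Qed.

Lemma derV f x v df : f x != 0 -> is_derive x v f df ->
  is_derive x v (fun y => (f y)^-1) (- df / f x ^+ 2).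
Proof.
move=> f0 [hf <-]; apply: DeriveDef; first exact: derivableV.
rewrite deriveV // -[_ *: _]/(- f x ^- 2 * 'D_v f x).
by rewrite !mulNr mulrC.
Qed.

Lemma der_sum (I : Type) (r : seq I) (f : I -> V -> R) (df : I -> R) x v :
  (forall i, is_derive x v (f i) (df i)) ->
  is_derive x v (fun y => \sum_(i <- r) f i y) (\sum_(i <- r) df i).
Proof.
move=> h; elim: r => [|i r IH].
  rewrite big_nil (_ : (fun=> _) = fun=> 0); first exact: derC.
  by apply/funext => y; rewrite big_nil.
rewrite big_cons (_ : (fun=> _) = fun y => f i y + \sum_(j <- r) f j y).
  exact: derD.
by apply/funext => y; rewrite big_cons.
Qed.

End ScalarDerivatives.

Section MeanValue.
Variable R : realType.
Implicit Types (f df : R -> R).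

(** Stated for functions differentiable on r > 0 only, with right continuity demanded just when the
    interval starts at 0; this is all that is known of the profile. *)
Lemma mean_value f df (a b : R) : 0 <= a -> a < b ->
  (forall r : R, 0 < r -> is_derive r 1 f (df r)) -> (a = 0 -> f @ 0^'+ --> f 0) ->
  exists2 c, a < c < b & f b - f a = df c * (b - a).
Proof.
move=> a0 ab hf h0.
have hc r : 0 < r -> {for r, continuous f}.
  move=> r0; apply: differentiable_continuous; apply/derivable1_diffP.
  by have [] := hf _ r0.
have [||c] := @MVT _ f df a b ab; last by rewrite in_itv /= => ? ?; exists c.
- move=> r; rewrite in_itv /= => /andP[ar _].
  exact/hf/(le_lt_trans a0 ar).
- apply/continuous_within_itvP => //; split.
  + move=> r; rewrite in_itv /= => /andP[ar _]; exact/hc/(le_lt_trans a0 ar).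
  + move: a0; rewrite le_eqVlt => /orP[/eqP a0|a0]; first by rewrite -a0; exact: h0.
    exact/cvg_at_right_filter/hc.
  + exact/cvg_at_left_filter/hc/(le_lt_trans a0 ab).
Qed.

End MeanValue.

(* The unknowns are u_i, i : nat; the right-hand side of the i-th equation is
   the sum of c * u_j * u_k over the triples (j, k, c) of sys i. *)
Section QuadraticSystem.
Variables (R : realType) (sys : nat -> seq (nat * nat * R)).
Implicit Types (u : nat -> R) (U : nat -> R -> R).

Definition rhs u i := \sum_(e <- sys i) e.2 * (u e.1.1 * u e.1.2).

(** Course-of-values recursion: stage [n] is a table of the coefficients of order at most [n], and
    the next one is the Cauchy product prescribed by the system, divided by [n + 1]. *)
Fixpoint tcoef_upto u (n : nat) : nat -> nat -> R :=
  if n is n'.+1 then fun l i =>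
    if (l <= n')%N then tcoef_upto u n' l i
    else n'.+1%:R^-1 * \sum_(e <- sys i) e.2 *
      \sum_(0 <= m < n'.+1)
        tcoef_upto u n' m e.1.1 * tcoef_upto u n' (n' - m)%N e.1.2
  else fun _ => u.

(* The n-th Taylor coefficient of the solution taking the value u. *)
Definition tcoef u n := tcoef_upto u n n.

Lemma tcoef_uptoE u n l : (l <= n)%N -> tcoef_upto u n l = tcoef u l.
Proof.
elim: n l => [|n IH] l; first by rewrite leqn0 => /eqP ->.
rewrite leq_eqVlt => /orP[/eqP -> //|]; rewrite ltnS => ln.
by apply/funext => i /=; rewrite ln IH.
Qed.

Lemma tcoefS u n i : n.+1%:R * tcoef u n.+1 i = \sum_(e <- sys i) e.2 *
  \sum_(0 <= m < n.+1) tcoef u m e.1.1 * tcoef u (n - m)%N e.1.2.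
Proof.
rewrite {1}/tcoef /= ltnn mulrA divff ?pnatr_eq0 // mul1r.
apply: eq_bigr => e _; congr (_ * _); rewrite !big_nat.
apply: eq_bigr => m; rewrite ltnS => /andP[_ mn].
by rewrite !tcoef_uptoE ?leq_subr.
Qed.

(** The Cauchy product of order [n] has [n + 1] terms, each at most [q^2 (K q)^n], and the recursion
    divides by [n + 1]; the bound is therefore geometric, without factorials. *)
Lemma tcoef_bound u (q K : R) : 0 <= q -> 0 <= K ->
  (forall i, `|u i| <= q) -> (forall i, \sum_(e <- sys i) `|e.2| <= K) ->
  forall n i, `|tcoef u n i| <= q * (K * q) ^+ n.
Proof.
move=> q0 K0 hu hK n; elim/ltn_ind: n => -[|n] IH i.
  by rewrite expr0 mulr1; exact: hu.
rewrite -(ler_pM2l (_ : 0 < n.+1%:R)) ?ltr0n //.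
rewrite -[X in X * `|_|]ger0_norm ?ler0n // -normrM tcoefS.
apply: (le_trans (ler_norm_sum _ _ _)).
have -> : n.+1%:R * (q * (K * q) ^+ n.+1)
    = K * (n.+1%:R * (q * q * (K * q) ^+ n)) by rewrite exprS; ring.
apply: (@le_trans _ _ (\sum_(e <- sys i) `|e.2|
    * (n.+1%:R * (q * q * (K * q) ^+ n)))); last first.
  rewrite -mulr_suml ler_wpM2r // mulr_ge0 ?ler0n // mulr_ge0 //.
    exact: mulr_ge0.
  by rewrite exprn_ge0 // mulr_ge0.
apply: ler_sum => e _; rewrite normrM ler_wpM2l //.
apply: (le_trans (ler_norm_sum _ _ _)).
rewrite -[X in X%:R * _](subn0 n.+1) mulr_natl -sumr_const_nat !big_nat.
apply: ler_sum => m; rewrite ltnS => /andP[_ mn]; rewrite normrM.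
have -> : q * q * (K * q) ^+ n = (q * (K * q) ^+ m) * (q * (K * q) ^+ (n - m)).
  by rewrite mulrACA -exprD subnKC.
by apply: ler_pM => //; apply: IH; rewrite ltnS ?leq_subr.
Qed.

(** Along a solution the recursion reproduces differentiation, so the coefficients are the
    derivatives divided by factorials, without iterated derivatives ever being formed. *)
Lemma tcoef_derive U (x : R) :
  (forall i, is_derive x 1 (U i) (rhs (U^~ x) i)) ->
  forall n i, is_derive x 1 (fun s => tcoef (U^~ s) n i)
    (n.+1%:R * tcoef (U^~ x) n.+1 i).
Proof.
move=> hU n; elim/ltn_ind: n => -[|n] IH i.
  rewrite tcoefS (_ : (fun s => _) = U i) //.
  apply: is_derive_eq (hU i) _; rewrite /rhs; apply: eq_bigr => e _.
  by rewrite big_nat1.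
have -> : (fun s => tcoef (U^~ s) n.+1 i) = fun s => n.+1%:R^-1 *
    \sum_(e <- sys i) e.2 * \sum_(m <- index_iota 0 n.+1)
      tcoef (U^~ s) m e.1.1 * tcoef (U^~ s) (n - m)%N e.1.2.
  apply/funext => s; rewrite -tcoefS mulrA mulVf ?pnatr_eq0 //.
  by rewrite mul1r.
pose T m j := tcoef (U^~ x) m j.
have hT m j : (m <= n)%N ->
    is_derive x 1 (fun s => tcoef (U^~ s) m j) (m.+1%:R * T m.+1 j).
  by move=> mn; apply: IH; rewrite ltnS.
have hb (r : seq nat) j k : {in r, forall m, (m <= n)%N} ->
    is_derive x 1 (fun s => \sum_(m <- r)
      tcoef (U^~ s) m j * tcoef (U^~ s) (n - m)%N k)
    (\sum_(m <- r) (m.+1%:R * T m.+1 j * T (n - m)%N k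
      + T m j * ((n - m).+1%:R * T (n - m).+1 k))).
  elim: r => [|m r IHr] hr.
    rewrite big_nil (_ : (fun=> _) = fun=> 0); first exact: derC.
    by apply/funext => y; rewrite big_nil.
  rewrite big_cons (_ : (fun=> _) = fun s =>
    tcoef (U^~ s) m j * tcoef (U^~ s) (n - m)%N k + \sum_(m <- r)
      tcoef (U^~ s) m j * tcoef (U^~ s) (n - m)%N k); last first.
    by apply/funext => y; rewrite big_cons.
  apply: derD; last by apply: IHr => m' hm'; apply: hr; rewrite inE hm' orbT.
  by apply: derM; apply: hT; rewrite ?leq_subr // hr // inE eqxx.
have hs := derZ n.+1%:R^-1 (der_sum (sys i) (fun e => derZ e.2
  (hb (index_iota 0 n.+1) e.1.1 e.1.2 _))).
have hin : {in index_iota 0 n.+1, forall m, (m <= n)%N}.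
  by move=> m; rewrite mem_index_iota ltnS.
apply: is_derive_eq (hs hin) _.
rewrite tcoefS mulr_sumr; apply: eq_bigr => e _; rewrite mulrCA; congr (_ * _).
rewrite big_split /= -(subn0 n.+1) -/(index_iota 0 n.+1) subn0.
(* Both halves of the Leibniz rule are reindexed to sums up to [n + 1], where their weights [m] and
   [n + 1 - m] add up to the constant [n + 1]. *)
have -> : \sum_(0 <= m < n.+1) m.+1%:R * T m.+1 e.1.1 * T (n - m)%N e.1.2
   = \sum_(0 <= m < n.+2) m%:R * (T m e.1.1 * T (n.+1 - m)%N e.1.2).
  rewrite [RHS]big_nat_recl // mul0r add0r; apply: eq_bigr => m _.
  by rewrite subSS mulrA.
have -> : \sum_(0 <= m < n.+1) T m e.1.1 * ((n - m).+1%:R * T (n - m).+1 e.1.2)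
   = \sum_(0 <= m < n.+2) (n.+1 - m)%:R * (T m e.1.1 * T (n.+1 - m)%N e.1.2).
  rewrite [RHS]big_nat_recr //= subnn mul0r addr0 !big_nat.
  apply: eq_bigr => m /andP[_]; rewrite ltnS => mn.
  by rewrite subSn // mulrCA.
rewrite -big_split /= mulr_sumr !big_nat; apply: eq_bigr => m /andP[_].
by rewrite ltnS => mn; rewrite -mulrDl -natrD subnKC // mulKf ?pnatr_eq0.
Qed.

Lemma tcoef_cvg (F : set_system R) (FF : Filter F) U u :
  (forall i, U i @ F --> u i) ->
  forall n i, (fun s => tcoef (U^~ s) n i) @ F --> tcoef u n i.
Proof.
move=> hU n; elim/ltn_ind: n => -[|n] IH i; first exact: hU.
have E v : tcoef v n.+1 i = n.+1%:R^-1 * \sum_(e <- sys i) e.2 *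
    \sum_(m <- index_iota 0 n.+1) tcoef v m e.1.1 * tcoef v (n - m)%N e.1.2.
  by rewrite -tcoefS mulrA mulVf ?pnatr_eq0 // mul1r.
under eq_fun do rewrite E; rewrite E; apply: cvgMl_tmp.
elim: (sys i) => [|e r IHr].
  by rewrite big_nil; under eq_fun do rewrite big_nil; exact: cvg_cst.
rewrite big_cons; under eq_fun do rewrite big_cons.
apply: cvgD => //; apply: cvgMl_tmp.
have : {in index_iota 0 n.+1, forall m, (m <= n)%N}.
  by move=> m; rewrite mem_index_iota ltnS.
elim: (index_iota 0 n.+1) => [|m r' IHr'] hr'.
  by rewrite big_nil; under eq_fun do rewrite big_nil; exact: cvg_cst.
rewrite big_cons; under eq_fun do rewrite big_cons.
apply: cvgD; last by apply: IHr' => m' hm'; apply: hr'; rewrite inE hm' orbT.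
by apply: cvgM; apply: IH; rewrite ltnS ?leq_subr // hr' // inE eqxx.
Qed.

(** The system is compatible with the reflection of r about 0 when the unknowns marked by [par] are
    odd: each product on the right has the parity opposite to that of the unknown it
    differentiates. *)
Lemma tcoef_parity u (par : nat -> bool) :
  (forall i, all (fun e => par e.1.1 (+) par e.1.2 (+) par i) (sys i)) ->
  (forall i, par i -> u i = 0) ->
  forall n i, odd n (+) par i -> tcoef u n i = 0.
Proof.
move=> hp hu n; elim/ltn_ind: n => -[|n] IH i /= hn; first exact: hu.
apply/eqP; rewrite -(mulrI_eq0 _ (mulfI (_ : n.+1%:R != 0))) ?pnatr_eq0 //.
rewrite tcoefS big_seq big1 // => e he.
rewrite big_nat big1 ?mulr0 // => m; rewrite ltnS => /andP[_ mn].
have /allP /(_ _ he) := hp i.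
have [h|h] := boolP (odd m (+) par e.1.1).
  by rewrite IH ?mul0r.
have [h'|h' hs] := boolP (odd (n - m) (+) par e.1.2).
  by rewrite [X in _ * X]IH ?mulr0 // ltnS leq_subr.
exfalso; move: hn h h' hs; rewrite oddB //.
by case: (odd n); case: (odd m); case: (par i); case: (par _); case: (par _).
Qed.

(** The Taylor polynomial at [s], meant as a function of the centre [s] for fixed [x]: its
    derivative telescopes to one term, and at [s = x] it is the value of the solution. *)
Definition tsum U i (N : nat) (s x : R) :=
  \sum_(0 <= n < N) tcoef (U^~ s) n i * (x - s) ^+ n.

Lemma tsum_derive U i (x s : R) :
  (forall i, is_derive s 1 (U i) (rhs (U^~ s) i)) ->
  forall N, is_derive s 1 (fun s => tsum U i N s x)
    (N%:R * tcoef (U^~ s) N i * (x - s) ^+ N.-1).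
Proof.
move=> hU; elim=> [|N IH].
  rewrite !mul0r (_ : (fun=> _) = fun=> 0); first exact: derC.
  by apply/funext => y; rewrite /tsum big_nil.
rewrite (_ : (fun=> _) = fun s => tsum U i N s x
   + tcoef (U^~ s) N i * (x - s) ^+ N); last first.
  by apply/funext => y; rewrite /tsum big_nat_recr.
have hx : is_derive s 1 (fun s => x - s) (- 1).
  by apply: is_derive_eq (derB (derC x s 1) (is_derive_id s 1)) _; rewrite sub0r.
apply: is_derive_eq (derD IH (derM (tcoef_derive hU N i) (derX N hx))) _.
ring.
Qed.

Lemma tsumE U i N x : tsum U i N.+1 x x = U i x.
Proof.
rewrite /tsum big_nat_recl // subrr expr0 mulr1 big1 ?addr0 // => n _.
by rewrite expr0n mulr0.
Qed.

(** The mean value theorem is applied in the centre of expansion, giving a remainder of Cauchy type.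
    Only coefficients at interior points of the interval occur, so the expansion at 0 needs no
    derivative at 0. *)
Lemma taylor_remainder U (q K : R) (a b r0 x : R) i N :
  0 <= q -> 0 <= K -> (forall i, \sum_(e <- sys i) `|e.2| <= K) ->
  0 <= a -> a < b ->
  (forall i (r : R), 0 < r -> is_derive r 1 (U i) (rhs (U^~ r) i)) ->
  (a = 0 -> forall i, U i @ 0^'+ --> U i 0) ->
  (forall i r, a < r < b -> `|U i r| <= q) ->
  (r0 = a /\ x = b) \/ (r0 = b /\ x = a) ->
  `|U i x - tsum U i N.+1 r0 x| <= q * N.+1%:R * (K * q * (b - a)) ^+ N.+1.
Proof.
move=> q0 K0 hK a0 ab hU h0 hq hx.
have ba : 0 <= b - a by rewrite subr_ge0 ltW.
have [|c /andP[ac cb] hc] := mean_value (f := fun s => tsum U i N.+1 s x) a0 ab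
  (fun r r0 => tsum_derive i x (fun j => hU j r r0) N.+1).
  move=> /h0 {}h0; rewrite /tsum; elim: (index_iota 0 N.+1) => [|n r IHr].
    by rewrite big_nil; under eq_fun do rewrite big_nil; exact: cvg_cst.
  rewrite big_cons; under eq_fun do rewrite big_cons.
  apply: cvgD => //; apply: cvgM; first exact: tcoef_cvg.
  have [hd _] := derX n (derB (derC x (0 : R) (1 : R)) (is_derive_id (0 : R) (1 : R))).
  apply: cvg_at_right_filter.
  apply: (@differentiable_continuous _ _ _ _ (fun y => (x - y) ^+ n)).
  exact/derivable1_diffP.
have -> : `|U i x - tsum U i N.+1 r0 x|
    = `|tsum U i N.+1 b x - tsum U i N.+1 a x|.
  by case: hx => -[-> ->]; rewrite tsumE // distrC.
have hxc : `|x - c| <= b - a.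
  case: hx => -[_ ->]; first by rewrite ger0_norm ?subr_ge0 ?ltW // ltrD2l ltrN2.
  by rewrite distrC ger0_norm ?subr_ge0 ?ltW // ltrD2r.
rewrite hc !normrM [`|b - a|]ger0_norm // [`|N.+1%:R|]ger0_norm ?ler0n //=.
rewrite normrX.
have -> : q * N.+1%:R * (K * q * (b - a)) ^+ N.+1 = N.+1%:R
   * (q * (K * q) ^+ N.+1) * (b - a) ^+ N * (b - a).
  by rewrite (exprMn _ (K * q) (b - a)) (exprS (b - a)); ring.
rewrite ler_wpM2r // ler_pM ?mulr_ge0 ?ler0n ?exprn_ge0 //.
  rewrite ler_wpM2l ?ler0n // tcoef_bound // => j.
  by apply: hq; rewrite ac.
by rewrite lerXn2r // nnegrE.
Qed.

Lemma taylor_cvg U (q K : R) (a b r0 x : R) i :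
  0 <= q -> 0 <= K -> (forall i, \sum_(e <- sys i) `|e.2| <= K) ->
  0 <= a -> a < b ->
  (forall i (r : R), 0 < r -> is_derive r 1 (U i) (rhs (U^~ r) i)) ->
  (a = 0 -> forall i, U i @ 0^'+ --> U i 0) ->
  (forall i r, a < r < b -> `|U i r| <= q) ->
  (r0 = a /\ x = b) \/ (r0 = b /\ x = a) ->
  K * q * (b - a) <= 4^-1 ->
  pseries (fun n => tcoef (U^~ r0) n i) (x - r0) @ \oo --> U i x.
Proof.
move=> q0 K0 hK a0 ab hU h0 hq hx h4.
have ba : 0 <= b - a by rewrite subr_ge0 ltW.
rewrite -cvg_shiftS.
have -> : [sequence pseries (fun n => tcoef (U^~ r0) n i) (x - r0) n.+1]_n
    = fun N => tsum U i N.+1 r0 x by [].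
have hg : (fun N => q * (2^-1) ^+ N.+1 : R^o) @ \oo --> (0 : R^o).
  rewrite -(mulr0 q); apply: cvgMl_tmp.
  rewrite (cvg_shiftS (fun N => 2^-1 ^+ N : R^o)).
  by apply: cvg_expr; rewrite ger0_norm ?invr_ge0 // invf_lt1 // ltr1n.
have hd : (fun N => tsum U i N.+1 r0 x - U i x : R^o) @ \oo --> (0 : R^o).
  apply: (squeeze_cvgr (f := fun N => - (q * (2^-1) ^+ N.+1) : R^o) _ _ hg).
    near=> N; rewrite -ler_norml distrC.
    apply: (le_trans (taylor_remainder i N q0 K0 hK a0 ab hU h0 hq hx)).
    rewrite -mulrA ler_wpM2l //.
    (* The bound 1/4 on the ratio leaves room to absorb the factor [N + 1], which is at most
       [2^(N+1)]. *)
    apply: (@le_trans _ _ ((2 ^ N.+1)%:R * 4^-1 ^+ N.+1)).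
      apply: ler_pM; rewrite ?ler0n ?exprn_ge0 ?mulr_ge0 //.
        by rewrite ler_nat ltnW // ltn_expl.
      by rewrite lerXn2r // nnegrE ?mulr_ge0 ?invr_ge0.
    by rewrite natrX -exprMn (_ : 2 * 4^-1 = 2^-1 :> R) //; field.
  by rewrite -oppr0; exact: cvgN.
rewrite (_ : (fun N => tsum U i N.+1 r0 x)
   = (fun N => tsum U i N.+1 r0 x - U i x) \+ cst (U i x)); last first.
  by apply/funext => N; rewrite /= subrK.
have h := cvgD hd (cvg_cst (U i x) : cst (U i x) @ \oo --> U i x).
by rewrite add0r in h; exact: h.
Unshelve. all: by end_near. Qed.

End QuadraticSystem.

(** * The profile functions t and nu *)

Section PowerSeries.
Variable R : realType.
Implicit Types (c : R^nat) (f : R -> R).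

Lemma pseries0 c : pseries c 0 @ \oo --> c 0%N.
Proof.
rewrite -cvg_shiftS.
rewrite (_ : [sequence _]_n = fun=> c 0%N); first exact: cvg_cst.
apply/funext => n; rewrite /pseries /series /= big_nat_recl // expr0 mulr1.
by rewrite big1 ?addr0 // => i _; rewrite expr0n mulr0.
Qed.

Lemma pseries_scale c (k x l : R) : pseries c x @ \oo --> l ->
  pseries (fun n => k * c n) x @ \oo --> k * l.
Proof.
move=> h; rewrite (_ : pseries _ _ = fun n => k * pseries c x n).
  exact: cvgMl_tmp.
apply/funext => n; rewrite /pseries /series /= mulr_sumr.
by apply: eq_bigr => i _; rewrite mulrA.
Qed.

Lemma pseries_tail c (x l : R) : x != 0 -> c 0%N = 0 -> pseries c x @ \oo --> l ->
  pseries (fun n => c n.+1) x @ \oo --> l / x.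
Proof.
move=> x0 c0; rewrite -cvg_shiftS => h.
rewrite (_ : pseries _ _ = fun n => pseries c x n.+1 / x).
  exact: cvgMr_tmp.
apply/funext => n; rewrite /pseries /series /= big_nat_recl // c0 mul0r add0r.
rewrite mulr_suml; apply: eq_bigr => i _; rewrite exprSr; field.
exact: x0.
Qed.

Lemma pseries_even c (x l : R) : (forall n, odd n -> c n = 0) ->
  pseries c x @ \oo --> l ->
  pseries (fun n => c n.*2) (x ^+ 2) @ \oo --> l.
Proof.
move=> hc h; rewrite (_ : pseries _ _ = (pseries c x) \o double).
  apply: cvg_comp h; apply/cvgnyPgt => n; near=> m.
  rewrite -addnn (leq_trans _ (leq_addr _ _)) //; near: m.
  exact: nbhs_infty_gt.
apply/funext => n; rewrite /pseries /series /=; elim: n => [|n IH].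
  by rewrite !big_nil.
rewrite doubleS !big_nat_recr //= IH (hc n.*2.+1) ?mul0r ?addr0 /= ?odd_double //.
by rewrite -exprM mul2n.
Unshelve. all: by end_near. Qed.

(* f r = F (r ^ 2) for r >= 0 small, where F is the sum of a power series. *)
Definition even_germ f := exists (c : R^nat) (q B rho : R),
  [/\ 0 < rho, forall n, `|c n| <= q * B ^+ n, f 0 = c 0%N &
      forall r, 0 <= r < rho -> pseries c (r ^+ 2) @ \oo --> f r].

(** Dropping the first [m] vanishing even coefficients divides the series by [r^(2m)]; the value
    chosen at 0 is the new constant coefficient. *)
Lemma even_germ_quotient c f (q B rho : R) (m : nat) :
  0 < rho -> 0 <= q -> 0 <= B -> (forall n, `|c n| <= q * B ^+ n) ->
  (forall n, odd n -> c n = 0) -> (forall n, (n < m)%N -> c n.*2 = 0) ->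
  (forall r, 0 <= r < rho -> pseries c r @ \oo --> f r) ->
  even_germ (fun r => if r == 0 then c m.*2 else f r / r ^+ m.*2).
Proof.
move=> rho0 q0 B0 hb ho h0 hf.
exists (fun n => c (n + m).*2), (q * (B ^+ m.*2)), (B ^+ 2), rho; split => //.
- move=> n; apply: le_trans (hb _) _.
  by rewrite -mulrA -exprM -exprD doubleD mul2n addnC.
- by rewrite eqxx add0n.
move=> r hr; case: eqP => [->|/eqP r0].
  have h := @pseries0 (fun n => c (n + m).*2).
  by rewrite add0n in h; rewrite expr0n; exact: h.
have : forall k, (k <= m)%N ->
    pseries (fun n => c (n + k).*2) (r ^+ 2) @ \oo --> f r / r ^+ k.*2.
  elim=> [_|k IH km].
    rewrite expr0 divr1; under [fun n => _]eq_fun do rewrite addn0.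
    by apply: pseries_even => //; apply: hf.
  have {}IH := IH (ltnW km).
  have := pseries_tail (expf_neq0 2 r0) _ IH; rewrite add0n h0 // => /(_ erefl).
  have -> : f r / r ^+ k.+1.*2 = f r / r ^+ k.*2 / r ^+ 2.
    by rewrite -mulrA -invfM -exprD addn2.
  by under [fun n => c (n.+1 + k).*2]eq_fun do rewrite addSnnS.
exact.
Qed.

End PowerSeries.

(** * Analyticity of the solutions of quadratic systems *)

Section LocalBounds.
Variable R : realType.

Lemma locally_bounded_list (F : set_system R) (FF : Filter F)
    (fs : seq (R -> R)) :
  (forall i, exists l : R, nth (fun=> 0) fs i @ F --> l) ->
  exists2 q : R, 0 <= q &
    \forall s \near F, forall i, `|nth (fun=> 0) fs i s| <= q.
Proof.
elim: fs => [|f fs IH] h.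
  by exists 0 => //; near=> s => i; rewrite nth_nil normr0.
have [l hl] := h 0%N; have [q q0 hq] := IH (fun i => h i.+1).
exists (q + (`|l| + 1)); first by rewrite addr_ge0 // addr_ge0.
have hl1 : `|l| < `|l| + 1 by rewrite ltrDl.
have hf := @cvgr_norm_le R R^o R F FF _ l hl _ hl1.
near=> s => -[|i] /=.
  by apply: (@le_trans _ _ (`|l| + 1)); [near: s|rewrite lerDr].
apply: (@le_trans _ _ q); last by rewrite lerDl addr_ge0.
by move: i; near: s.
Unshelve. all: by end_near. Qed.

Lemma system_bound (l : seq (seq (nat * nat * R))) :
  exists2 K : R, 0 <= K & forall i, \sum_(e <- nth [::] l i) `|e.2| <= K.
Proof.
elim: l => [|s l [K K0 IH]]; first by exists 0 => // i; rewrite nth_nil big_nil.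
exists (\sum_(e <- s) `|e.2| + K); first by rewrite addr_ge0 // sumr_ge0.
move=> [|i] /=; first by rewrite lerDl.
by apply: le_trans (IH i) _; rewrite lerDr sumr_ge0.
Qed.

End LocalBounds.

Section Analyticity.
Variables (R : realType) (l : seq (seq (nat * nat * R))) (fs : seq (R -> R)).
Let sys i := nth [::] l i.
Let U i := nth (fun=> 0 : R) fs i.
Hypothesis hU : forall i (r : R), 0 < r -> is_derive r 1 (U i) (rhs sys (U^~ r) i).

Lemma system_cvg i (r : R) : 0 < r -> {for r, continuous (U i)}.
Proof.
move=> r0; apply: differentiable_continuous; apply/derivable1_diffP.
by have [] := hU i r0.
Qed.

Lemma step_exists (K q d : R) : 0 < d -> 0 <= K -> 0 <= q ->
  exists rho : R, [/\ 0 < rho, rho <= d & K * q * rho <= 4^-1].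
Proof.
move=> d0 K0 q0; exists (Num.min d (4 * (K * q + 1))^-1).
have p0 : 0 < 4 * (K * q + 1) by rewrite mulr_gt0 // ltr_wpDl // mulr_ge0.
split; [by rewrite lt_min d0 invr_gt0|by rewrite ge_min lexx|].
apply: (@le_trans _ _ (K * q * (4 * (K * q + 1))^-1)).
  by rewrite ler_wpM2l ?mulr_ge0 // ge_min lexx orbT.
rewrite ler_pdivrMr // mulKf ?pnatr_eq0 //.
by rewrite lerDl.
Qed.

Lemma system_analytic (r0 : R) : 0 < r0 ->
  exists2 rho : R, 0 < rho & forall i r, `|r - r0| < rho ->
    pseries (fun n => tcoef sys (U^~ r0) n i) (r - r0) @ \oo --> U i r.
Proof.
move=> r00; have [K K0 hK] := system_bound l.
have [i|q q0 /nbhs_ballP [d /= d0 hd]] :=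
  @locally_bounded_list R (nbhs r0) _ fs.
  by exists (U i r0); exact: system_cvg.
have dr : 0 < Num.min d r0 by rewrite lt_min d0.
have [rho [rho0 rhod h4]] := step_exists dr K0 q0.
(* Besides the region where the unknowns are bounded, the radius is limited by [r0], so that the
   interval of expansion stays in r > 0. *)
move: rhod; rewrite le_min => /andP[rhod rhor].
exists rho => // i r hr.
have key a b : a < b -> (r0 = a /\ r = b) \/ (r0 = b /\ r = a) ->
    pseries (fun n => tcoef sys (U^~ r0) n i) (r - r0) @ \oo --> U i r.
  move=> ab hx.
  have ba : b - a < rho.
    have : 0 < b - a by rewrite subr_gt0.
    move=> ba0; rewrite -(gtr0_norm ba0).
    by case: hx => -[E1 E2]; rewrite -E1 -E2 // distrC.
  have a0 : 0 < a.
    case: hx => -[E1 E2]; first by rewrite -E1.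
    by rewrite ltrBlDr -ltrBlDl in ba; apply: le_lt_trans ba; rewrite -E1 subr_ge0.
  apply: (@taylor_cvg R sys U q K a b r0 r i) => //; first exact: ltW.
  - by move=> a0'; rewrite a0' ltxx in a0.
  - move=> j s /andP[as_ sb]; apply: hd; rewrite /ball /=.
    apply: (lt_le_trans _ rhod); apply: le_lt_trans ba.
    case: hx => -[-> _].
      by rewrite distrC ger0_norm ?subr_ge0 ?ltW // ltrD2r.
    by rewrite ger0_norm ?subr_ge0 ?ltW // ltrD2l ltrN2.
  - by apply: le_trans h4; rewrite ler_wpM2l ?mulr_ge0 // ltW.
have [rr|rr|->] := ltgtP r0 r; [by apply: (key _ _ rr); left|
  by apply: (key _ _ rr); right|].
rewrite subrr; exact: (@pseries0 R (fun n => tcoef sys (U^~ r) n i)).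
Qed.

Lemma system_analytic0 : (forall i, U i @ 0^'+ --> U i 0) ->
  exists rho q B : R, [/\ 0 < rho, 0 <= q, 0 <= B,
    forall n i, `|tcoef sys (U^~ 0) n i| <= q * B ^+ n &
    forall i r, 0 <= r < rho ->
      pseries (fun n => tcoef sys (U^~ 0) n i) r @ \oo --> U i r].
Proof.
move=> h0; have [K K0 hK] := system_bound l.
have [i|q q0 hq] := @locally_bounded_list R (0 : R)^'+ _ fs.
  by exists (U i 0); exact: h0.
(* A separate bound for the values at 0, which control the coefficients; [q] bounds the unknowns to
   the right of 0 and controls the remainder. *)
have [i|q' q'0 hq'] := @locally_bounded_list R (globally [set (0 : R)]) _ fs.
  by exists (U i 0) => A hA x /= ->; exact: (nbhs_singleton hA).
have {}hq' i : `|U i 0| <= q' by apply: (hq' 0).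
have /nbhs_ballP [d /= d0 hd] := hq.
have [rho [rho0 rhod h4]] := step_exists d0 K0 q0.
exists rho, q', (K * q'); split => //; first exact: mulr_ge0.
  by move=> n i; apply: tcoef_bound.
move=> i r /andP[]; rewrite le_eqVlt => /orP[/eqP <- _|r0 rr].
  exact: (@pseries0 R (fun n => tcoef sys (U^~ 0) n i)).
rewrite -[r in pseries _ r]subr0.
apply: (@taylor_cvg R sys U q K 0 r 0 r i) => //.
- move=> j s /andP[s0 sr]; apply: hd => //=.
  rewrite /ball /= sub0r normrN gtr0_norm // (lt_le_trans _ rhod) //.
  exact: lt_trans sr rr.
- by left.
- by rewrite subr0; apply: le_trans h4; rewrite ler_wpM2l ?mulr_ge0 // ltW.
Qed.

End Analyticity.

(** * Positivity of the profile and uniqueness for the instanton equation *)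

Section Profile.
Variables (R : realType) (nu0 : R) (t nu : R -> R).
Hypotheses (hnu0 : 0 < nu0) (hp : spin7_profile nu0 t nu).

Let t0 : t 0 = 0. Proof. by case: hp => -[]. Qed.
Let nu00 : nu 0 = nu0. Proof. by case: hp => -[]. Qed.
Let t_cvg0 : t @ 0^'+ --> 0.
Proof.
have h : t @ 0^'+ --> t 0 by case: hp => _ [].
by rewrite t0 in h.
Qed.

Let nusq_cvg0 : nu r ^+ 2 @[r --> 0^'+] --> nu0 ^+ 2.
Proof.
have h : nu @ 0^'+ --> nu0 by case: hp => -[_ <-] [].
by rewrite expr2; under eq_fun do rewrite expr2; exact: cvgM.
Qed.

Lemma nusq_derive (r : R) : 0 < r ->
  is_derive r 1 (fun u => nu u ^+ 2) (6 * t r).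
Proof. by case: hp => _ _ _ h _; exact: h. Qed.

Lemma t_derive (r : R) : 0 < r ->
  is_derive r 1 t (1 - 2 * t r ^+ 2 / nu r ^+ 2).
Proof. by case: hp => _ _ _ _ h; exact: h. Qed.

(* (t nu^2)' >= nu^2, which is positive near 0. *)
Lemma t_gt0 (r : R) : 0 < r -> 0 < t r.
Proof.
move=> r0.
pose d s := (1 - 2 * t s ^+ 2 / nu s ^+ 2) * nu s ^+ 2 + t s * (6 * t s).
have hd (s : R) : 0 < s -> is_derive s 1 (fun s => t s * nu s ^+ 2) (d s).
  by move=> s0; apply: derM; [exact: t_derive|exact: nusq_derive].
have dnu s : nu s ^+ 2 <= d s.
  (* It is not yet known that [nu] has no zero; at a zero the quotient is 0 by convention, and the
     inequality still holds. *)
  rewrite /d; have [->|n0] := eqVneq (nu s ^+ 2) 0.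
    by rewrite mulr0 add0r mulrCA mulr_ge0 // -expr2 sqr_ge0.
  rewrite mulrBl mul1r divfK // -addrA lerDl.
  have -> : - (2 * t s ^+ 2) + t s * (6 * t s) = 4 * t s ^+ 2 by ring.
  by rewrite mulr_ge0 // sqr_ge0.
have h0 : t s * nu s ^+ 2 @[s --> 0^'+] --> t 0 * nu 0 ^+ 2.
  by rewrite t0 nu00; exact: cvgM.
have hnear : \forall s \near (0 : R)^'+, 0 < nu s ^+ 2.
  by apply: (cvgr_gt _ nusq_cvg0); rewrite exprn_gt0.
have [e /= e0 he] := iffLR (nbhs_ballP _ _) hnear.
pose e1 := Num.min e r.
have e10 : 0 < e1 by rewrite lt_min e0.
have [c /andP[c0 ce] hc] := mean_value (lexx 0) e10 hd (fun=> h0).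
have tn : 0 < t e1 * nu e1 ^+ 2.
  move: hc; rewrite t0 mul0r !subr0 => ->; rewrite mulr_gt0 //.
  apply: lt_le_trans (dnu c); apply: he => //; rewrite /ball /= sub0r normrN.
  by rewrite gtr0_norm // (lt_le_trans ce) // ge_min lexx.
have : 0 < t r * nu r ^+ 2.
  have : e1 <= r by rewrite ge_min lexx orbT.
  rewrite le_eqVlt => /orP[/eqP <- //|er].
  have [|c' _ hc'] := mean_value (ltW e10) er hd.
    by move=> E; rewrite E ltxx in e10.
  rewrite -(subrK (t e1 * nu e1 ^+ 2) (t r * _)) hc' ltr_wpDl // mulr_ge0 //.
    exact: le_trans (sqr_ge0 _) (dnu c').
  by rewrite subr_ge0 ltW.
have := sqr_ge0 (nu r); rewrite le_eqVlt => /orP[/eqP <-|n0].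
  by rewrite mulr0 ltxx.
by rewrite pmulr_lgt0.
Qed.

(** The integral of [t] from 0 to [r], in closed form because [(nu^2)' = 6 t]. *)
Definition tint r := (nu r ^+ 2 - nu0 ^+ 2) / 6.

Lemma tint_derive (r : R) : 0 < r -> is_derive r 1 tint (t r).
Proof.
move=> r0; apply: is_derive_eq (derM (derB (nusq_derive r0) (derC _ _ _)) (derC 6^-1 _ _)) _.
by rewrite mulr0 addr0 subr0; field.
Qed.

Lemma tint_cvg0 : tint @ 0^'+ --> 0.
Proof.
have h : tint @ 0^'+ --> (nu0 ^+ 2 - nu0 ^+ 2) / 6.
  apply: cvgMr_tmp; apply: cvgB => //; exact: cvg_cst.
by rewrite subrr mul0r in h.
Qed.

Lemma tint0 : tint 0 = 0. Proof. by rewrite /tint nu00 subrr mul0r. Qed.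

Lemma tint_gt0 (r : R) : 0 < r -> 0 < tint r.
Proof.
move=> r0; have [|c /andP[c0 _]] := mean_value (lexx 0) r0 tint_derive.
  by move=> _; rewrite tint0; exact: tint_cvg0.
by rewrite tint0 !subr0 => ->; rewrite mulr_gt0 // t_gt0.
Qed.

Lemma nusq_gt0 (r : R) : 0 <= r -> 0 < nu r ^+ 2.
Proof.
rewrite le_eqVlt => /orP[/eqP <-|r0]; first by rewrite nu00 exprn_gt0.
have := tint_gt0 r0; rewrite pmulr_lgt0 ?invr_gt0 // subr_gt0.
by apply: lt_trans; rewrite exprn_gt0.
Qed.

Lemma nusq_neq0 (r : R) : 0 <= r -> nu r ^+ 2 != 0.
Proof. by move=> r0; rewrite gt_eqF // nusq_gt0. Qed.

Lemma t_neq0 (r : R) : 0 < r -> t r != 0.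
Proof. by move=> r0; rewrite gt_eqF // t_gt0. Qed.

Lemma tint_integral (r : R) : 0 < r ->
  \int[lebesgue_measure]_(u in `[0, r]) t u = tint r.
Proof.
move=> r0; rewrite /Rintegral.
have ct (s : R) : 0 < s -> {for s, continuous t}.
  move=> s0; apply: differentiable_continuous; apply/derivable1_diffP.
  by have [] := t_derive s0.
have ci (s : R) : 0 < s -> {for s, continuous tint}.
  move=> s0; apply: differentiable_continuous; apply/derivable1_diffP.
  by have [] := tint_derive s0.
rewrite (@continuous_FTC2 R t tint 0 r) //.
- by rewrite tint0 /= subr0.
- apply/continuous_within_itvP => //; split.
  + by move=> s; rewrite in_itv /= => /andP[s0 _]; exact: ct.
  + by rewrite t0.
  + exact/cvg_at_left_filter/ct.
- split.
  + move=> s; rewrite in_itv /= => /andP[s0 _]; by have [] := tint_derive s0.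
  + by rewrite tint0; exact: tint_cvg0.
  + exact/cvg_at_left_filter/ci.
- move=> s; rewrite in_itv /= => /andP[s0 _].
  by rewrite derive1E; have [_ ->] := tint_derive s0.
Qed.

Lemma t_over_r_cvg : t r / r @[r --> 0^'+] --> (1 : R).
Proof.
apply: (@lhopital_at_right R t (fun r => 1 - 2 * t r ^+ 2 / nu r ^+ 2) id
  (fun=> 1) 0 1 1 ltr01) => //.
- by move=> x; rewrite in_itv /= => /andP[x0 _]; exact: t_derive.
- exact/cvg_at_right_filter/cvg_id.
under eq_fun do rewrite divr1.
have h : 2 * t x ^+ 2 / nu x ^+ 2 @[x --> 0^'+] --> (2 * 0 ^+ 2 / nu0 ^+ 2 : R).
  apply: cvgM; last by apply: cvgV; rewrite ?expf_neq0 ?gt_eqF.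
  apply: cvgMl_tmp; rewrite expr2; under eq_fun do rewrite expr2.
  exact: cvgM.
have {}h : 1 - 2 * t x ^+ 2 / nu x ^+ 2 @[x --> 0^'+]
    --> (1 - 2 * 0 ^+ 2 / nu0 ^+ 2 : R) by apply: cvgB => //; exact: cvg_cst.
by rewrite expr0n mulr0 mul0r subr0 in h.
Qed.

Lemma tint_over_rsq_cvg : 2 * tint r / r ^+ 2 @[r --> 0^'+] --> (1 : R).
Proof.
apply: (@lhopital_at_right R (fun r => 2 * tint r) (fun r => 2 * t r)
  (fun r => r ^+ 2) (fun r => 2 * r) 0 1 1 ltr01).
- by move=> x; rewrite in_itv /= => /andP[x0 _]; exact/derZ/tint_derive.
- move=> x _; apply: is_derive_eq (derX 2 (is_derive_id x 1)) _.
  by rewrite mulr1 expr1.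
- have h : 2 * tint x @[x --> 0^'+] --> (2 * 0 : R).
    by apply: cvgMl_tmp; exact: tint_cvg0.
  by rewrite mulr0 in h.
- have h : x ^+ 2 @[x --> (0 : R)] --> (0 : R) ^+ 2 by exact: exprn_continuous.
  by rewrite expr0n in h; exact: cvg_at_right_filter.
- by move=> x; rewrite in_itv /= => /andP[x0 _]; rewrite mulf_neq0 // gt_eqF.
apply: cvg_trans t_over_r_cvg; apply: near_eq_cvg; near=> r.
rewrite /= -mulf_div divff ?mul1r //.
Unshelve. all: by end_near. Qed.

Definition instanton_ode (x : R -> R) := forall r : R, 0 < r ->
  exists2 x' : R, is_derive r 1 x x' &
    x' / t r + 2 * (x r ^+ 2 - x r) / t r ^+ 2 + 4 * x r / nu r ^+ 2 = 0.

(* With w = x / t^2 the equation becomes w' = - 2 t w^2, so that w decreases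
   and d = w (c + 2 k int t) - k satisfies d' = - 2 t w d. *)
Lemma instanton_ode_unique (x : R -> R) (c k : R)
    (d := fun r => x r / t r ^+ 2 * (c + 2 * k * tint r) - k) :
  instanton_ode x -> d @ 0^'+ --> 0 -> forall r, 0 < r -> d r = 0.
Proof.
move=> hx d0.
pose w r := x r / t r ^+ 2.
have hw (r : R) : 0 < r -> is_derive r 1 w (- 2 * t r * w r ^+ 2).
  move=> r0; have [x' hx' E] := hx _ r0.
  have tr := t_neq0 r0; have nr := nusq_neq0 (ltW r0).
  have h := derM hx' (derV (f := fun s => t s ^+ 2) (expf_neq0 2 tr) (derX 2 (t_derive r0))).
  apply: is_derive_eq h _.
  have -> : x' = - (2 * (x r ^+ 2 - x r) / t r + 4 * x r * t r / nu r ^+ 2).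
    apply/eqP; rewrite -subr_eq0 opprK; apply/eqP.
    rewrite -[RHS](mulr0 (t r)) -E.
    by move: (nu r ^+ 2) nr => n nr; field; rewrite nr.
  rewrite /w /=; move: (nu r ^+ 2) nr => n nr; field.
  by rewrite tr nr.
have hd (r : R) : 0 < r -> is_derive r 1 d (- 2 * t r * w r * d r).
  move=> r0; have h := derB (derM (hw r r0) (derD (derC c r (1 : R))
    (derZ (2 * k) (tint_derive r0)))) (derC k r (1 : R)).
  apply: is_derive_eq h _.
  rewrite /d -/(w r); ring.
have wdecr (a b : R) : 0 < a -> a <= b -> w b <= w a.
  move=> a0; rewrite le_eqVlt => /orP[/eqP -> //|ab].
  have [|e /andP[ae _] he] := mean_value (ltW a0) ab hw.
    by move=> E; rewrite E ltxx in a0.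
  rewrite -subr_le0 he mulr_le0_ge0 //; last by rewrite subr_ge0 ltW.
  rewrite -mulrA mulNr oppr_le0 mulr_ge0 // mulr_ge0 ?sqr_ge0 //.
  by rewrite ltW // t_gt0 // (lt_trans a0).
move=> r1 r10; pose C := `|w r1|.
(* Near 0, [w] may be unbounded, but only from above: being decreasing, it is at least [w r1], hence
   at least [- C], on the interval up to [r1]. The weight adds [C] to [w], which makes [f]
   nonincreasing, while [f] is at most [d^2], which tends to 0. *)
pose f r := d r ^+ 2 * expR (- 4 * C * tint r).
have hf (r : R) : 0 < r -> is_derive r 1 f (- 4 * t r * (w r + C) * (d r ^+ 2 * expR (- 4 * C * tint r))).
  move=> r0; have he := @is_derive1_comp R expR (fun r => - 4 * C * tint r) r _ _
    (is_derive_expR _) (derZ (- 4 * C) (tint_derive r0)).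
  apply: is_derive_eq (derM (derX 2 (hd r r0)) he) _ => /=.
  by move: (expR _) => e; ring.
have fdecr (a : R) : 0 < a -> a <= r1 -> f r1 <= f a.
  move=> a0; rewrite le_eqVlt => /orP[/eqP -> //|ab].
  have [|e /andP[ae er] he] := mean_value (ltW a0) ab hf.
    by move=> E; rewrite E ltxx in a0.
  have e0 := lt_trans a0 ae.
  rewrite -subr_le0 he mulr_le0_ge0 //; last by rewrite subr_ge0 ltW.
  rewrite mulr_le0_ge0 //; last by rewrite mulr_ge0 ?sqr_ge0 ?expR_ge0.
  rewrite -mulrA mulNr oppr_le0 mulr_ge0 // mulr_ge0 //.
    by rewrite ltW // t_gt0.
  rewrite -lerBlDr sub0r; apply: le_trans (wdecr e r1 e0 (ltW er)).
  by rewrite lerNl /C -normrN ler_norm.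
apply/eqP; rewrite -sqrf_eq0; apply/negP => /negP n0.
have f10 : 0 < f r1 by rewrite mulr_gt0 ?expR_gt0 // lt_def n0 sqr_ge0.
have d20 : d r ^+ 2 @[r --> 0^'+] --> 0.
  rewrite -[X in _ --> X](mulr0 0); under eq_fun do rewrite expr2.
  exact: cvgM.
have hsmall : \forall r \near (0 : R)^'+, d r ^+ 2 < f r1.
  by apply: (cvgr_lt _ d20).
have hr1 := nbhs_right_lt r10; have h0 := nbhs_right_gt (0 : R).
have : \forall s \near (0 : R)^'+, (d s ^+ 2 < f r1 /\ s < r1) /\ 0 < s.
  by apply: filterI => //; apply: filterI.
move=> /(@filter_ex _ _ (at_right_proper_filter (0 : R))) [s [[s1 s2] s3]].
have := fdecr s s3 (ltW s2); apply/negP; rewrite -ltNge.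
apply: le_lt_trans s1; rewrite ler_piMr ?sqr_ge0 // -expR0 ler_expR.
by rewrite -mulrA mulNr oppr_le0 mulr_ge0 // mulr_ge0 ?normr_ge0 // ltW // tint_gt0.
Qed.

End Profile.

(** * The profile and its quotients as a quadratic system *)

Section ProfileSystem.
Variables (R : realType) (nu0 : R) (t nu : R -> R) (k : R).
Hypotheses (hnu0 : 0 < nu0) (hp : spin7_profile nu0 t nu) (k0 : 0 <= k).

Let M (r : R) := (nu r ^+ 2)^-1.
Let J (r : R) := (1 + 2 * k * tint nu0 nu r)^-1.

Lemma den_gt0 (r : R) : 0 <= r -> 0 < 1 + 2 * k * tint nu0 nu r.
Proof.
move=> r0; have : 0 <= tint nu0 nu r.
  move: r0; rewrite le_eqVlt => /orP[/eqP <-|r0]; first by rewrite (tint0 hp).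
  by rewrite ltW // (tint_gt0 hnu0 hp).
by move=> h; rewrite ltr_pwDl // mulr_ge0 // mulr_ge0.
Qed.

Definition qterm (i j : nat) (c : R) : nat * nat * R := (i, j, c).

(** The constant 1 is an unknown so that linear terms become products, and [t / nu^2] is one so that
    the cubic [t^2 / nu^2 * t] type terms stay quadratic. The unknowns with
    [J = 1 / (1 + 2 k int t)] carry the solutions for the parameter [k]. *)
Definition profile_eqs : seq (seq (nat * nat * R)) := [::
  [::];
  [:: qterm 0 0 (1); qterm 1 3 (-2)];
  [:: qterm 3 2 (-6)];
  [:: qterm 0 2 (1); qterm 3 3 (-8)];
  [:: qterm 5 4 (- (2 * k))];
  [:: qterm 0 4 (1); qterm 3 5 (-2); qterm 5 5 (- (2 * k))];
  [:: qterm 0 5 (2); qterm 3 6 (-4); qterm 5 6 (- (2 * k))];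
  [:: qterm 0 1 (1)]].

Definition profile_funs : seq (R -> R) := [:: fun=> 1; t; M; fun r => t r * M r;
  J; fun r => t r * J r; fun r => t r ^+ 2 * J r; tint nu0 nu].

(* Away from r = 0, with the further functions 1/r, t J/r and t^2 J/r^2. *)
Definition quotient_eqs := profile_eqs ++ [::
  [:: qterm 8 8 (-1)];
  [:: qterm 4 8 (1); qterm 3 9 (-2); qterm 5 9 (- (2 * k)); qterm 9 8 (-1)];
  [:: qterm 9 8 (2); qterm 3 10 (-4); qterm 5 10 (- (2 * k)); qterm 10 8 (-2)]].

Definition quotient_funs := profile_funs ++ [:: fun r => r^-1;
  fun r => t r * J r / r; fun r => t r ^+ 2 * J r / r ^+ 2].

Section Derivatives.
Variables (r : R) (r0 : 0 < r).

Let tE : is_derive r 1 t (1 - 2 * t r * (t r * M r)).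
Proof.
apply: is_derive_eq (t_derive hp r0) _.
by rewrite expr2 !mulrA.
Qed.

Let ME : is_derive r 1 M (- 6 * (t r * M r) * M r).
Proof.
have h := derV (f := fun r => nu r ^+ 2) (nusq_neq0 hnu0 hp (ltW r0)) (nusq_derive hp r0).
by apply: is_derive_eq h _; rewrite /M -exprVn; ring.
Qed.

Let aE : is_derive r 1 (fun r => t r * M r) (M r - 8 * (t r * M r) ^+ 2).
Proof. by apply: is_derive_eq (derM tE ME) _; ring. Qed.

Let JE : is_derive r 1 J (- (2 * k) * (t r * J r) * J r).
Proof.
have n0 : 1 + 2 * k * tint nu0 nu r != 0 by rewrite gt_eqF // den_gt0 // ltW.
have h := derV (f := fun r => 1 + 2 * k * tint nu0 nu r) n0
  (derD (derC 1 r (1 : R)) (derZ (2 * k) (tint_derive hp r0))).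
by apply: is_derive_eq h _; rewrite /J -exprVn; ring.
Qed.

Let bE : is_derive r 1 (fun r => t r * J r)
  (J r - 2 * (t r * M r) * (t r * J r) - 2 * k * (t r * J r) ^+ 2).
Proof. by apply: is_derive_eq (derM tE JE) _; ring. Qed.

Let hE : is_derive r 1 (fun r => t r ^+ 2 * J r)
  (2 * (t r * J r) - 4 * (t r * M r) * (t r ^+ 2 * J r)
   - 2 * k * (t r * J r) * (t r ^+ 2 * J r)).
Proof. by apply: is_derive_eq (derM (derX 2 tE) JE) _; rewrite /=; ring. Qed.

Let RE : is_derive r 1 (fun r => r^-1) (- r^-1 ^+ 2).
Proof.
have h := derV (f := id) (lt0r_neq0 r0) (is_derive_id r (1 : R)).
by apply: is_derive_eq h _; rewrite exprVn mulNr mul1r.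
Qed.

Lemma profile_system i : is_derive r 1 (nth (fun=> 0) profile_funs i)
  (rhs (nth [::] profile_eqs) (fun i => nth (fun=> 0) profile_funs i r) i).
Proof.
rewrite /rhs; case: i => [|[|[|[|[|[|[|[|i]]]]]]]] /=.
- by rewrite big_nil; exact: derC.
- by apply: is_derive_eq tE _; rewrite !big_cons big_nil /=; ring.
- by apply: is_derive_eq ME _; rewrite !big_cons big_nil /=; ring.
- by apply: is_derive_eq aE _; rewrite !big_cons big_nil /=; ring.
- by apply: is_derive_eq JE _; rewrite !big_cons big_nil /=; ring.
- by apply: is_derive_eq bE _; rewrite !big_cons big_nil /=; ring.
- by apply: is_derive_eq hE _; rewrite !big_cons big_nil /=; ring.
- by apply: is_derive_eq (tint_derive hp r0) _; rewrite !big_cons big_nil /=; ring.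
- by rewrite !nth_nil big_nil; exact: derC.
Qed.

Lemma quotient_system i : is_derive r 1 (nth (fun=> 0) quotient_funs i)
  (rhs (nth [::] quotient_eqs) (fun i => nth (fun=> 0) quotient_funs i r) i).
Proof.
have [i8|i8] := ltnP i 8.
  have h := profile_system i.
  rewrite /quotient_funs nth_cat i8; apply: is_derive_eq h _.
  rewrite /rhs /quotient_eqs nth_cat i8.
  by case: i i8 => [|[|[|[|[|[|[|[|i]]]]]]]] // _; rewrite /= ?big_cons ?big_nil.
rewrite -(subnKC i8); move: (i - 8)%N => {i8}i; rewrite /rhs.
case: i => [|[|[|i]]] /=.
- by apply: is_derive_eq RE _; rewrite !big_cons big_nil /=; ring.
- apply: is_derive_eq (derM bE RE) _; rewrite !big_cons big_nil /=; ring.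
- have h := derM hE (derX 2 RE).
  rewrite (_ : (fun y : R => _) = fun r => t r ^+ 2 * J r / r ^+ 2) in h; last first.
    by apply/funext => y; rewrite exprVn.
  by apply: is_derive_eq h _; rewrite !big_cons big_nil /= -exprVn; ring.
- by rewrite !nth_nil big_nil; exact: derC.
Qed.

End Derivatives.

Lemma profile_cvg0 i : nth (fun=> 0) profile_funs i @ 0^'+
  --> nth (fun=> 0) profile_funs i 0.
Proof.
have ht : t @ 0^'+ --> t 0 by case: hp => _ [].
have hn : nu r ^+ 2 @[r --> 0^'+] --> nu 0 ^+ 2.
  have h : nu @ 0^'+ --> nu 0 by case: hp => _ [].
  by rewrite expr2; under eq_fun do rewrite expr2; exact: cvgM.
have hI : tint nu0 nu @ 0^'+ --> tint nu0 nu 0.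
  by rewrite (tint0 hp); exact: (tint_cvg0 hp).
have hM : M @ 0^'+ --> M 0.
  by apply: cvgV => //; exact: (nusq_neq0 hnu0 hp).
have hJ : J @ 0^'+ --> J 0.
  apply: cvgV; first by rewrite gt_eqF // den_gt0.
  by apply: cvgD; [exact: cvg_cst|exact: cvgMl_tmp].
case: i => [|[|[|[|[|[|[|[|i]]]]]]]] //=.
- exact: cvg_cst.
- exact: cvgM.
- exact: cvgM.
- apply: cvgM => //; rewrite expr2; under eq_fun do rewrite expr2; exact: cvgM.
- by rewrite nth_nil; exact: cvg_cst.
Qed.

Let T n i := tcoef (nth [::] profile_eqs)
  (fun i => nth (fun=> 0) profile_funs i 0) n i.

(** The odd unknowns are [t], [t / nu^2] and [t J]; all three vanish at 0 because [t] does. *)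
Lemma profile_parity n i : odd n (+) (i \in [:: 1; 3; 5]%N) -> T n i = 0.
Proof.
have t0 : t 0 = 0 by case: hp => -[].
apply: (tcoef_parity (par := fun i => i \in [:: 1; 3; 5]%N)) => {}i.
  by case: i => [|[|[|[|[|[|[|[|i]]]]]]]] //; rewrite /= nth_nil.
by rewrite !inE => /or3P[] /eqP -> /=; rewrite t0 ?mul0r.
Qed.

(** Both [t^2 J] and twice the integral of [t] start with [r^2]. This permits the division by [r^2],
    and the division of their difference by [r^4]. *)
Lemma profile_coef : [/\ T 0 6 = 0, T 1 6 = 0 & T 2 6 = 1] /\
  [/\ T 0 7 = 0, T 1 7 = 0 & 2 * T 2 7 = 1].
Proof.
have t0 : t 0 = 0 by case: hp => -[].
have I0 : tint nu0 nu 0 = 0 by exact: (tint0 hp).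
have S n i := tcoefS (nth [::] profile_eqs)
  (fun i => nth (fun=> 0) profile_funs i 0) n i.
have T00 : T 0 0 = 1 by [].
have T01 : T 0 1 = 0 by [].
have T03 : T 0 3 = 0 by rewrite /T /tcoef /= t0 mul0r.
have T04 : T 0 4 = 1 by rewrite /T /tcoef /= /J I0 mulr0 addr0 invr1.
have T05 : T 0 5 = 0 by rewrite /T /tcoef /= t0 mul0r.
have T06 : T 0 6 = 0 by rewrite /T /tcoef /= t0 expr0n mul0r.
have T07 : T 0 7 = 0 by rewrite /T /tcoef /= I0.
have T16 : T 1 6 = 0 by exact: profile_parity.
have T17 : T 1 7 = 0 by exact: profile_parity.
have T10 : T 1 0 = 0 by exact: profile_parity.
have T11 : T 1 1 = 1.
  have := S 0%N 1%N; rewrite /index_iota /= !big_cons !big_nil /= -!/(T _ _).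
  by rewrite T00 T01 T03 => h; rewrite -[LHS]mul1r h; ring.
have T15 : T 1 5 = 1.
  have := S 0%N 5%N; rewrite /index_iota /= !big_cons !big_nil /= -!/(T _ _).
  by rewrite T00 T04 T05 T03 => h; rewrite -[LHS]mul1r h; ring.
have two0 : (2 : R) != 0 by rewrite pnatr_eq0.
split; split => //.
- apply: (mulfI two0).
  have := S 1%N 6%N; rewrite /index_iota /= !big_cons !big_nil /= -!/(T _ _).
  by rewrite T00 T05 T06 T03 T10 T15 T16 => ->; ring.
- have := S 1%N 7%N; rewrite /index_iota /= !big_cons !big_nil /= -!/(T _ _).
  by rewrite T00 T01 T10 T11 => ->; ring.
Qed.

Definition quot_fun (r : R) : R := if r == 0 then 1 else t r ^+ 2 * J r / r ^+ 2.

Lemma quot_fun_even : even_germ quot_fun.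
Proof.
have [rho [q [B [rho0 q0 B0 hb hs]]]] :=
  system_analytic0 (fun i r r0 => profile_system r0 i) profile_cvg0.
have [[c0 c1 c2] _] := profile_coef.
have h := @even_germ_quotient R (fun n => T n 6) (nth (fun=> 0) profile_funs 6)
  q B rho 1 rho0 q0 B0 (fun n => hb n 6%N) _ _ (fun r => hs 6%N r).
rewrite (_ : quot_fun = fun r => if r == 0 then T 2 6 else
  nth (fun=> 0) profile_funs 6 r / r ^+ 2); last by rewrite c2.
apply: h => n; first by move=> hn; apply: profile_parity; rewrite hn.
by rewrite ltnS leqn0 => /eqP ->.
Qed.

(** At 0 the first two coefficients of [t^2 J] vanish and the series is shifted. Away from 0 the
    quotient is itself an unknown of the enlarged system, so no quotient of power series has to be
    expanded. *)
Lemma quot_fun_analytic (c : R) :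
  real_analytic_on [set r | 0 <= r] (fun r => c * quot_fun r).
Proof.
move=> r0 /=; rewrite le_eqVlt => /orP[/eqP <-|r00].
  have [rho [q [B [rho0 q0 B0 hb hs]]]] :=
    system_analytic0 (fun i r r0 => profile_system r0 i) profile_cvg0.
  have [[c0 c1 c2] _] := profile_coef.
  exists (fun n => c * T n.+2 6), rho; split => // r rge; rewrite subr0 => rr.
  apply: pseries_scale; rewrite /quot_fun; case: eqP => [->|/eqP rn0].
    by rewrite -c2; exact: (@pseries0 R (fun n => T n.+2 6)).
  have := hs 6%N r; rewrite rge -(ger0_norm rge) rr => /(_ isT).
  rewrite ger0_norm // => h; have := pseries_tail rn0 c0 h.
  move=> /(pseries_tail rn0 c1); rewrite -mulrA -invfM -expr2; exact.
have [rho rho0 hs] := system_analytic (fun i r r0 => quotient_system r0 i) r00.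
(* The radius is at most [r0], which keeps r positive and excludes the separately defined value at
   0. *)
exists (fun n => c * tcoef (nth [::] quotient_eqs)
  (fun i => nth (fun=> 0) quotient_funs i r0) n 10), (Num.min rho r0).
split; first by rewrite lt_min rho0.
move=> r rge; rewrite lt_min => /andP[rr rr0]; apply: pseries_scale.
have rp : 0 < r.
  rewrite lt_def rge andbT; apply: contraTneq rr0 => ->.
  by rewrite sub0r normrN gtr0_norm // ltxx.
by rewrite /quot_fun gt_eqF //; exact: (hs 10%N r rr).
Qed.

Lemma tint_quot_even : even_germ (fun r => if r == 0 then 1 else
  2 * tint nu0 nu r / r ^+ 2).
Proof.
have [rho [q [B [rho0 q0 B0 hb hs]]]] :=
  system_analytic0 (fun i r r0 => profile_system r0 i) profile_cvg0.
have [_ [c0 c1 c2]] := profile_coef.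
have h := @even_germ_quotient R (fun n => 2 * T n 7)
  (fun r => 2 * tint nu0 nu r) (2 * q) B rho 1 rho0 _ B0 _ _ _ _.
rewrite (_ : (fun r => _) = fun r : R => if r == 0 then 2 * T 1.*2 7
  else 2 * tint nu0 nu r / r ^+ 1.*2); last by rewrite -[1.*2]/2%N c2.
apply: h => [|n|n hn|n|r hr].
- exact: mulr_ge0.
- by rewrite normrM -mulrA ger0_norm // ler_wpM2l // hb.
- by rewrite profile_parity ?mulr0 // hn.
- by rewrite ltnS leqn0 => /eqP ->; rewrite c0 mulr0.
- exact/pseries_scale/(hs 7%N r hr).
Qed.

(** Both terms have leading part [r^2] and are even, so their difference starts at order 4. For
    [k = 0] this is what makes [x - 1] divisible by [r^2] for the limiting solution. *)
Lemma tint_defect_even : exists w : R, even_germ (fun r => if r == 0 then w else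
  (2 * tint nu0 nu r - t r ^+ 2 * J r) / r ^+ 4).
Proof.
have [rho [q [B [rho0 q0 B0 hb hs]]]] :=
  system_analytic0 (fun i r r0 => profile_system r0 i) profile_cvg0.
have [[c0 c1 c2] [c0' c1' c2']] := profile_coef.
have h := @even_germ_quotient R (fun n => 2 * T n 7 - T n 6)
  (fun r => 2 * tint nu0 nu r - t r ^+ 2 * J r) (3 * q) B rho 2 rho0 _ B0 _ _ _ _.
eexists; apply: h => [|n|n hn|n|r hr].
- exact: mulr_ge0.
- apply: le_trans (ler_normB _ _) _; rewrite normrM ger0_norm //.
  have -> : 3 * q * B ^+ n = 2 * (q * B ^+ n) + q * B ^+ n by ring.
  by rewrite lerD ?ler_wpM2l // hb.
- by rewrite !profile_parity ?hn // mulr0 subrr.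
- by case: n => [|[|]] // _; rewrite ?c0 ?c0' ?c2 ?c2' ?mulr0 subrr.
rewrite (_ : pseries _ r = pseries (fun n => 2 * T n 7) r \- pseries (T^~ 6) r).
  by apply: cvgB; [exact/pseries_scale/(hs 7%N r hr)|exact: (hs 6%N r hr)].
apply/funext => n; rewrite /pseries /series /= -sumrB.
by apply: eq_bigr => i _; rewrite mulrBl.
Qed.

End ProfileSystem.

(** * Smooth maps *)

Section ClassC.
Variable R : realType.
Implicit Types (V W : normedModType R) (k : nat).

Lemma near_eq_differentiable V W (f g : V -> W) (x : V) :
  (\near x, f x = g x) -> differentiable f x -> differentiable g x.
Proof.
move=> fg df; have [c hf] := (diff_locallyP _ _).1 df.
have h : g \o shift x = cst (g x) + 'd f x +o_ 0 id.
  apply/eqaddoP => e e0; move/eqaddoP : hf => /(_ e e0) hf.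
  have fg' : \forall h \near (0 : V), f (h + x) = g (h + x).
    by have := fg; rewrite (near_shift 0 x) subr0.
  near=> y.
  have -> : (g \o shift x - (cst (g x) + 'd f x)) y
    = (f \o shift x - (cst (f x) + 'd f x)) y.
    rewrite !fctE /= (near fg' y) //; congr (_ - (_ + _)).
    by rewrite (nbhs_singleton fg).
  by near: y.
by apply/diff_locallyP; rewrite (diff_unique c h).
Unshelve. all: by end_near. Qed.

Lemma class_CS k V W (D : set V) (f : V -> W) : class_C k.+1 D f ->
  (forall p, D p -> differentiable f p) /\ (forall v, class_C k D ('D_v f)).
Proof. by []. Qed.

Lemma class_CW k V W (D : set V) (f : V -> W) :
  class_C k.+1 D f -> class_C k D f.
Proof.
elim: k f => [|k IH] f [h1 h2]; first by move=> p /h1 /differentiable_continuous.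
by split => // v; apply: IH.
Qed.

Lemma class_C_cont k V W (D : set V) (f : V -> W) :
  class_C k D f -> forall p, D p -> {for p, continuous f}.
Proof.
case: k => [//|k] [h _] p /h; exact: differentiable_continuous.
Qed.

Lemma open_eq_near V W (D : set V) (f g : V -> W) p : open D -> D p ->
  (forall p, D p -> f p = g p) -> \near p, f p = g p.
Proof.
move=> oD Dp fg; have := open_nbhs_nbhs (conj oD Dp).
by apply: filterS => q; exact: fg.
Qed.

Lemma eq_class_C k V W (D : set V) (f g : V -> W) : open D ->
  (forall p, D p -> f p = g p) -> class_C k D f -> class_C k D g.
Proof.
move=> oD; elim: k f g => [|k IH] f g fg /=.
  move=> h p Dp; rewrite /prop_for /continuous_at -fg //.
  apply: cvg_trans (h p Dp); apply: near_eq_cvg.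
  by have := open_eq_near oD Dp fg.
move=> [h1 h2]; split => [p Dp|v].
  exact: near_eq_differentiable (open_eq_near oD Dp fg) (h1 _ Dp).
apply: (IH (fun p => 'D_v f p)) => // p Dp.
exact/near_eq_derive/(open_eq_near oD Dp fg).
Qed.

Lemma sub_class_C k V W (D D' : set V) (f : V -> W) : D `<=` D' ->
  class_C k D' f -> class_C k D f.
Proof.
move=> s; elim: k f => [|k IH] f /=; first by move=> h p /s; exact: h.
by move=> [h1 h2]; split => [p /s|v]; [exact: h1|exact: IH].
Qed.

(** Derivatives are taken of the globally defined function and do not refer to the set, so
    smoothness glues over a covering. *)
Lemma class_CU k V W (D D' : set V) (f : V -> W) :
  class_C k D f -> class_C k D' f -> class_C k (D `|` D') f.
Proof.
elim: k f => [|k IH] f /=; first by move=> h h' p [/h|/h'].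
move=> [h1 h2] [h1' h2']; split => [p [/h1|/h1'] //|v]; exact: IH.
Qed.

Lemma class_C_cst k V W (D : set V) (c : W) : class_C k D (fun=> c).
Proof.
elim: k c => [|k IH] c /=; first by move=> p _; exact: cvg_cst.
split=> [p _|v]; first exact: differentiable_cst.
have -> : 'D_v (fun=> c) = (fun _ : V => 0 : W).
  by apply/funext => p; exact: derive_cst.
exact: IH.
Qed.

Lemma class_CD k V W (D : set V) (f g : V -> W) : open D ->
  class_C k D f -> class_C k D g -> class_C k D (fun p => f p + g p).
Proof.
move=> oD; elim: k f g => [|k IH] f g /=.
  by move=> hf hg p Dp; apply: cvgD; [exact: hf|exact: hg].
move=> [f1 f2] [g1 g2]; split => [p Dp|v].
  by apply: differentiableD; [exact: f1|exact: g1].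
apply: (@eq_class_C k _ _ D (fun p => 'D_v f p + 'D_v g p)) => // [p Dp|].
  by rewrite [RHS]deriveD //; apply: diff_derivable; [exact: f1|exact: g1].
exact: IH.
Qed.

Lemma class_CN k V W (D : set V) (f : V -> W) : open D ->
  class_C k D f -> class_C k D (fun p => - f p).
Proof.
move=> oD; elim: k f => [|k IH] f /=.
  by move=> hf p Dp; apply: cvgN; exact: hf.
move=> [f1 f2]; split => [p Dp|v]; first by apply: differentiableN; exact: f1.
apply: (@eq_class_C k _ _ D (fun p => - 'D_v f p)) => // [p Dp|].
  by rewrite [RHS]deriveN //; apply: diff_derivable; exact: f1.
exact: IH.
Qed.

Lemma class_CB k V W (D : set V) (f g : V -> W) : open D ->
  class_C k D f -> class_C k D g -> class_C k D (fun p => f p - g p).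
Proof. by move=> oD hf hg; apply: class_CD => //; exact: class_CN. Qed.

Lemma class_C_sum k V W (D : set V) (I : Type) (r : seq I) (f : I -> V -> W) :
  open D -> (forall i, class_C k D (f i)) ->
  class_C k D (fun p => \sum_(i <- r) f i p).
Proof.
move=> oD hf; elim: r => [|i r IH].
  by under eq_fun do rewrite big_nil; exact: class_C_cst.
by under eq_fun do rewrite big_cons; exact: class_CD.
Qed.

Lemma class_CM k V (D : set V) (f g : V -> R) : open D ->
  class_C k D f -> class_C k D g -> class_C k D (fun p => f p * g p).
Proof.
move=> oD; elim: k f g => [|k IH] f g hf hg.
  by move=> p Dp; apply: cvgM; [exact: hf|exact: hg].
have [f1 f2] := class_CS hf; have [g1 g2] := class_CS hg; split => [p Dp|v].
  by apply: differentiableM; [exact: f1|exact: g1].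
apply: (@eq_class_C k _ _ D (fun p => 'D_v f p * g p + f p * 'D_v g p)) => // [p Dp|].
  have df := derivableP (@diff_derivable _ _ _ f p v (f1 p Dp)).
  have dg := derivableP (@diff_derivable _ _ _ g p v (g1 p Dp)).
  by have [_ ->] := derM df dg.
by apply: class_CD => //; apply: IH => //; exact: class_CW.
Qed.

Lemma class_CX k V (D : set V) (f : V -> R) n : open D ->
  class_C k D f -> class_C k D (fun p => f p ^+ n).
Proof.
move=> oD hf; elim: n => [|n IH].
  by under eq_fun do rewrite expr0; exact: class_C_cst.
by under eq_fun do rewrite exprS; exact: class_CM.
Qed.

Lemma class_CV k V (D : set V) (f : V -> R) : open D ->
  (forall p, D p -> f p != 0) ->
  class_C k D f -> class_C k D (fun p => (f p)^-1).
Proof.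
move=> oD f0; elim: k => [|k IH] hf.
  by move=> p Dp; apply: cvgV; [exact: f0|exact: hf].
have [f1 f2] := class_CS hf; split => [p Dp|v].
  by apply: differentiableV; [exact: f1|exact: f0].
have IH' := IH (class_CW hf).
apply: (@eq_class_C k _ _ D (fun p => - 'D_v f p * ((f p)^-1 * (f p)^-1))) => // [p Dp|].
  have df := derivableP (@diff_derivable _ _ _ f p v (f1 p Dp)).
  by have [_ ->] := derV (f0 p Dp) df; rewrite expr2 invfM.
by apply: class_CM => //; [exact: class_CN|exact: class_CM].
Qed.

Lemma derive_scale1 W (g : R -> W) (y c : R) : differentiable g y ->
  'D_c g y = c *: 'D_1 g y.
Proof.
by move=> dg; rewrite !deriveE // -[c in LHS]mulr1 -[c * 1]/(c *: 1) linearZ.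
Qed.

Lemma class_C_comp1 k V (D : set V) (D' : set R) (g : R -> R) (f : V -> R) :
  open D -> (forall p, D p -> D' (f p)) ->
  class_C k D' g -> class_C k D f -> class_C k D (fun p => g (f p)).
Proof.
move=> oD fD; elim: k g => [|k IH] g hg hf.
  move=> p Dp; apply: (@continuous_comp _ _ _ f g); first exact: hf.
  exact/hg/fD.
have [g1 g2] := class_CS hg; have [f1 f2] := class_CS hf; split => [p Dp|v].
  by apply: (@differentiable_comp _ _ _ _ f g); [exact: f1|exact/g1/fD].
apply: (@eq_class_C k _ _ D (fun p => 'D_v f p * 'D_1 g (f p))) => // [p Dp|].
  have df := f1 _ Dp; have dg := g1 _ (fD _ Dp).
  rewrite [RHS]deriveE; last exact: (@differentiable_comp _ _ _ _ f g).
  rewrite (@diff_comp _ _ _ _ f g) //= -!deriveE // [RHS]derive_scale1 //.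
apply: class_CM => //; exact: (IH ('D_1 g) (g2 1) (class_CW hf)).
Qed.

Lemma class_C_linear k (V' V : normedModType R) W (D : set V) (f : V -> W)
  (L : {linear V' -> V}) : open D -> continuous L ->
  class_C k D f -> class_C k (L @^-1` D) (fun p => f (L p)).
Proof.
move=> oD cL; elim: k f => [|k IH] f /=.
  move=> hf p Dp; apply: (@continuous_comp _ _ _ L f); first exact: cL.
  exact: hf.
have dL p : differentiable L p by exact: linear_differentiable.
move=> [f1 f2]; split => [p Dp|v].
  by apply: (@differentiable_comp _ _ _ _ L f) => //; exact: f1.
have oD' : open (L @^-1` D) by exact: open_comp.
apply: (@eq_class_C k _ _ _ (fun p => 'D_(L v) f (L p))) => // [p Dp|].
  have df := f1 _ Dp; rewrite [RHS]deriveE.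
    by rewrite (@diff_comp _ _ _ _ L f) //= diff_lin // -deriveE.
  exact: (@differentiable_comp _ _ _ _ L f).
exact: (IH ('D_(L v) f) (f2 (L v))).
Qed.

Lemma class_C_id_coord k m n (D : set 'M[R]_(m, n)) i j :
  class_C k D (fun p : 'M[R]_(m, n) => p i j).
Proof.
case: k => [|k]; first by move=> p _; exact: coord_continuous.
split=> [p _|v]; first exact: differentiable_coord.
have -> : 'D_v (fun p : 'M[R]_(m, n) => p i j) = fun=> v i j.
  apply/funext => p.
  have := derive_mx (@derivable_id R 'M[R]_(m, n) p v).
  by rewrite derive_id => /matrixP /(_ i j); rewrite mxE => <-.
exact: class_C_cst.
Qed.

Lemma class_C_entry k V m n (D : set V) (f : V -> 'M[R]_(m, n)) i j : open D ->
  class_C k D f -> class_C k D (fun p => f p i j).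
Proof.
move=> oD; elim: k f => [|k IH] f.
  move=> h p Dp; apply: (@continuous_comp _ _ _ f (fun N => N i j)).
    exact: h.
  exact: coord_continuous.
move=> /class_CS [f1 f2]; split=> [p Dp|v].
  apply: (@differentiable_comp _ _ _ _ f (fun N => N i j)); first exact: f1.
  exact: differentiable_coord.
apply: (@eq_class_C k _ _ D (fun p => 'D_v f p i j)) => // [p Dp|].
  by rewrite derive_mx ?mxE //; apply: diff_derivable; exact: f1.
exact: IH.
Qed.

Lemma differentiable_mx V m n (f : V -> 'M[R]_(m, n)) (p : V) :
  (forall i j, differentiable (fun q => f q i j : R) p) -> differentiable f p.
Proof.
move=> h.
rewrite (_ : f = \sum_(i < m) \sum_(j < n)
   (fun q => (f q i j : R) *: delta_mx i j)); last first.
  apply/funext => q; rewrite {1}(matrix_sum_delta (f q)).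
  rewrite fct_sumE; apply: eq_bigr => i _; rewrite fct_sumE.
  exact: eq_bigr.
apply: differentiable_sum => i; apply: differentiable_sum => j.
exact: differentiableZl.
Qed.

Lemma class_C_mx k V m n (D : set V) (f : V -> 'M[R]_(m, n)) : open D ->
  (forall i j, class_C k D (fun p => f p i j)) -> class_C k D f.
Proof.
move=> oD; elim: k f => [|k IH] f h.
  move=> p Dp; apply/cvgrPdist_le => /= e e0.
  have hi : \forall q \near p, forall ij : 'I_m * 'I_n,
      `|f p ij.1 ij.2 - f q ij.1 ij.2| <= e.
    by apply: filter_forall => ij; have /cvgrPdist_le := h ij.1 ij.2 p Dp; exact.
  near=> q.
  have hq : forall ij : 'I_m * 'I_n, `|f p ij.1 ij.2 - f q ij.1 ij.2| <= e.
    by near: q.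
  rewrite /Num.Def.normr/= mx_normrE (bigmax_le _ (ltW e0))//= => -[i j] _.
  by rewrite !mxE /=; exact: (hq (i, j)).
have h1 i j p : D p -> differentiable (fun q => f q i j : R) p.
  by move=> Dp; have [+ _] := class_CS (h i j); exact.
have hd p : D p -> differentiable f p.
  by move=> Dp; apply: differentiable_mx => i j; exact: h1.
split=> // v; apply: IH => i j.
apply: (@eq_class_C k _ _ D (fun p => 'D_v (fun q => f q i j : R) p)) => // [p Dp|].
  by rewrite derive_mx ?mxE //; apply: diff_derivable; exact: hd.
by have [_ +] := class_CS (h i j); exact.
Unshelve. all: by end_near. Qed.

Lemma class_C_sqrt k : class_C k [set x : R | 0 < x] (@Num.sqrt R).
Proof.
have oD : open [set x : R | 0 < x] by exact: open_gt.
have dS (x : R) : 0 < x -> is_derive x 1 (@Num.sqrt R) ((2 * Num.sqrt x)^-1).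
  exact: is_derive1_sqrt.
have hd (x : R) : 0 < x -> differentiable (@Num.sqrt R) x.
  by move=> x0; apply/derivable1_diffP; have [] := dS _ x0.
elim: k => [|k IH]; first by move=> x /= x0; exact: sqrt_continuous.
split=> [x /= x0|v]; first exact: hd.
apply: (@eq_class_C k _ _ _ (fun x => v * (2 * Num.sqrt x)^-1)) => // [x /= x0|].
  have [_ E] := dS _ x0.
  exact: esym (etrans (derive_scale1 v (hd x x0)) (congr1 (fun y => v *: y) E)).
apply: class_CM => //; first exact: class_C_cst.
apply: class_CV => //; first by move=> x /= x0; rewrite mulf_neq0 // gt_eqF ?sqrtr_gt0.
by apply: class_CM => //; exact: class_C_cst.
Qed.

End ClassC.

(** * Smoothness of power series and of radial functions *)

Section PowerSeriesSmooth.
Variable R : realType.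
Implicit Types (c : R^nat).

(** Radius of convergence at least [1 / B]. The bound is asked for every larger [B'], since termwise
    differentiation introduces a factor [n + 1] that a bound with [B] itself would not absorb. *)
Definition growth (B : R) c :=
  forall B' : R, B < B' -> exists q : R, forall n, `|c n| <= q * B' ^+ n.

Lemma bernoulli (e : R) n : 0 <= e -> 1 + n%:R * e <= (1 + e) ^+ n.
Proof.
move=> e0; elim: n => [|n IH]; first by rewrite mul0r addr0.
rewrite exprS; apply: (@le_trans _ _ ((1 + e) * (1 + n%:R * e))).
  rewrite -subr_ge0 -natr1.
  have -> : (1 + e) * (1 + n%:R * e) - (1 + (n%:R + 1) * e) = n%:R * e ^+ 2 by ring.
  by rewrite mulr_ge0 ?sqr_ge0.
by rewrite ler_wpM2l // addr_ge0.
Qed.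

(** An intermediate rate [C] between [B] and [B'] leaves a ratio [1 + e = B' / C], and Bernoulli's
    inequality bounds [n + 1] by a multiple of [(1 + e)^n]. *)
Lemma growth_diffs (B : R) c : 0 < B -> growth B c -> growth B (pseries_diffs c).
Proof.
move=> B0 hc B' BB'; pose C := (B + B') / 2.
have BC : B < C by rewrite /C; lra.
have CB' : C < B' by rewrite /C; lra.
have C0 : 0 < C by lra.
have [q hq] := hc C BC.
pose e := B' / C - 1.
have e0 : 0 < e by rewrite subr_gt0 ltr_pdivlMr // mul1r.
have e0' := ltW e0.
exists (q * C * (1 + e^-1)) => n; rewrite /pseries_diffs normrM ger0_norm ?ler0n //.
have hn : n.+1%:R <= (1 + e^-1) * (1 + e) ^+ n.
  apply: (@le_trans _ _ ((1 + e^-1) * (1 + n%:R * e))); last first.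
    by rewrite ler_wpM2l ?bernoulli // addr_ge0 // invr_ge0.
  have -> : (1 + e^-1) * (1 + n%:R * e) = 1 + n%:R + n%:R * e + e^-1.
    by field; rewrite gt_eqF.
  by rewrite -natr1 addrC -addrA lerDl addr_ge0 ?mulr_ge0 ?invr_ge0 // ltW.
have -> : q * C * (1 + e^-1) * B' ^+ n
    = (1 + e^-1) * (1 + e) ^+ n * (q * C ^+ n.+1).
  have -> : B' = (1 + e) * C by rewrite /e; field; rewrite gt_eqF.
  by rewrite exprMn exprS; ring.
by apply: ler_pM.
Qed.

Lemma growth_cvg (B : R) c x : 0 < B -> growth B c -> `|x| < B^-1 ->
  cvgn (pseries c x).
Proof.
move=> B0 hc hx.
have [->|x0] := eqVneq x 0; first by apply/cvg_ex; exists (c 0%N); exact: pseries0.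
have nx0 : 0 < `|x| by rewrite normr_gt0.
have xB : B < `|x|^-1 by rewrite -[B]invrK ltf_pV2 // posrE // invr_gt0.
have BC : B < (B + `|x|^-1) / 2 by lra.
have [q hq] := hc _ BC.
set C := (_ / 2) in hq.
have C0 : 0 < C by rewrite divr_gt0 // addr_gt0 // invr_gt0.
have Cx : C * `|x| < 1.
  rewrite -ltr_pdivlMr // mul1r /C; lra.
apply: normed_cvg.
apply: (@series_le_cvg _ _ (geometric q (C * `|x|))) => [n|n|n|].
- exact: normr_ge0.
- have q0 : 0 <= q by apply: le_trans (normr_ge0 (c 0%N)) _; have := hq 0%N; rewrite expr0 mulr1.
  by rewrite /geometric /= mulr_ge0 // exprn_ge0 // mulr_ge0 // ltW.
- by rewrite /geometric /= normrM normrX exprMn mulrA ler_wpM2r // exprn_ge0.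
- by apply: is_cvg_geometric_series; rewrite ger0_norm // mulr_ge0 // ltW.
Qed.

Lemma class_C_pseries k (B : R) c : 0 < B -> growth B c ->
  class_C k [set x : R | `|x| < B^-1] (fun x : R => limn (pseries c x)).
Proof.
move=> B0; set D := (X in class_C k X).
have oD : open D.
  rewrite (_ : D = ball (0 : R) B^-1); first exact: ball_open.
  by apply/seteqP; split=> x; rewrite /D /ball /= sub0r normrN.
have hd c' (x : R) : growth B c' -> D x -> is_derive x 1
    (fun x : R => limn (pseries c' x)) (limn (pseries (pseries_diffs c') x)).
  move=> hc' Dx; pose K := (`|x| + B^-1) / 2.
  have Dx' : `|x| < B^-1 := Dx.
  have xK : `|x| < K by rewrite /K; lra.
  have KB : K < B^-1 by rewrite /K; lra.
  have nK : `|K| = K by rewrite ger0_norm // (le_trans _ (ltW xK)).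
  apply: (@pseries_snd_diffs R c' K x); rewrite ?nK //.
  - by apply: (growth_cvg B0); rewrite ?nK.
  - by apply: (growth_cvg B0); rewrite ?nK //; exact: growth_diffs.
  - by apply: (growth_cvg B0); rewrite ?nK //; do 2 apply: growth_diffs => //.
have hdd c' (x : R) : growth B c' -> D x ->
    differentiable (fun x : R => limn (pseries c' x)) x.
  by move=> hc' Dx; apply/derivable1_diffP; have [] := hd c' x hc' Dx.
elim: k c => [|k IH] c hc.
  by move=> x Dx; apply: differentiable_continuous; exact: hdd.
split=> [x Dx|v]; first exact: hdd.
apply: (@eq_class_C _ k _ _ _ (fun x => v * limn (pseries (pseries_diffs c) x))) => // [x Dx|].
  have [_ E] := hd c x hc Dx.
  exact: esym (etrans (derive_scale1 v (hdd c x hc Dx)) (congr1 (fun y => v *: y) E)).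
apply: class_CM => //; first exact: class_C_cst.
by apply: IH; exact: growth_diffs.
Qed.

End PowerSeriesSmooth.

Section RadialSmooth.
Variable R : realType.
Implicit Types q : 'rV[R]_4.

Definition normsq q : R := \sum_m q 0 m ^+ 2.

Lemma class_C_normsq k (D : set 'rV[R]_4) : open D -> class_C k D normsq.
Proof.
move=> oD; apply: class_C_sum => // m; apply: class_CX => //.
exact: class_C_id_coord.
Qed.

Lemma normsq_ge0 q : 0 <= normsq q.
Proof. by apply: sumr_ge0 => m _; rewrite sqr_ge0. Qed.

Lemma normsq_eq0 q : (normsq q == 0) = (q == 0).
Proof.
apply/idP/eqP => [|->]; last first.
  by rewrite /normsq big1 // => m _; rewrite mxE expr0n.
rewrite psumr_eq0 => [/allP h|m _]; last by rewrite sqr_ge0.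
apply/rowP => m; rewrite mxE; apply/eqP; rewrite -sqrf_eq0.
by apply: h; rewrite mem_index_enum.
Qed.

Lemma qnorm_sq q : qnorm q ^+ 2 = normsq q.
Proof. by rewrite sqr_sqrtr // normsq_ge0. Qed.

Lemma qnorm_ge0 q : 0 <= qnorm q. Proof. exact: sqrtr_ge0. Qed.

Lemma qnorm_gt0 q : (0 < qnorm q) = (q != 0).
Proof. by rewrite /qnorm sqrtr_gt0 lt_def normsq_ge0 andbT normsq_eq0. Qed.

Lemma open_neq0 : open [set q : 'rV[R]_4 | q != 0].
Proof.
rewrite (_ : [set q : 'rV[R]_4 | q != 0] = normsq @^-1` [set x | x != 0]).
  apply: open_comp; last exact: open_neq.
  by move=> q _; apply: (@class_C_cont R 0 _ _ setT normsq) => //; exact: (@class_C_normsq 0 setT openT).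
by apply/seteqP; split=> q /=; rewrite normsq_eq0.
Qed.

Lemma class_C_qnorm k : class_C k [set q : 'rV[R]_4 | q != 0] (@qnorm R).
Proof.
apply: (@class_C_comp1 R k _ _ [set x | 0 < x] (@Num.sqrt R) normsq).
- exact: open_neq0.
- by move=> q /= q0; rewrite lt_def normsq_ge0 normsq_eq0 q0.
- exact: class_C_sqrt.
- exact/class_C_normsq/open_neq0.
Qed.

Lemma class_C_radial k (f : R -> R) : class_C k [set r : R | 0 < r] f ->
  class_C k [set q : 'rV[R]_4 | q != 0] (fun q => f (qnorm q)).
Proof.
move=> hf; apply: (@class_C_comp1 R k _ _ [set x | 0 < x] f) => //.
- exact: open_neq0.
- by move=> q /=; rewrite qnorm_gt0.
- exact: class_C_qnorm.
Qed.

(** The space is covered by a small ball, on which [f] is a power series in the polynomial [normsq],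
    and the complement of the origin, on which [qnorm] is smooth. *)
Lemma class_C_even k (f : R -> R) : even_germ f -> class_C k [set r : R | 0 < r] f ->
  class_C k setT (fun q => f (qnorm q)).
Proof.
move=> [c [Q [B [rho [rho0 hc f0 hf]]]]] hk.
have B10 : 0 < `|B| + 1 by rewrite ltr_pwDr.
pose d := Num.min (`|B| + 1)^-1 (rho ^+ 2).
have d0 : 0 < d by rewrite lt_min invr_gt0 B10 exprn_gt0.
pose D := [set q | normsq q < d].
have oD : open D.
  apply: (@open_comp _ _ normsq [set x | x < d]); last exact: open_lt.
  by move=> q _; apply: (@class_C_cont R 0 _ _ setT normsq) => //; exact: (@class_C_normsq 0 setT openT).
have Q0 : 0 <= Q by apply: le_trans (normr_ge0 (c 0%N)) _; have := hc 0%N; rewrite expr0 mulr1.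
have gc : growth (`|B| + 1) c.
  move=> B' hB'; exists Q => n; apply: le_trans (hc n) _.
  rewrite ler_wpM2l //; apply: le_trans (ler_norm _) _; rewrite normrX.
  have bB : `|B| <= B' by apply: le_trans (ltW hB'); rewrite lerDl.
  by apply: lerXn2r => //; rewrite nnegrE // (le_trans _ bB).
apply: (@sub_class_C _ k _ _ _ (D `|` [set q : 'rV[R]_4 | q != 0])).
  move=> q _; have [->|q0] := eqVneq q 0; [left|by right].
  by rewrite /D /= (_ : normsq 0 = 0) //; apply/eqP; rewrite normsq_eq0.
apply: class_CU; last exact: class_C_radial.
apply: (@eq_class_C _ k _ _ D (fun q => limn (pseries c (normsq q)))) => // [q|].
  rewrite /D /= lt_min => /andP[_ hr]; apply: cvg_lim => //.
  rewrite -qnorm_sq; apply: hf; rewrite qnorm_ge0 /=.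
  by rewrite -(@ltr_pXn2r _ 2) ?nnegrE ?qnorm_ge0 ?qnorm_sq // ltW.
apply: (@class_C_comp1 R k _ D [set x : R | `|x| < (`|B| + 1)^-1]
  (fun x => limn (pseries c x)) normsq) => //.
- by move=> q; rewrite /D /= lt_min (ger0_norm (normsq_ge0 q)) => /andP[].
- exact: class_C_pseries.
- exact: class_C_normsq.
Qed.

End RadialSmooth.

Section ProfileSmooth.
Variables (R : realType) (nu0 : R) (t nu : R -> R).
Hypotheses (hnu0 : 0 < nu0) (hp : spin7_profile nu0 t nu).
Let D := [set r : R | 0 < r].
Let oD : open D. Proof. exact: open_gt. Qed.

(** Bootstrapping: the derivatives are polynomials in the unknowns, so C^k for all of them gives
    C^(k+1). *)
Lemma class_C_system k (l : seq (seq (nat * nat * R))) (fs : seq (R -> R)) :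
  (forall i (r : R), 0 < r -> is_derive r 1 (nth (fun=> 0) fs i)
    (rhs (nth [::] l) (fun i => nth (fun=> 0) fs i r) i)) ->
  forall i, class_C k D (nth (fun=> 0) fs i).
Proof.
move=> h; have hd i (r : R) : 0 < r -> differentiable (nth (fun=> 0) fs i : R -> R) r.
  by move=> r0; apply/derivable1_diffP; have [] := h i r r0.
elim: k => [|k IH] i; first by move=> r r0; apply: differentiable_continuous; exact: hd.
split=> [r r0|v]; first exact: hd.
apply: (@eq_class_C _ k _ _ _ (fun r => v *
  rhs (nth [::] l) (fun i => nth (fun=> 0) fs i r) i)) => // [r r0|].
  have [_ E] := h i r r0.
  exact: esym (etrans (derive_scale1 v (hd i r r0)) (congr1 (fun y => v *: y) E)).
apply: class_CM => //; first exact: class_C_cst.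
apply: class_C_sum => // e; apply: class_CM => //; first exact: class_C_cst.
by apply: class_CM.
Qed.

Lemma class_C_t k : class_C k D t.
Proof.
exact: (class_C_system k (fun i r r0 => profile_system hnu0 hp (lexx 0) r0 i) 1).
Qed.

Lemma class_C_tint k : class_C k D (tint nu0 nu).
Proof.
exact: (class_C_system k (fun i r r0 => profile_system hnu0 hp (lexx 0) r0 i) 7).
Qed.

End ProfileSmooth.

(** * Quaternions *)

Section QuaternionAlgebra.
Variable R : realType.
Local Notation H := 'rV[R]_4.
Implicit Types x y z q : H.

Lemma quatP x y : x 0 0 = y 0 0 -> x 0 1 = y 0 1 -> x 0 2 = y 0 2 ->
  x 0 3 = y 0 3 -> x = y.
Proof.
move=> h0 h1 h2 h3; apply/rowP => -[[|[|[|[|//]]]] hm].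
- by rewrite (_ : Ordinal hm = 0) //; exact/val_inj.
- by rewrite (_ : Ordinal hm = 1) //; exact/val_inj.
- by rewrite (_ : Ordinal hm = 2) //; exact/val_inj.
- by rewrite (_ : Ordinal hm = 3) //; exact/val_inj.
Qed.

Lemma quat_sum (f : 'I_4 -> R) : \sum_(m < 4) f m = f 0 + f 1 + f 2 + f 3.
Proof.
rewrite !big_ord_recl big_ord0 addr0 !addrA.
by congr (f _ + f _ + f _ + f _); apply/val_inj.
Qed.

Lemma qmul0 x y : qmul x y 0 0
  = x 0 0 * y 0 0 - x 0 1 * y 0 1 - x 0 2 * y 0 2 - x 0 3 * y 0 3.
Proof. by rewrite mxE. Qed.
Lemma qmul1 x y : qmul x y 0 1
  = x 0 0 * y 0 1 + x 0 1 * y 0 0 + x 0 2 * y 0 3 - x 0 3 * y 0 2.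
Proof. by rewrite mxE. Qed.
Lemma qmul2 x y : qmul x y 0 2
  = x 0 0 * y 0 2 + x 0 2 * y 0 0 + x 0 3 * y 0 1 - x 0 1 * y 0 3.
Proof. by rewrite mxE. Qed.
Lemma qmul3 x y : qmul x y 0 3
  = x 0 0 * y 0 3 + x 0 3 * y 0 0 + x 0 1 * y 0 2 - x 0 2 * y 0 1.
Proof. by rewrite mxE. Qed.
Definition qmulE := (qmul0, qmul1, qmul2, qmul3).

Lemma qconj0 x : qconj x 0 0 = x 0 0. Proof. by rewrite mxE. Qed.
Lemma qconj1 x : qconj x 0 1 = - x 0 1. Proof. by rewrite mxE. Qed.
Lemma qconj2 x : qconj x 0 2 = - x 0 2. Proof. by rewrite mxE. Qed.
Lemma qconj3 x : qconj x 0 3 = - x 0 3. Proof. by rewrite mxE. Qed.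
Definition qconjE := (qconj0, qconj1, qconj2, qconj3).

Lemma qim0 x : qim x 0 0 = 0. Proof. by rewrite mxE. Qed.
Lemma qim1 x : qim x 0 1 = x 0 1. Proof. by rewrite mxE. Qed.
Lemma qim2 x : qim x 0 2 = x 0 2. Proof. by rewrite mxE. Qed.
Lemma qim3 x : qim x 0 3 = x 0 3. Proof. by rewrite mxE. Qed.
Definition qimE := (qim0, qim1, qim2, qim3).

Lemma rowD n (x y : 'rV[R]_n) m : (x + y) 0 m = x 0 m + y 0 m.
Proof. by rewrite mxE. Qed.
Lemma rowN n (x : 'rV[R]_n) m : (- x) 0 m = - x 0 m.
Proof. by rewrite mxE. Qed.
Lemma rowZ n (c : R) (x : 'rV[R]_n) m : (c *: x) 0 m = c * x 0 m.
Proof. by rewrite mxE. Qed.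
Definition quatE := (rowD, rowN, rowZ, qmulE, qconjE, qimE).

Lemma qmulA x y z : qmul x (qmul y z) = qmul (qmul x y) z.
Proof. by apply: quatP; rewrite !quatE; ring. Qed.
Lemma qmulDl x y z : qmul (x + y) z = qmul x z + qmul y z.
Proof. by apply: quatP; rewrite !quatE; ring. Qed.
Lemma qmulDr x y z : qmul x (y + z) = qmul x y + qmul x z.
Proof. by apply: quatP; rewrite !quatE; ring. Qed.
Lemma qmulZl c x y : qmul (c *: x) y = c *: qmul x y.
Proof. by apply: quatP; rewrite !quatE; ring. Qed.
Lemma qmulZr c x y : qmul x (c *: y) = c *: qmul x y.
Proof. by apply: quatP; rewrite !quatE; ring. Qed.
Lemma qmulNl x y : qmul (- x) y = - qmul x y.
Proof. by apply: quatP; rewrite !quatE; ring. Qed.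
Lemma qmulNr x y : qmul x (- y) = - qmul x y.
Proof. by apply: quatP; rewrite !quatE; ring. Qed.

Definition qone : H := basis_vec R 0.

Lemma qone0 : qone 0 0 = 1. Proof. by rewrite mxE. Qed.
Lemma qone1 : qone 0 1 = 0. Proof. by rewrite mxE. Qed.
Lemma qone2 : qone 0 2 = 0. Proof. by rewrite mxE. Qed.
Lemma qone3 : qone 0 3 = 0. Proof. by rewrite mxE. Qed.
Definition qoneE := (qone0, qone1, qone2, qone3).

Lemma qmul_1l x : qmul qone x = x.
Proof. by apply: quatP; rewrite !quatE !qoneE; ring. Qed.
Lemma qmul_1r x : qmul x qone = x.
Proof. by apply: quatP; rewrite !quatE !qoneE; ring. Qed.

Lemma normsqE x : normsq x = x 0 0 ^+ 2 + x 0 1 ^+ 2 + x 0 2 ^+ 2 + x 0 3 ^+ 2.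
Proof. exact: quat_sum. Qed.

Lemma qinvE x : qinv x = (normsq x)^-1 *: qconj x.
Proof. by rewrite /qinv qnorm_sq. Qed.

Lemma qmulV x : x != 0 -> qmul x (qinv x) = qone.
Proof.
rewrite -normsq_eq0 normsqE => n0.
by apply: quatP; rewrite qinvE normsqE !quatE !qoneE; field.
Qed.

Lemma imagE : (imag 0 = 1) * (imag 1 = 2) * (imag 2 = 3).
Proof. by split; [split|]; apply/val_inj. Qed.

Lemma ordSE : (ordS (0 : 'I_3) = 1) * (ordS (1 : 'I_3) = 2)
  * (ordS (2 : 'I_3) = 0).
Proof. by split; [split|]; apply/val_inj. Qed.

Lemma ord3P (P : 'I_3 -> Prop) : P 0 -> P 1 -> P 2 -> forall i, P i.
Proof.
move=> h0 h1 h2 [[|[|[|//]]] hi].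
- by rewrite (_ : Ordinal hi = 0) //; exact/val_inj.
- by rewrite (_ : Ordinal hi = 1) //; exact/val_inj.
- by rewrite (_ : Ordinal hi = 2) //; exact/val_inj.
Qed.

Lemma sum_ord3 (f : 'I_3 -> R) : \sum_(i < 3) f i = f 0 + f 1 + f 2.
Proof.
rewrite !big_ord_recl big_ord0 addr0 !addrA.
by congr (f _ + f _ + f _); apply/val_inj.
Qed.

Lemma qcomm_imag x y (i : 'I_3) : qcomm x y 0 (imag i)
  = 2 * (x 0 (imag (ordS i)) * y 0 (imag (ordS (ordS i)))
         - x 0 (imag (ordS (ordS i))) * y 0 (imag (ordS i))).
Proof.
by move: i; apply: ord3P; rewrite /qcomm !ordSE !imagE !quatE; ring.
Qed.

(** The self-dual 2-form [e^0 /\ e^i + e^j /\ e^k], (i, j, k) cyclic, evaluated on two vectors given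
    by their components. *)
Definition sigma (i : 'I_3) x y : R :=
  x 0 0 * y 0 (imag i) - x 0 (imag i) * y 0 0
  + (x 0 (imag (ordS i)) * y 0 (imag (ordS (ordS i)))
     - x 0 (imag (ordS (ordS i))) * y 0 (imag (ordS i))).

(** Left multiplication acts on the self-dual forms through the adjoint representation on imaginary
    quaternions. Both sides scale with the squared norm of [q], so [q] need not be a unit. *)
Lemma sigma_conj q x y (i : 'I_3) (S : H) :
  S 0 0 = 0 -> (forall j, S 0 (imag j) = sigma j x y) ->
  qmul (qmul (qconj q) S) q 0 (imag i)
  = sigma i (qmul (qconj q) x) (qmul (qconj q) y).
Proof.
move=> S0 hS; have := (hS 0, hS 1, hS 2); rewrite !imagE => -[[h1 h2] h3].
by move: i; apply: ord3P;
  rewrite /sigma !ordSE !imagE !quatE S0 h1 h2 h3 /sigma !ordSE !imagE; ring.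
Qed.

Lemma inner_qmul q x y : \sum_m qmul q x 0 m * qmul q y 0 m
  = normsq q * \sum_m x 0 m * y 0 m.
Proof. by rewrite !quat_sum normsqE !quatE; ring. Qed.

Lemma normsq_qmul x y : normsq (qmul x y) = normsq x * normsq y.
Proof.
by rewrite !normsqE !quatE; ring.
Qed.

Lemma normsq_qconj x : normsq (qconj x) = normsq x.
Proof. by rewrite !normsqE !quatE; ring. Qed.

End QuaternionAlgebra.

Section QuaternionCalculus.
Variables (R : realType) (V : normedModType R).
Local Notation H := 'rV[R]_4.
Implicit Types (f g : V -> H) (p v : V).

Lemma is_derive_mx m n (f : V -> 'M[R]_(m, n)) p v (df : 'M[R]_(m, n)) :
  (forall i j, is_derive p v (fun x => f x i j : R) (df i j)) ->
  is_derive p v f df.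
Proof.
move=> h; have d : derivable f p v.
  by apply/derivable_mxP => i j; have [] := h i j.
apply: DeriveDef => //; rewrite derive_mx //; apply/matrixP => i j.
by rewrite mxE; have [_ ->] := h i j.
Qed.

Lemma is_derive_entry m n (f : V -> 'M[R]_(m, n)) p v (df : 'M[R]_(m, n)) i j :
  is_derive p v f df -> is_derive p v (fun x => f x i j : R) (df i j).
Proof.
move=> [d <-]; apply: DeriveDef; first by move/derivable_mxP: d; exact.
by rewrite derive_mx // mxE.
Qed.

Lemma is_derive_quat f p v (df : H) :
  is_derive p v (fun x => f x 0 0 : R) (df 0 0) ->
  is_derive p v (fun x => f x 0 1 : R) (df 0 1) ->
  is_derive p v (fun x => f x 0 2 : R) (df 0 2) ->
  is_derive p v (fun x => f x 0 3 : R) (df 0 3) -> is_derive p v f df.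
Proof.
move=> h0 h1 h2 h3; apply: is_derive_mx => i j; rewrite (ord1 i) {i}.
case: j => -[|[|[|[|//]]]] hm.
- by rewrite (_ : Ordinal hm = 0) //; exact/val_inj.
- by rewrite (_ : Ordinal hm = 1) //; exact/val_inj.
- by rewrite (_ : Ordinal hm = 2) //; exact/val_inj.
- by rewrite (_ : Ordinal hm = 3) //; exact/val_inj.
Qed.

Lemma der_qmul f g p v (df dg : H) : is_derive p v f df -> is_derive p v g dg ->
  is_derive p v (fun x => qmul (f x) (g x)) (qmul df (g p) + qmul (f p) dg).
Proof.
move=> hf hg.
have F m := is_derive_entry 0 m hf; have G m := is_derive_entry 0 m hg.
have P i j := derM (F i) (G j).
apply: is_derive_quat; rewrite rowD !qmulE.
- under eq_fun do rewrite qmul0.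
  by apply: is_derive_eq (derB (derB (derB (P 0 0) (P 1 1)) (P 2 2)) (P 3 3)) _; ring.
- under eq_fun do rewrite qmul1.
  by apply: is_derive_eq (derB (derD (derD (P 0 1) (P 1 0)) (P 2 3)) (P 3 2)) _; ring.
- under eq_fun do rewrite qmul2.
  by apply: is_derive_eq (derB (derD (derD (P 0 2) (P 2 0)) (P 3 1)) (P 1 3)) _; ring.
- under eq_fun do rewrite qmul3.
  by apply: is_derive_eq (derB (derD (derD (P 0 3) (P 3 0)) (P 1 2)) (P 2 1)) _; ring.
Qed.

Lemma der_qim f p v (df : H) : is_derive p v f df ->
  is_derive p v (fun x => qim (f x)) (qim df).
Proof.
move=> hf; have F m := is_derive_entry 0 m hf.
apply: is_derive_quat; rewrite !qimE.
- by under eq_fun do rewrite qim0; exact: derC.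
- by under eq_fun do rewrite qim1; exact: F.
- by under eq_fun do rewrite qim2; exact: F.
- by under eq_fun do rewrite qim3; exact: F.
Qed.

Lemma der_normsq f p v (df : H) : is_derive p v f df ->
  is_derive p v (fun x => normsq (f x)) (2 * \sum_m f p 0 m * df 0 m).
Proof.
move=> hf; have F m := is_derive_entry 0 m hf.
rewrite /normsq; apply: is_derive_eq (der_sum _ (fun m => derX 2 (F m))) _.
by rewrite mulr_sumr; apply: eq_bigr => m _; rewrite expr1 mulrA.
Qed.

Lemma der_qinv f p v (df : H) : f p != 0 -> is_derive p v f df ->
  is_derive p v (fun x => qinv (f x)) (- qmul (qmul (qinv (f p)) df) (qinv (f p))).
Proof.
move=> f0 hf; have F m := is_derive_entry 0 m hf.
have n0 : normsq (f p) != 0 by rewrite normsq_eq0.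
have N := derV (f := fun x => normsq (f x)) n0 (der_normsq hf).
rewrite qinvE; under eq_fun do rewrite qinvE.
move: N; rewrite quat_sum => N; rewrite normsqE in n0.
apply: is_derive_quat; rewrite !quatE.
- under eq_fun do rewrite rowZ qconj0.
  by apply: is_derive_eq (derM N (F 0)) _; rewrite !normsqE; field.
- under eq_fun do rewrite rowZ qconj1.
  by apply: is_derive_eq (derM N (derN (F 1))) _; rewrite !normsqE; field.
- under eq_fun do rewrite rowZ qconj2.
  by apply: is_derive_eq (derM N (derN (F 2))) _; rewrite !normsqE; field.
- under eq_fun do rewrite rowZ qconj3.
  by apply: is_derive_eq (derM N (derN (F 3))) _; rewrite !normsqE; field.
Qed.

End QuaternionCalculus.

(** * The curvature of the spinor bundle *)

Section LeviSymbol.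
Variable R : realType.

Lemma mxDE m n (x y : 'M[R]_(m, n)) i j : (x + y) i j = x i j + y i j.
Proof. by rewrite mxE. Qed.
Lemma mxNE m n (x : 'M[R]_(m, n)) i j : (- x) i j = - x i j.
Proof. by rewrite mxE. Qed.
Lemma mxZE m n (c : R) (x : 'M[R]_(m, n)) i j : (c *: x) i j = c * x i j.
Proof. by rewrite mxE. Qed.

Definition levi_nat (s : seq nat) : R :=
  if uniq s then (-1) ^+ (sort_sign s).1 else 0.

(** Reduces the symbol, defined by a determinant, to a sorting sign that can be computed; the sorted
    lists are checked over all quadruples of indices. *)
Lemma leviE (i j k l : 'I_4) :
  levi_symbol R i j k l = levi_nat [:: val i; val j; val k; val l].
Proof.
set s := [:: _; _; _; _].
have -> : levi_symbol R i j k l = mono s (1%:M : 'M[R]_4).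
  rewrite /levi_symbol /mono -det_tr; congr (\det _).
  apply/matrixP => m n; rewrite !mxE /kron.
  have -> : tnth [tuple i; j; k; l] n = inord (nth 0%N s n).
    apply/val_inj; rewrite (tnth_nth i) /s.
    by case: n => -[|[|[|[|//]]]] hn /=; rewrite inordK.
  by rewrite eq_sym.
rewrite /levi_nat; case: ifPn => hu; last by rewrite mono_dup.
have -> : mono s (1%:M : 'M[R]_4)
    = (-1) ^+ (sort_sign s).1 * mono (sort_sign s).2 (1%:M : 'M[R]_4).
  exact: (@mono_sort R 4 3 [::] s).
have hs : s \in [seq [:: x.1.1; x.1.2; x.2.1; x.2.2] |
    x <- [seq (y, z) | y <- [seq (b, c) | b <- iota 0 4, c <- iota 0 4],
                       z <- [seq (b, c) | b <- iota 0 4, c <- iota 0 4]]].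
  apply/mapP; exists ((val i, val j), (val k, val l)) => //.
  by apply: allpairs_f; apply: allpairs_f; rewrite mem_iota /=.
have : all (fun s => uniq s ==> ((sort_sign s).2 == iota 0 4))
  [seq [:: x.1.1; x.1.2; x.2.1; x.2.2] |
    x <- [seq (y, z) | y <- [seq (b, c) | b <- iota 0 4, c <- iota 0 4],
                       z <- [seq (b, c) | b <- iota 0 4, c <- iota 0 4]]].
  by vm_compute.
move=> /allP /(_ _ hs); rewrite hu => /eqP ->.
rewrite (_ : mono _ _ = 1) ?mulr1 //.
rewrite /mono -[RHS](det1 R 4); congr (\det _); apply/matrixP => m n.
by rewrite !mxE nth_iota ?ltn_ord // add0n inord_val.
Qed.

End LeviSymbol.

Section Curvature.
Variables (R : realType) (s : R) (Z : asd_einstein_spin_orbifold s) (a : chart Z).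
Local Notation V := 'rV[R]_4.
Local Notation th := (lc a).
Implicit Types (z v w : V) (i : 'I_3).

Definition mxcomm (x y : 'M[R]_4) := x *m y - y *m x.

Lemma open_dom : open (Defs.dom a). Proof. exact: dom_open. Qed.

Lemma th_linear z (c : R) v w : Defs.dom a z ->
  th z (c *: v + w) = c *: th z v + th z w.
Proof. by move=> hz; case: (lc_levi_civita a) => -[h _] _ _; exact: h. Qed.

Lemma th_smooth v k : class_C k (Defs.dom a) (fun z => th z v).
Proof. by case: (lc_levi_civita a) => -[_ h] _ _; exact: h. Qed.

Lemma th_skew z v (j k : 'I_4) : Defs.dom a z -> th z v j k = - th z v k j.
Proof.
move=> hz; case: (lc_levi_civita a) => _ /(_ z v hz) h _.
by have /matrixP /(_ k j) := h; rewrite !mxE.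
Qed.

Lemma th_differentiable z w : Defs.dom a z -> differentiable (fun z' => th z' w) z.
Proof. by move=> hz; have [h _] := class_CS (th_smooth w 1); exact: h. Qed.

Lemma th_near (f g : V -> 'M[R]_4) z : Defs.dom a z ->
  (forall z', Defs.dom a z' -> f z' = g z') -> \near z, f z = g z.
Proof. by move=> hz fg; exact: (open_eq_near open_dom hz fg). Qed.

Definition Omega z v w := curvature mxcomm th z v w.

Lemma dth_linear_r z v (c : R) (u : V) w : Defs.dom a z ->
  'D_v (fun z' => th z' (c *: u + w)) z
  = c *: 'D_v (fun z' => th z' u) z + 'D_v (fun z' => th z' w) z.
Proof.
move=> hz.
have hd x : derivable (fun z' => th z' x) z v.
  by apply: diff_derivable; exact: th_differentiable.
rewrite (near_eq_derive _ (g := (c \*: (fun z' => th z' u)) + (fun z' => th z' w))).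
  by rewrite deriveD ?deriveZ //; exact: derivableZ.
by apply: th_near => // z' hz'; rewrite th_linear.
Qed.

Lemma dth_linear_l z w (c : R) (u : V) v : Defs.dom a z ->
  'D_(c *: u + v) (fun z' => th z' w) z
  = c *: 'D_u (fun z' => th z' w) z + 'D_v (fun z' => th z' w) z.
Proof.
by move=> hz; rewrite !deriveE ?linearP //; exact: th_differentiable.
Qed.

Lemma Omega_linear_l z w (c : R) (u : V) v : Defs.dom a z ->
  Omega z (c *: u + v) w = c *: Omega z u w + Omega z v w.
Proof.
move=> hz; rewrite /Omega /curvature dth_linear_l // dth_linear_r // th_linear //.
rewrite /mxcomm mulmxDl mulmxDr -scalemxAl -scalemxAr.
move: ('D_u _ z) ('D_v _ z) ('D_w _ z) ('D_w _ z) (_ *m _) (_ *m _) (_ *m _) (_ *m _).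
by move=> *; apply/matrixP => i j; rewrite !mxE; ring.
Qed.

Lemma Omega_linear_r z w (c : R) (u : V) v : Defs.dom a z ->
  Omega z w (c *: u + v) = c *: Omega z w u + Omega z w v.
Proof.
move=> hz; rewrite /Omega /curvature dth_linear_l // dth_linear_r // th_linear //.
rewrite /mxcomm mulmxDl mulmxDr -scalemxAl -scalemxAr.
move: ('D_u _ z) ('D_v _ z) ('D_w _ z) ('D_w _ z) (_ *m _) (_ *m _) (_ *m _) (_ *m _).
by move=> *; apply/matrixP => i j; rewrite !mxE; ring.
Qed.

Lemma linear_expand (U : lmodType R) (f : V -> U) (x : 'I_4 -> R) (e : 'I_4 -> V) :
  (forall c u v, f (c *: u + v) = c *: f u + f v) ->
  f (\sum_k x k *: e k) = \sum_k x k *: f (e k).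
Proof.
move=> hf; have f0 : f 0 = 0.
  by have := hf (-1) 0 0; rewrite scaler0 addr0 scaleN1r addNr.
elim: (index_enum _) => [|k r IH]; first by rewrite !big_nil.
by rewrite !big_cons hf IH.
Qed.

Lemma coframe_expand z v : Defs.dom a z ->
  v = \sum_k coframe (cof a) z v 0 k *: frame (cof a) z k.
Proof.
move=> hz; have hu := cof_unit hz.
rewrite -[LHS](mulmxK hu) /coframe /frame.
by rewrite mulmx_sum_row.
Qed.

Lemma Omega_riemann z v w (i j : 'I_4) : Defs.dom a z -> Omega z v w i j
  = \sum_k \sum_l coframe (cof a) z v 0 k * coframe (cof a) z w 0 l
      * riemann (cof a) th z i j k l.
Proof.
move=> hz; rewrite {1}(coframe_expand v hz) {1}(coframe_expand w hz).
rewrite (linear_expand _ _ (f := fun u => Omega z u _)); last first.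
  by move=> c u u'; exact: Omega_linear_l.
rewrite summxE; apply: eq_bigr => k _; rewrite mxZE.
rewrite (linear_expand _ _ (f := fun u => Omega z _ u)); last first.
  by move=> c u u'; exact: Omega_linear_r.
rewrite summxE mulr_sumr; apply: eq_bigr => l _; rewrite mxZE mulrA.
by congr (_ * _ * _).
Qed.

Lemma Omega_skew z v w (j k : 'I_4) : Defs.dom a z -> Omega z v w j k = - Omega z v w k j.
Proof.
move=> hz.
have hD (u u' : V) : 'D_u (fun z' => th z' u') z j k = - 'D_u (fun z' => th z' u') z k j.
  have hd : derivable (fun z' => th z' u') z u.
    by apply: diff_derivable; exact: th_differentiable.
  rewrite !derive_mx // !mxE -deriveN; last by move/derivable_mxP: hd; exact.
  apply: near_eq_derive; have := open_nbhs_nbhs (conj open_dom hz).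
  by apply: filterS => z' hz'; rewrite th_skew.
rewrite /Omega /curvature /mxcomm !(mxDE, mxNE) (hD v w) (hD w v) ![(_ *m _) _ _]mxE.
rewrite [X in _ + (X - _)](eq_bigr (fun m => th z w k m * th z v m j)); last first.
  by move=> m _; rewrite (th_skew v j m) // (th_skew w m k) // mulrNN mulrC.
rewrite [X in _ + (_ - X)](eq_bigr (fun m => th z v k m * th z w m j)); last first.
  by move=> m _; rewrite (th_skew w j m) // (th_skew v m k) // mulrNN mulrC.
ring.
Qed.

Lemma riemann_skew z (i j k l : 'I_4) : Defs.dom a z ->
  riemann (cof a) th z i j k l = - riemann (cof a) th z j i k l.
Proof. exact: Omega_skew. Qed.

(** Anti-self-duality removes the Weyl part of the self-dual combination and the Einstein condition
    removes the traceless Ricci part. The scalar part remains with coefficient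
    [s / 4 - s / 6 = s / 12]. *)
Lemma selfdual_riemann z i (k l : 'I_4) (j := imag (ordS i)) (j' := imag (ordS (ordS i))) :
  Defs.dom a z ->
  riemann (cof a) th z 0 (imag i) k l + riemann (cof a) th z j j' k l
  = s / 12 * (kron R 0 k * kron R (imag i) l - kron R (imag i) k * kron R 0 l
     + (kron R j k * kron R j' l - kron R j' k * kron R j l)).
Proof.
move=> hz.
have hs := scal_s hz; have hE := is_einstein hz; have hW := is_weyl_asd hz.
have Wskew p q : weyl (cof a) th z p q k l = - weyl (cof a) th z q p k l.
  by rewrite /weyl (riemann_skew _ _ _ _ hz); ring.
have asd : weyl (cof a) th z 0 (imag i) k l + weyl (cof a) th z j j' k l = 0.
  have := hW 0 (imag i) k l; rewrite !quat_sum !leviE /j /j'.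
  move: (fun p q => weyl (cof a) th z p q k l) Wskew => W Wskew.
  move: i {j j'}; apply: ord3P; rewrite !ordSE !imagE /levi_nat /=.
  - by rewrite (Wskew 3 2); lra.
  - by rewrite (Wskew 1 3); lra.
  - by rewrite (Wskew 2 1); lra.
move: asd; rewrite /weyl !hE !hs.
move: (riemann _ _ _ _ _ _ _) (riemann _ _ _ _ _ _ _) => R1 R2 h.
apply/eqP; rewrite -subr_eq0; apply/eqP; rewrite -[RHS]h.
by field.
Qed.

Lemma sum_kron (x y : 'I_4 -> R) (p q : 'I_4) :
  \sum_k \sum_l x k * y l * (kron R p k * kron R q l) = x p * y q.
Proof.
rewrite (bigD1 p) //= [X in _ + X]big1 ?addr0 => [|k /negPf kp].
  rewrite (bigD1 q) //= [X in _ + X]big1 ?addr0 => [|l /negPf lq].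
    by rewrite /kron !eqxx !mulr1.
  by rewrite /kron eqxx eq_sym lq !mulr0.
by rewrite big1 // => l _; rewrite /kron eq_sym kp mul0r mulr0.
Qed.

Lemma spin_connection_imag z v i : spin_connection th z v 0 (imag i)
  = - (th z v 0 (imag i) + th z v (imag (ordS i)) (imag (ordS (ordS i)))) / 2.
Proof. by rewrite mxE /imag liftK. Qed.

Lemma spin_connection0 z v : spin_connection th z v 0 0 = 0.
Proof. by rewrite mxE unlift_none. Qed.

Lemma spin_connection_linear z (c : R) v w : Defs.dom a z ->
  spin_connection th z (c *: v + w)
  = c *: spin_connection th z v + spin_connection th z w.
Proof.
move=> hz; apply/rowP => m; rewrite !mxE; case: (unlift _ m) => [i|].
  by rewrite th_linear // !mxE; field.
by rewrite mulr0 addr0.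
Qed.

Lemma spin_connection_smooth v k : class_C k (Defs.dom a) (fun z => spin_connection th z v).
Proof.
have oD := open_dom.
apply: class_C_mx => // i m; rewrite (ord1 i) {i}.
under eq_fun do rewrite mxE; case: (unlift _ m) => [i|]; last exact: class_C_cst.
have e j l : class_C k (Defs.dom a) (fun z => th z v j l).
  by apply: class_C_entry => //; exact: th_smooth.
by apply: class_CM; [|apply: class_CN; [|apply: class_CD]|exact: class_C_cst].
Qed.

(* The map th |-> A is the projection of so(4) to its first summand su(2), a Lie
   algebra homomorphism. *)
Lemma spin_curvature_Omega z v w i : Defs.dom a z ->
  curvature (@qcomm R) (spin_connection th) z v w 0 (imag i)
  = - (Omega z v w 0 (imag i)
       + Omega z v w (imag (ordS i)) (imag (ordS (ordS i)))) / 2.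
Proof.
move=> hz.
have hD u u' : 'D_u (fun z' => spin_connection th z' u') z 0 (imag i)
   = - ('D_u (fun z' => th z' u') z 0 (imag i)
     + 'D_u (fun z' => th z' u') z (imag (ordS i)) (imag (ordS (ordS i)))) / 2.
  have hd : is_derive z u (fun z' => th z' u') ('D_u (fun z' => th z' u') z).
    by apply/derivableP/diff_derivable; exact: th_differentiable.
  have hs : derivable (fun z' => spin_connection th z' u') z u.
    apply: diff_derivable.
    by have [h _] := class_CS (spin_connection_smooth u' 1); exact: h.
  rewrite derive_mx // mxE; under eq_fun do rewrite spin_connection_imag.
  have [_ ->] := derM (derN (derD (is_derive_entry 0 (imag i) hd)
    (is_derive_entry (imag (ordS i)) (imag (ordS (ordS i))) hd))) (derC 2^-1 z u).
  by rewrite mulr0 addr0.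
have skew := fun u p q => @th_skew z u p q hz.
have diag u p : th z u p p = 0.
  by have := skew u p p; lra.
rewrite /Omega /curvature rowD rowD rowN !hD qcomm_imag !spin_connection_imag.
rewrite /mxcomm !(mxDE, mxNE) ![(_ *m _) _ _]mxE !quat_sum.
move: ('D_v _ z) ('D_w _ z) => D1 D2.
move: i {hD}; apply: ord3P; rewrite !ordSE !imagE.
- rewrite !diag ?(skew _ 1 0) ?(skew _ 2 0) ?(skew _ 3 0) ?(skew _ 2 1) ?(skew _ 3 1) ?(skew _ 3 2).
  by move: (th z v) (th z w) => x y; field.
- rewrite !diag ?(skew _ 1 0) ?(skew _ 2 0) ?(skew _ 3 0) ?(skew _ 2 1) ?(skew _ 3 1) ?(skew _ 3 2).
  by move: (th z v) (th z w) => x y; field.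
- rewrite !diag ?(skew _ 1 0) ?(skew _ 2 0) ?(skew _ 3 0) ?(skew _ 2 1) ?(skew _ 3 1) ?(skew _ 3 2).
  by move: (th z v) (th z w) => x y; field.
Qed.

(** The constant is half of [s / 12], the half coming from the projection of so(4) to su(2). Hence
    the connection on the spinor bundle has self-dual curvature of constant coefficients in any
    oriented orthonormal coframe. *)
Lemma spin_curvature z v w i : Defs.dom a z ->
  curvature (@qcomm R) (spin_connection th) z v w 0 (imag i)
  = - (s / 24) * sigma i (coframe (cof a) z v) (coframe (cof a) z w).
Proof.
move=> hz; rewrite spin_curvature_Omega // !Omega_riemann //.
set x := coframe _ _ v; set y := coframe _ _ w.
rewrite -big_split /=.
under eq_bigr => k _ do rewrite -big_split /=.
under eq_bigr => k _ do under eq_bigr => l _ do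
  rewrite -mulrDr selfdual_riemann // mulrCA.
under eq_bigr => k _ do rewrite -mulr_sumr.
rewrite -mulr_sumr.
have -> : \sum_(k < 4) \sum_(l < 4) x 0 k * y 0 l *
   (kron R 0 k * kron R (imag i) l - kron R (imag i) k * kron R 0 l
     + (kron R (imag (ordS i)) k * kron R (imag (ordS (ordS i))) l
        - kron R (imag (ordS (ordS i))) k * kron R (imag (ordS i)) l))
  = sigma i x y.
  rewrite /sigma -!(sum_kron (fun k => x 0 k) (fun l => y 0 l)).
  rewrite -!sumrB -big_split /=; apply: eq_bigr => k _.
  rewrite -!sumrB -big_split /=; apply: eq_bigr => l _; ring.
by field.
Qed.

Lemma spin_curvature0 z v w : Defs.dom a z ->
  curvature (@qcomm R) (spin_connection th) z v w 0 0 = 0.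
Proof.
move=> hz; have hD u u' : 'D_u (fun z' => spin_connection th z' u') z 0 0 = 0.
  rewrite derive_mx; last first.
    apply: diff_derivable.
    by have [h _] := class_CS (spin_connection_smooth u' 1); exact: h.
  by rewrite mxE; under eq_fun do rewrite spin_connection0; exact: derive_cst.
rewrite /curvature rowD rowD rowN !hD /qcomm !quatE !spin_connection0; ring.
Qed.

End Curvature.

(** * The forms eta and their curvature on the spinor bundle *)

Section SpinorGeometry.
Variables (R : realType) (s : R) (Z : asd_einstein_spin_orbifold s) (a : chart Z).
Local Notation V := 'rV[R]_4.
Local Notation P := 'rV[R]_8.
Local Notation A := (spin_connection (lc a)).
Implicit Types (p v w : P) (i : 'I_3).

Let lsubL : {linear 'rV[R]_(4 + 4) -> 'rV[R]_4} := @lsubmx R 1 4 4.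
Let rsubL : {linear 'rV[R]_(4 + 4) -> 'rV[R]_4} := @rsubmx R 1 4 4.
Definition baseL : {linear P -> V} := lsubL.
Definition fibreL : {linear P -> V} := rsubL.

Lemma continuous_base : continuous baseL.
Proof.
have h : class_C 0 setT (@base R).
  apply: class_C_mx => [|i j]; first exact: openT.
  rewrite (_ : (fun p => _) = fun p : P => p i (lshift 4 j : 'I_8)).
    exact: (@class_C_id_coord R 0 1 8).
  by apply/funext => p; rewrite mxE.
by move=> p; exact: h.
Qed.

Lemma continuous_fibre : continuous fibreL.
Proof.
have h : class_C 0 setT (@fibre R).
  apply: class_C_mx => [|i j]; first exact: openT.
  rewrite (_ : (fun p => _) = fun p : P => p i (rshift 4 j : 'I_8)).
    exact: (@class_C_id_coord R 0 1 8).
  by apply/funext => p; rewrite mxE.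
by move=> p; exact: h.
Qed.

Lemma is_derive_linear (U W : normedModType R) (L : {linear U -> W}) (p v : U) :
  continuous L -> is_derive p v L (L v).
Proof.
move=> cL; have dL : differentiable L p by exact: linear_differentiable.
apply: DeriveDef; first exact: diff_derivable.
by rewrite deriveE // diff_lin.
Qed.

Lemma der_base p v : is_derive p v (@base R) (base v).
Proof. exact: (is_derive_linear (L := baseL) p v continuous_base). Qed.

Lemma der_fibre p v : is_derive p v (@fibre R) (fibre v).
Proof. exact: (is_derive_linear (L := fibreL) p v continuous_fibre). Qed.

Lemma base_linear (c : R) v w : base (c *: v + w) = c *: base v + base w.
Proof. exact: (linearP baseL). Qed.

Lemma fibre_linear (c : R) v w : fibre (c *: v + w) = c *: fibre v + fibre w.
Proof. exact: (linearP fibreL). Qed.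

Lemma open_domE : open (domE a).
Proof.
apply: (@open_comp _ _ baseL (Defs.dom a)); last exact: open_dom.
by move=> p _; exact: continuous_base.
Qed.

Lemma open_fibre_neq0 : open [set p : P | fibre p != 0].
Proof.
apply: (@open_comp _ _ fibreL [set q | q != 0]); last exact: open_neq0.
by move=> p _; exact: continuous_fibre.
Qed.

Lemma open_domE0 : open (domE0 a).
Proof.
rewrite (_ : domE0 a = domE a `&` [set p | fibre p != 0]) //.
by apply: openI; [exact: open_domE|exact: open_fibre_neq0].
Qed.

Lemma der_radius p v : fibre p != 0 -> is_derive p v (@Defs.radius R)
  ((\sum_m fibre p 0 m * fibre v 0 m) / qnorm (fibre p)).
Proof.
move=> q0; have n0 : 0 < normsq (fibre p) by rewrite lt_def normsq_ge0 normsq_eq0 q0.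
have hN := der_normsq (der_fibre p v).
have dN : differentiable (fun x : P => normsq (fibre x)) p.
  have h := @class_C_linear R 1 _ _ _ setT (@normsq R) fibreL openT
    continuous_fibre (@class_C_normsq R 1 setT openT).
  by have [h1 _] := class_CS h; exact: h1.
have hS := is_derive1_sqrt n0.
have dS : differentiable (@Num.sqrt R) (normsq (fibre p)).
  by apply/derivable1_diffP; have [] := hS.
have dC : differentiable (Num.sqrt \o (fun x : P => normsq (fibre x))) p.
  exact: differentiable_comp.
apply: DeriveDef; first exact: (diff_derivable dC).
rewrite deriveE // (@diff_comp _ _ _ _ (fun x : P => normsq (fibre x)) (@Num.sqrt R)) //=.
have [_ E1] := hN; have [_ E2] := hS.
rewrite deriveE // in E1; rewrite E1.
rewrite -[_ * _ in LHS]mulr1 -[_ * 1]/(_ *: (1 : R)) linearZ /=.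
rewrite deriveE // in E2; rewrite E2 /qnorm -[_ *: _]/(_ * _).
by field; rewrite gt_eqF // sqrtr_gt0.
Qed.

Lemma drE p v : fibre p != 0 ->
  dr p v = (\sum_m fibre p 0 m * fibre v 0 m) / qnorm (fibre p).
Proof. by move=> q0; have [_ <-] := der_radius v q0. Qed.

Lemma der_A p v w : Defs.dom a (base p) ->
  is_derive p v (fun p' => A (base p') (base w))
   ('D_(base v) (fun z => A z (base w)) (base p)).
Proof.
move=> hz; have dA : differentiable (fun z => A z (base w)) (base p).
  by have [h _] := class_CS (spin_connection_smooth a (base w) 1); exact: h.
have db : differentiable (@base R) p.
  exact: (linear_differentiable (f := baseL) p continuous_base).
have dC : differentiable ((fun z => A z (base w)) \o (@base R)) p.
  exact: differentiable_comp.
apply: DeriveDef; first exact: (diff_derivable dC).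
rewrite deriveE; last exact: dC.
rewrite (@diff_comp _ _ _ _ (@base R) (fun z => A z (base w))) //= [RHS]deriveE //.
congr ('d _ _ _).
by rewrite -deriveE //; have [_] := der_base p v.
Qed.

(** With [beta = q^-1 dq] and [alpha = q^-1 A q], the pure [beta] terms and the mixed terms cancel
    as for a gauge transformation. Replacing [beta] by its imaginary part is harmless because real
    quaternions are central. *)
Let eta_identity (bv bw av aw x1 x2 : V) :
  (qim (- qmul bv bw) + (- qmul bv aw + x1 + qmul aw bv))
  - (qim (- qmul bw bv) + (- qmul bw av + x2 + qmul av bw))
  + qcomm (qim bv + av) (qim bw + aw) = x1 - x2 + qcomm av aw.
Proof. by apply: quatP; rewrite /qcomm !quatE; ring. Qed.

(* With beta = q^-1 dq and alpha = q^-1 A q one has eta = Im beta + alpha. *)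
Lemma der_etaH p v w (q := fibre p) (iq := qinv (fibre p)) : domE0 a p ->
  is_derive p v (fun p' => etaH a p' w)
   (qim (- qmul (qmul iq (fibre v)) (qmul iq (fibre w)))
    + (- qmul (qmul iq (fibre v)) (qmul (qmul iq (A (base p) (base w))) q)
       + qmul (qmul iq ('D_(base v) (fun z => A z (base w)) (base p))) q
       + qmul (qmul (qmul iq (A (base p) (base w))) q) (qmul iq (fibre v)))).
Proof.
move=> [hz q0].
have hI := der_qinv q0 (der_fibre p v).
have h1 := der_qim (der_qmul hI (is_derive_cst (fibre w) p v)).
have h2 := der_qmul (der_qmul hI (der_A v w hz)) (der_fibre p v).
apply: is_derive_eq (is_deriveD h1 h2) _.
rewrite /cst -/q -/iq.
have E x : qmul (qmul (qmul iq x) q) (qmul iq (fibre v)) = qmul (qmul iq x) (fibre v).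
  by rewrite -(qmulA _ q) (qmulA q) qmulV // qmul_1l.
rewrite E qmulDl !qmulNl !qmulA; congr (qim _ + _).
by have := qmulZr 0 iq 0; rewrite !scale0r => ->; rewrite addr0.
Qed.

Lemma curvature_etaH p v w : domE0 a p ->
  curvature (@qcomm R) (etaH a) p v w =
  qmul (qmul (qinv (fibre p))
    (curvature (@qcomm R) A (base p) (base v) (base w))) (fibre p).
Proof.
move=> hp; have [hz q0] := hp.
rewrite /curvature; have [_ ->] := der_etaH v w hp; have [_ ->] := der_etaH w v hp.
rewrite /etaH eta_identity /qcomm.
set q := fibre p; set iq := qinv q.
have E x y : qmul (qmul (qmul iq x) q) (qmul (qmul iq y) q)
    = qmul (qmul iq (qmul x y)) q.
  by rewrite !qmulA -(qmulA _ q iq) qmulV // qmul_1r.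
by rewrite !E !(qmulDr, qmulDl, qmulNr, qmulNl).
Qed.

(** The horizontal coframe turned by the inverse of the unit quaternion [q / |q|]. This keeps the
    horizontal metric, and in it the [omega_i] become the standard forms [sigma i], independently of
    [q]. *)
Definition unit_coframe p v : V :=
  (qnorm (fibre p))^-1 *: qmul (qconj (fibre p)) (coframe (cof a) (base p) (base v)).

Lemma curvature_eta p v w i : domE0 a p ->
  curvature (@qcomm R) (etaH a) p v w 0 (imag i)
  = - (s / 24) * sigma i (unit_coframe p v) (unit_coframe p w).
Proof.
move=> hp; have [hz q0] := hp.
rewrite curvature_etaH //; set F := curvature _ _ _ _ _.
set x := coframe (cof a) (base p) (base v); set y := coframe (cof a) (base p) (base w).
pose S : V := \row_m (if unlift ord0 m is Some j then sigma j x y else 0).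
have S0 : S 0 0 = 0 by rewrite mxE unlift_none.
have Si j : S 0 (imag j) = sigma j x y by rewrite mxE /imag liftK.
have FS : F = - (s / 24) *: S.
  apply/rowP => m; rewrite mxZE; case: (unliftP ord0 m) => [j|] ->.
    by rewrite -/(imag j) Si /F spin_curvature.
  by rewrite (_ : ord0 = 0) // S0 mulr0 /F spin_curvature0.
rewrite FS qinvE !(qmulZr, qmulZl) !mxZE (sigma_conj _ _ S0 Si) -qnorm_sq.
rewrite /unit_coframe -/x -/y /sigma !mxZE.
have n0 : qnorm (fibre p) != 0 by rewrite gt_eqF // qnorm_gt0.
by field.
Qed.

End SpinorGeometry.

(** * The instanton equation for radial connections *)

Section CayleyIdentity.
Variable R : realType.

(** The G2-form [phi] in the adapted coframe, once the factors [t] and [nu] have been absorbed. *)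
Definition phi_terms : signed_terms := [:: (false, [:: 5; 6; 7]);
  (true, [:: 0; 1; 5]); (true, [:: 2; 3; 5]);
  (true, [:: 0; 2; 6]); (false, [:: 1; 3; 6]);
  (true, [:: 0; 3; 7]); (true, [:: 1; 2; 7])]%N.

Lemma ev_phi (m : seq nat -> R) (ev := fun L : signed_terms =>
    \sum_(x <- L) (-1) ^+ x.1 * m x.2) :
  ev (swedge (swedge [:: (false, [:: 5])] [:: (false, [:: 6])]) [:: (false, [:: 7])])
  - (ev (swedge [:: (false, [:: 5])] (om 0)) + ev (swedge [:: (false, [:: 6])] (om 1))
     + ev (swedge [:: (false, [:: 7])] (om 2))) = ev phi_terms.
Proof.
rewrite /ev.
set L1 := swedge _ _; set L2 := swedge _ _; set L3 := swedge _ _; set L4 := swedge _ _.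
vm_compute in L1, L2, L3, L4; rewrite /L1 /L2 /L3 /L4 /phi_terms.
by rewrite !big_cons !big_nil; simpl; ring.
Qed.

Lemma ev_cayley (m : seq nat -> R) (ev := fun L : signed_terms =>
    \sum_(x <- L) (-1) ^+ x.1 * m x.2) :
  ev (swedge [:: (false, [:: 4])] phi_terms)
  + (6^-1 * (ev (swedge (om 0) (om 0)) + ev (swedge (om 1) (om 1))
             + ev (swedge (om 2) (om 2)))
     - (ev (swedge (swedge [:: (false, [:: 5])] [:: (false, [:: 6])]) (om 2))
        + ev (swedge (swedge [:: (false, [:: 6])] [:: (false, [:: 7])]) (om 0))
        + ev (swedge (swedge [:: (false, [:: 7])] [:: (false, [:: 5])]) (om 1))))
  = ev cayley.
Proof.
rewrite /ev.
set L1 := swedge _ _; set L2 := swedge _ _; set L3 := swedge _ _; set L4 := swedge _ _.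
set L5 := swedge _ _; set L6 := swedge _ _; set L7 := swedge _ _.
vm_compute in L1, L2, L3, L4, L5, L6, L7.
rewrite /L1 /L2 /L3 /L4 /L5 /L6 /L7 /cayley.
by rewrite !big_cons !big_nil; simpl; field.
Qed.

End CayleyIdentity.

Lemma inner8 (R : realType) (k c d d' : R) (u v : 'rV[R]_4) (e f : 'I_3 -> R) :
  \sum_(l < 8)
    [:: k * u 0 0; k * u 0 1; k * u 0 2; k * u 0 3; d; c * e 0; c * e 1; c * e 2]`_l
    * [:: k * v 0 0; k * v 0 1; k * v 0 2; k * v 0 3; d'; c * f 0; c * f 1; c * f 2]`_l
  = k ^+ 2 * \sum_m u 0 m * v 0 m + d * d' + c ^+ 2 * \sum_(i < 3) e i * f i.
Proof. rewrite 8!big_ord_recl big_ord0 quat_sum sum_ord3 /=; ring. Qed.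

(** * The adapted orthonormal coframe of g_Theta *)

Section OrthonormalCoframe.
Variables (R : realType) (s : R) (hs : 0 < s) (Z : asd_einstein_spin_orbifold s).
Variables (a : chart Z) (nu0 : R) (t nu : R -> R).
Hypotheses (hnu0 : 0 < nu0) (hprof : spin7_profile nu0 t nu).
Local Notation V := 'rV[R]_4.
Local Notation P := 'rV[R]_8.
Variables (p : P) (hp : domE0 a p).
Implicit Types (v w : P) (i : 'I_3).

Let r := Defs.radius p.
Let K := Num.sqrt (s * nu r ^+ 2 / 48).

Let q0 : fibre p != 0. Proof. by case: hp. Qed.
Let hz : Defs.dom a (base p). Proof. by case: hp. Qed.
Let r0 : 0 < r. Proof. by rewrite qnorm_gt0. Qed.
Let t0 : t r != 0. Proof. exact: (t_neq0 hnu0 hprof). Qed.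
Let n0 : nu r ^+ 2 != 0. Proof. exact: (nusq_neq0 hnu0 hprof (ltW r0)). Qed.
Let s0 : s != 0. Proof. by rewrite gt_eqF. Qed.
Let n1 : nu r != 0. Proof. by rewrite -sqrf_eq0. Qed.
Let K2 : K ^+ 2 = s * nu r ^+ 2 / 48.
Proof.
rewrite sqr_sqrtr // divr_ge0 // mulr_ge0 ?ltW //.
exact: (nusq_gt0 hnu0 hprof (ltW r0)).
Qed.
Let K0 : K != 0.
Proof. by rewrite -sqrf_eq0 K2 mulf_neq0 ?invr_eq0 ?pnatr_eq0 // mulf_neq0. Qed.

Definition coframe8 v : P := \row_(j < 8)
  [:: K * unit_coframe a p v 0 0; K * unit_coframe a p v 0 1;
      K * unit_coframe a p v 0 2; K * unit_coframe a p v 0 3;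
      dr p v; t r * Defs.eta a 0 p v; t r * Defs.eta a 1 p v; t r * Defs.eta a 2 p v]`_j.

Definition coframe_mx : 'M[R]_8 := \matrix_(i, j) coframe8 (basis_vec R i) 0 j.
Local Notation C := coframe_mx.

Lemma coframe8E v (j : 'I_8) : coframe8 v 0 j =
  [:: K * unit_coframe a p v 0 0; K * unit_coframe a p v 0 1;
      K * unit_coframe a p v 0 2; K * unit_coframe a p v 0 3;
      dr p v; t r * Defs.eta a 0 p v; t r * Defs.eta a 1 p v; t r * Defs.eta a 2 p v]`_j.
Proof. by rewrite [LHS]mxE. Qed.

Lemma coframe_linear (c : R) (x y : V) :
  coframe (cof a) (base p) (c *: x + y)
  = c *: coframe (cof a) (base p) x + coframe (cof a) (base p) y.
Proof. by rewrite /coframe mulmxDl scalemxAl. Qed.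

Lemma etaH_linear (c : R) v w : etaH a p (c *: v + w) = c *: etaH a p v + etaH a p w.
Proof.
have qimL (x y : V) : qim (c *: x + y) = c *: qim x + qim y.
  by apply: quatP; rewrite !quatE; ring.
rewrite /etaH base_linear fibre_linear spin_connection_linear //.
by rewrite !qmulDr !qmulZr qmulDl qmulZl qimL scalerDr addrACA.
Qed.

Lemma coframe8_linear (c : R) v w :
  coframe8 (c *: v + w) = c *: coframe8 v + coframe8 w.
Proof.
apply/rowP => j; rewrite mxDE mxZE !coframe8E.
have hu m : unit_coframe a p (c *: v + w) 0 m
    = c * unit_coframe a p v 0 m + unit_coframe a p w 0 m.
  by rewrite /unit_coframe base_linear coframe_linear qmulDr qmulZr !(mxZE, mxDE); ring.
have hd : dr p (c *: v + w) = c * dr p v + dr p w.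
  by rewrite !drE // fibre_linear !quat_sum !quatE; ring.
have he i : Defs.eta a i p (c *: v + w) = c * Defs.eta a i p v + Defs.eta a i p w.
  by rewrite /Defs.eta etaH_linear mxDE mxZE.
case: j => -[|[|[|[|[|[|[|[|//]]]]]]]] hj /=; first 4 last.
- exact: hd.
- by rewrite he mulrDr mulrCA.
- by rewrite he mulrDr mulrCA.
- by rewrite he mulrDr mulrCA.
- by rewrite hu mulrDr mulrCA.
- by rewrite hu mulrDr mulrCA.
- by rewrite hu mulrDr mulrCA.
- by rewrite hu mulrDr mulrCA.
Qed.

Lemma mul_coframe_mx v : v *m C = coframe8 v.
Proof.
have h00 : coframe8 0 = 0.
  by have := coframe8_linear (-1) 0 0; rewrite scaler0 addr0 scaleN1r addNr.
rewrite [in RHS](row_sum_delta v).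
have : forall l : seq 'I_8, coframe8 (\sum_(i <- l) v 0 i *: delta_mx 0 i)
    = \sum_(i <- l) v 0 i *: coframe8 (delta_mx 0 i).
  elim=> [|i l IH]; first by rewrite !big_nil.
  by rewrite !big_cons coframe8_linear IH.
move=> ->; apply/rowP => j; rewrite mxE summxE; apply: eq_bigr => i _.
by rewrite mxZE [C _ _]mxE.
Qed.

Lemma coframeE v (M := v *m C) :
  [/\ forall m : 'I_4, M 0 (inord m) = K * unit_coframe a p v 0 m,
      M 0 (inord 4) = dr p v &
      forall i : 'I_3, M 0 (inord (5 + i)) = t r * Defs.eta a i p v].
Proof.
rewrite /M mul_coframe_mx; split.
- case=> -[|[|[|[|//]]]] hm; rewrite coframe8E inordK //=.
  + by rewrite (_ : Ordinal hm = 0) //; apply: val_inj.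
  + by rewrite (_ : Ordinal hm = 1) //; apply: val_inj.
  + by rewrite (_ : Ordinal hm = 2) //; apply: val_inj.
  + by rewrite (_ : Ordinal hm = 3) //; apply: val_inj.
- by rewrite coframe8E inordK.
- by apply: ord3P; rewrite coframe8E inordK.
Qed.

(** On a vector in the kernel, the horizontal entries force [base v = 0]; then [dr] and the [eta_i]
    are the real part, up to a nonzero factor, and the imaginary part of [q^-1 dq], so [fibre v = 0]
    too. *)
Lemma coframe_unit : C \in unitmx.
Proof.
rewrite -row_free_unit -kermx_eq0; apply/rowV0P => v /sub_kermxP vC.
have [h1 h2 h3] := coframeE v; rewrite vC in h1 h2 h3.
have u0 : unit_coframe a p v = 0.
  apply/rowP => m; have := h1 m; rewrite mxE => /esym/eqP.
  by rewrite mulf_eq0 (negPf K0) /= => /eqP ->; rewrite mxE.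
have e0 (i : 'I_3) : etaH a p v 0 (imag i) = 0.
  have := h3 i; rewrite mxE => /esym/eqP.
  by rewrite mulf_eq0 (negPf t0) /= => /eqP.
have N0 : normsq (fibre p) != 0 by rewrite normsq_eq0.
have c0 : coframe (cof a) (base p) (base v) = 0.
  apply/eqP; rewrite -normsq_eq0; apply/eqP.
  have : normsq (unit_coframe a p v) = 0.
    by rewrite u0; apply/eqP; rewrite normsq_eq0.
  move/eqP; rewrite normsq_eq0 /unit_coframe scaler_eq0 invr_eq0.
  rewrite (gt_eqF r0) /= -normsq_eq0 normsq_qmul normsq_qconj mulf_eq0 (negPf N0).
  by move/eqP.
have b0 : base v = 0.
  by rewrite -(mulmxK (cof_unit hz) (base v)) -/(coframe _ _ _) c0 mul0mx.
have A0 : spin_connection (lc a) (base p) 0 = 0.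
  have := spin_connection_linear (-1) 0 0 hz.
  by rewrite scaler0 addr0 scaleN1r addNr.
have q00 : qmul (qinv (fibre p)) (fibre v) = 0.
  have hq m : etaH a p v 0 m = qim (qmul (qinv (fibre p)) (fibre v)) 0 m.
    rewrite /etaH b0 A0 mxDE (_ : qmul _ 0 = 0); last by apply: quatP; rewrite !quatE !mxE; ring.
    by rewrite (_ : qmul 0 _ = 0) ?mxE ?addr0 //; apply: quatP; rewrite !quatE !mxE; ring.
  have dr0 : \sum_m fibre p 0 m * fibre v 0 m = 0.
    move: h2; rewrite mxE drE // => /esym/eqP; rewrite mulf_eq0 invr_eq0 (gt_eqF r0) orbF.
    by move/eqP.
  apply: quatP; rewrite [RHS]mxE.
  - rewrite qinvE qmulZl mxZE !quatE; rewrite quat_sum in dr0.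
    by rewrite (_ : _ - _ = 0) ?mulr0 // -[RHS]dr0; ring.
  - by rewrite -qim1 -hq -imagE.1.1 e0.
  - by rewrite -qim2 -hq -imagE.1.2 e0.
  - by rewrite -qim3 -hq -imagE.2 e0.
have f0 : fibre v = 0.
  rewrite -(qmul_1l (fibre v)) -(qmulV q0) -qmulA q00.
  by apply: quatP; rewrite !quatE !mxE; ring.
rewrite -(hsubmxK (v : 'rV[R]_(4 + 4))) -/(base v) -/(fibre v) b0 f0.
exact: (@row_mx0 R 1 4 4).
Qed.

Lemma gram_coframe : Defs.gram t nu a p = C *m C^T.
Proof.
apply/matrixP => i j; rewrite [LHS]mxE [RHS]mxE /Defs.metric.
have hC k l : C k l = coframe8 (basis_vec R k) 0 l by rewrite mxE.
under [RHS]eq_bigr => l _ do rewrite [C^T _ _]mxE !hC.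
set x := basis_vec R i; set y := basis_vec R j.
have -> : \sum_(l < 8) coframe8 x 0 l * coframe8 y 0 l
  = K ^+ 2 * \sum_(m < 4) unit_coframe a p x 0 m * unit_coframe a p y 0 m
    + dr p x * dr p y + t r ^+ 2 * \sum_(i < 3) Defs.eta a i p x * Defs.eta a i p y.
  rewrite -(inner8 K (t r) (dr p x) (dr p y) (unit_coframe a p x) (unit_coframe a p y)
    (fun i => Defs.eta a i p x) (fun i => Defs.eta a i p y)).
  by apply: eq_bigr => l _; rewrite !coframe8E.
have -> : \sum_(m < 4) unit_coframe a p x 0 m * unit_coframe a p y 0 m
  = \sum_(m < 4) coframe (cof a) (base p) (base x) 0 m
      * coframe (cof a) (base p) (base y) 0 m.
  rewrite /unit_coframe.
  under eq_bigr => m _ do rewrite !mxZE mulrACA.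
  rewrite -mulr_sumr inner_qmul normsq_qconj mulrA -invfM -expr2 qnorm_sq mulVf ?mul1r //.
  by rewrite normsq_eq0.
by rewrite K2 addrC addrA.
Qed.

Lemma row2 (M : 'M[R]_(2, 8)) : M = col_mx (row 0 M) (row 1 M).
Proof.
have E1 : usubmx (M : 'M[R]_(1 + 1, 8)) = row 0 M.
  by apply/rowP => j; rewrite !mxE; congr (M _ _); apply: val_inj.
have E2 : dsubmx (M : 'M[R]_(1 + 1, 8)) = row 1 M.
  by apply/rowP => j; rewrite !mxE; congr (M _ _); apply: val_inj.
by rewrite -E1 -E2 vsubmxK.
Qed.

Lemma row2_mulmx (M : 'M[R]_(2, 8)) :
  M *m C = col_mx (row 0 M *m C) (row 1 M *m C).
Proof. by rewrite [in LHS](row2 M); exact: (@mul_col_mx R 1 1 8 8 (row 0 M) (row 1 M) C). Qed.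

Lemma mono1E n (l : nat) (v : 'rV[R]_n.+1) : mono [:: l] v = v 0 (inord l).
Proof. by rewrite /mono det_mx11 mxE. Qed.

Lemma drE8 : dr p = fun M => seval [:: (false, [:: 4%N])] (M *m C).
Proof.
apply/funext => M; rewrite /seval big_seq1 mul1r mono1E.
by have [_ -> _] := coframeE M.
Qed.

Lemma etaE8 i : Defs.eta a i p
  = fun M => (t r)^-1 * seval [:: (false, [:: 5 + i]%N)] (M *m C).
Proof.
apply/funext => M; rewrite /seval big_seq1 mul1r mono1E.
by have [_ _ ->] := coframeE M; rewrite mulKf.
Qed.

Lemma seval_f_f i (M : 'M[R]_(2, 8)) : seval (f_f i) (M *m C) = t r ^+ 2
  * (Defs.eta a (ordS i) p (row 0 M) * Defs.eta a (ordS (ordS i)) p (row 1 M)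
     - Defs.eta a (ordS (ordS i)) p (row 0 M) * Defs.eta a (ordS i) p (row 1 M)).
Proof.
rewrite /seval big_seq1 mul1r row2_mulmx mono2E.
have [_ _ h0] := coframeE (row 0 M); have [_ _ h1] := coframeE (row 1 M).
have e1 : (5 + i.+1 %% 3)%N = (5 + ordS i)%N by [].
have e2 : (5 + i.+2 %% 3)%N = (5 + ordS (ordS i))%N.
  by move: i {e1}; apply: ord3P.
have E (c x y z w : R) : c * x * (c * y) - c * z * (c * w) = c ^+ 2 * (x * y - z * w).
  by ring.
by rewrite e1 e2 !h0 !h1; exact: E.
Qed.

Lemma seval_dr_f i (M : 'M[R]_(2, 8)) : seval (dr_f i) (M *m C) = t r
  * (dr p (row 0 M) * Defs.eta a i p (row 1 M) - Defs.eta a i p (row 0 M) * dr p (row 1 M)).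
Proof.
rewrite /seval big_seq1 mul1r row2_mulmx mono2E.
have [_ d0 h0] := coframeE (row 0 M); have [_ d1 h1] := coframeE (row 1 M).
have E (c x y z w : R) : x * (c * y) - c * z * w = c * (x * y - z * w) by ring.
by rewrite d0 d1 !h0 !h1; exact: E.
Qed.

Lemma seval_om i (M : 'M[R]_(2, 8)) : seval (om i) (M *m C) = K ^+ 2
  * sigma i (unit_coframe a p (row 0 M)) (unit_coframe a p (row 1 M)).
Proof.
rewrite /seval big_cons big_seq1 !mul1r row2_mulmx !mono2E.
have [h0 _ _] := coframeE (row 0 M); have [h1 _ _] := coframeE (row 1 M).
have a0 : (row 0 M *m C) 0 (inord 0) = K * unit_coframe a p (row 0 M) 0 0 := h0 0.
have a1 : (row 1 M *m C) 0 (inord 0) = K * unit_coframe a p (row 1 M) 0 0 := h1 0.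
have e1 : i.+1 = imag i by [].
have e2 : (i.+1 %% 3).+1 = imag (ordS i) by [].
have e3 : (i.+2 %% 3).+1 = imag (ordS (ordS i)) by move: i {e1 e2}; apply: ord3P.
have E (c x y z w x' y' z' w' : R) : c * x * (c * y) - c * z * (c * w)
    + (c * x' * (c * y') - c * z' * (c * w'))
  = c ^+ 2 * (x * y - z * w + (x' * y' - z' * w')) by ring.
by rewrite e2 e3 e1 a0 a1 !h0 !h1; exact: E.
Qed.

Lemma etaH_curvature v w i :
  'D_v (fun p' => Defs.eta a i p' w : R^o) p - 'D_w (fun p' => Defs.eta a i p' v : R^o) p
  = curvature (@qcomm R) (etaH a) p v w 0 (imag i)
    - 2 * (Defs.eta a (ordS i) p v * Defs.eta a (ordS (ordS i)) p w
         - Defs.eta a (ordS (ordS i)) p v * Defs.eta a (ordS i) p w).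
Proof.
have [_ E1] := is_derive_entry 0 (imag i) (der_etaH v w hp).
have [_ E2] := is_derive_entry 0 (imag i) (der_etaH w v hp).
rewrite [X in X - _ = _]E1 [X in _ - X = _]E2.
rewrite /curvature; have [_ ->] := der_etaH v w hp; have [_ ->] := der_etaH w v hp.
by rewrite [in RHS]mxDE [in RHS]mxDE [in RHS]mxNE qcomm_imag /Defs.eta addrK.
Qed.

Lemma wedge_eta i j M : dwedge (Defs.eta a i) (Defs.eta a j) p M
  = Defs.eta a i p (row 0 M) * Defs.eta a j p (row 1 M)
    - Defs.eta a j p (row 0 M) * Defs.eta a i p (row 1 M).
Proof.
rewrite /dwedge (etaE8 i) (etaE8 j) wedgeZl wedgeZr wedge_pullback wedge_seval //.
have -> (N : 'M[R]_(1 + 1, 8)) : seval (swedge [:: (false, [:: 5 + i]%N)] [:: (false, [:: 5 + j]%N)]) N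
    = mono [:: 5 + i; 5 + j]%N N.
  rewrite -(@wedge_mono R 1 1 7 [:: 5 + i]%N [:: 5 + j]%N) // -wedge_seval //.
  congr (wedge _ _ _); apply/funext => x; by rewrite /seval big_seq1 mul1r.
rewrite row2_mulmx mono2E /seval !big_seq1 !mul1r !mono1E.
by ring.
Qed.

(** The quadratic term in the definition of [omega] completes [d eta_i] to the curvature of [eta],
    which is [- (s / 24) sigma i] in the unit coframe; [K^2] accounts for the scale of the
    horizontal metric. *)
Lemma omegaE8 i : omega a i p
  = fun M => (K ^+ 2)^-1 * seval (om i) (M *m C).
Proof.
apply/funext => M; rewrite /omega /diff1 etaH_curvature curvature_eta // wedge_eta.
rewrite seval_om mulKf ?sqrf_eq0 //; field.
exact: s0.
Qed.

Lemma wedge_coframe k l (c d : R) (L1 L2 : signed_terms) :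
  all (fun x => size x.2 == k) L1 -> all (fun x => size x.2 == l) L2 ->
  wedge (fun M : 'M[R]_(k, 8) => c * seval L1 (M *m C))
        (fun M : 'M[R]_(l, 8) => d * seval L2 (M *m C))
  = fun M => c * d * seval (swedge L1 L2) (M *m C).
Proof.
move=> h1 h2; rewrite wedgeZl wedgeZr; apply/funext => M.
by rewrite wedge_pullback wedge_seval // mulrA.
Qed.

Let tr := t r.
Let e0 : Defs.eta a 0 p = fun M => tr^-1 * seval [:: (false, [:: 5%N])] (M *m C).
Proof. exact: etaE8. Qed.
Let e1 : Defs.eta a 1 p = fun M => tr^-1 * seval [:: (false, [:: 6%N])] (M *m C).
Proof. exact: etaE8. Qed.
Let e2 : Defs.eta a 2 p = fun M => tr^-1 * seval [:: (false, [:: 7%N])] (M *m C).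
Proof. exact: etaE8. Qed.
Let o0 : omega a 0 p = fun M => (K ^+ 2)^-1 * seval (om 0) (M *m C).
Proof. exact: omegaE8. Qed.
Let o1 : omega a 1 p = fun M => (K ^+ 2)^-1 * seval (om 1) (M *m C).
Proof. exact: omegaE8. Qed.
Let o2 : omega a 2 p = fun M => (K ^+ 2)^-1 * seval (om 2) (M *m C).
Proof. exact: omegaE8. Qed.

Lemma phiE8 : Defs.phi t nu a p = fun M => 1 * seval phi_terms (M *m C).
Proof.
apply/funext => M; rewrite /Defs.phi /dwedge -/r sum_ord3 e0 e1 e2 o0 o1 o2.
rewrite !wedge_coframe // mul1r.
have := ev_phi (fun l => mono l (M *m C)).
rewrite /= -![\sum_(_ <- _) _]/(seval _ (M *m C)) => <-.
move: (seval _ _) (seval _ _) (seval _ _) (seval _ _) => x1 x2 x3 x4.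
by rewrite K2 /tr; field; rewrite n1 s0 t0.
Qed.

Lemma psiE8 M : Defs.psi t nu a p M =
  6^-1 * (seval (swedge (om 0) (om 0)) (M *m C) + seval (swedge (om 1) (om 1)) (M *m C)
          + seval (swedge (om 2) (om 2)) (M *m C))
  - (seval (swedge (swedge [:: (false, [:: 5%N])] [:: (false, [:: 6%N])]) (om 2)) (M *m C)
    + seval (swedge (swedge [:: (false, [:: 6%N])] [:: (false, [:: 7%N])]) (om 0)) (M *m C)
    + seval (swedge (swedge [:: (false, [:: 7%N])] [:: (false, [:: 5%N])]) (om 1)) (M *m C)).
Proof.
rewrite /Defs.psi /dwedge -/r !sum_ord3 !ordSE e0 e1 e2 o0 o1 o2.
rewrite !wedge_coframe //.
have E (x1 x2 x3 x4 x5 x6 : R) (c := (K ^+ 2)^-1) :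
  nu r ^+ 4 / 6 * (s / 48) ^+ 2 * (c * c * x1 + c * c * x2 + c * c * x3)
  - nu r ^+ 2 * t r ^+ 2 * (s / 48)
    * (tr^-1 * tr^-1 * c * x4 + tr^-1 * tr^-1 * c * x5 + tr^-1 * tr^-1 * c * x6)
  = 6^-1 * (x1 + x2 + x3) - (x4 + x5 + x6).
  by rewrite /c K2 /tr; field; rewrite n1 s0 t0.
exact: E.
Qed.

Lemma ThetaE8 : Theta t nu a p = fun M => seval cayley (M *m C).
Proof.
apply/funext => M; rewrite /Theta psiE8 /dwedge phiE8.
have -> : dr p = fun M => 1 * seval [:: (false, [:: 4%N])] (M *m C).
  by rewrite drE8; under [RHS]eq_fun do rewrite mul1r.
rewrite wedge_coframe // !mul1r.
have := ev_cayley (fun l => mono l (M *m C)).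
by rewrite /= -![\sum_(_ <- _) _]/(seval _ (M *m C)) => <-.
Qed.

End OrthonormalCoframe.

(** * Curvature of radial connections *)

Section RadialCalculus.
Variables (R : realType) (V : normedModType R).
Implicit Types p v : V.

Lemma der_comp1 (g : R -> R) (f : V -> R) p v (g' df : R) :
  differentiable f p -> is_derive (f p) 1 g g' -> is_derive p v f df ->
  is_derive p v (fun q => g (f q)) (g' * df).
Proof.
move=> dF [dg <-] [_ <-].
have dG : differentiable g (f p) by apply/derivable1_diffP.
have dC : differentiable (g \o f) p by exact: differentiable_comp.
apply: DeriveDef; first exact: (diff_derivable dC).
rewrite deriveE; last exact: dC.
rewrite (@diff_comp _ _ _ _ f g) //= -(deriveE v dF) -(deriveE _ dG).
by rewrite derive_scale1 // mulrC.
Qed.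

Lemma der_scale m n (f : V -> R) (g : V -> 'M[R]_(m, n)) p v (df : R) dg :
  is_derive p v f df -> is_derive p v g dg ->
  is_derive p v (fun q => f q *: g q) (df *: g p + f p *: dg).
Proof.
move=> hf hg; apply: is_derive_mx => i j.
rewrite (_ : (fun q => _) = fun q => f q * g q i j); last first.
  by apply/funext => q; rewrite mxE.
rewrite mxDE !mxZE; exact: (derM hf (is_derive_entry i j hg)).
Qed.

End RadialCalculus.

Section RadialConnections.
Variables (R : realType) (s : R) (hs : 0 < s) (Z : asd_einstein_spin_orbifold s).
Variables (a : chart Z) (nu0 : R) (t nu : R -> R).
Hypotheses (hnu0 : 0 < nu0) (hprof : spin7_profile nu0 t nu).
Local Notation P := 'rV[R]_8.
Implicit Types (p v w : P) (i : 'I_3) (A : connection Z).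

Lemma class_C_radius k : class_C k [set p : P | fibre p != 0] (@Defs.radius R).
Proof.
have h := @class_C_linear R k _ _ _ _ (@qnorm R) (fibreL R) (@open_neq0 R)
  (@continuous_fibre R) (@class_C_qnorm R k).
exact: h.
Qed.

Lemma der_radial (x : R -> R) (x' : R) p v w : domE0 a p ->
  is_derive (Defs.radius p) 1 x x' ->
  is_derive p v (fun p' => x (Defs.radius p') *: etaH a p' w)
    ((x' * dr p v) *: etaH a p w
     + x (Defs.radius p) *: 'D_v (fun p' => etaH a p' w) p).
Proof.
move=> hp hx; have [_ q0] := hp.
have dR : differentiable (@Defs.radius R) p.
  by have [h _] := class_CS (class_C_radius 1); exact: h.
apply: der_scale.
  by apply: der_comp1 => //; rewrite drE //; exact: der_radius.
by have [hd _] := der_etaH v w hp; exact: DeriveDef.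
Qed.

(** The curvature of [x eta] is [x' dr /\ eta + x F_eta + (x^2 - x) [eta /\ eta] / 2]. The
    coefficient [- 2 x / nu^2] is [- x s / 24] divided by the horizontal scale [s nu^2 / 48]. *)
Lemma radial_curvature A (x : R -> R) (x' : R) p i : domE0 a p ->
  is_derive (Defs.radius p) 1 x x' ->
  (forall p' v, domE0 a p' -> A a p' v = radial_connection x a p' v) ->
  su2_curvature A a i p = fun M =>
    x' / t (Defs.radius p) * seval (dr_f i) (M *m coframe_mx a t nu p)
    + 2 * (x (Defs.radius p) ^+ 2 - x (Defs.radius p)) / t (Defs.radius p) ^+ 2
      * seval (f_f i) (M *m coframe_mx a t nu p)
    + (- 2 * x (Defs.radius p) / nu (Defs.radius p) ^+ 2)
      * seval (om i) (M *m coframe_mx a t nu p).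
Proof.
move=> hp hx hA; apply/funext => M; set v := row 0 M; set w := row 1 M.
have [_ q0] := hp.
have r0 : 0 < Defs.radius p by rewrite qnorm_gt0.
have t0 := t_neq0 hnu0 hprof r0.
have n0 := nusq_neq0 hnu0 hprof (ltW r0).
have D u u' : 'D_u (fun p' => A a p' u') p = (x' * dr p u) *: etaH a p u'
     + x (Defs.radius p) *: 'D_u (fun p' => etaH a p' u') p.
  have [_ <-] := der_radial u u' hp hx.
  apply: near_eq_derive; apply: (open_eq_near (open_domE0 (a := a)) hp) => p' hp'.
  exact: hA.
rewrite /su2_curvature /curvature !D !hA //.
have G (T X X' N dv dw S : R) (e f d d' : 'rV[R]_4) : T != 0 -> N != 0 ->
    (d - d' + qcomm e f) 0 (imag i) = - (s / 24) * S ->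
    ((X' * dv) *: f + X *: d - ((X' * dw) *: e + X *: d')
      + qcomm (X *: e) (X *: f)) 0 (imag i)
    = X' / T * (T * (dv * f 0 (imag i) - e 0 (imag i) * dw))
      + 2 * (X ^+ 2 - X) / T ^+ 2 * (T ^+ 2 *
         (e 0 (imag (ordS i)) * f 0 (imag (ordS (ordS i)))
          - e 0 (imag (ordS (ordS i))) * f 0 (imag (ordS i))))
      + (- 2 * X / N) * (s * N / 48 * S).
  move=> T0 N0; move: (qcomm_imag e f i) (qcomm_imag (X *: e) (X *: f) i).
  move: (qcomm e f) (qcomm (X *: e) (X *: f)) => Q Q' E1 E2.
  rewrite !(mxDE, mxNE, mxZE) E1 E2 !mxZE.
  move=> /(canRL (addrK _))/(canRL (subrK _)) ->.
  by field; rewrite T0 N0.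
have E := curvature_eta v w i hp; rewrite /curvature in E.
rewrite seval_dr_f // seval_f_f // seval_om // -/v -/w.
rewrite sqr_sqrtr; last by rewrite divr_ge0 // mulr_ge0 ?ltW // lt_def n0 sqr_ge0.
rewrite /radial_connection /Defs.eta; exact: G.
Qed.

(** The relation [al + be - 2 ga = 0] does not depend on the direction [i], so one direction yields
    the equation and the equation yields all three. *)
Lemma radial_instanton_at A (x : R -> R) (x' : R) p : domE0 a p ->
  is_derive (Defs.radius p) 1 x x' ->
  (forall p' v, domE0 a p' -> A a p' v = radial_connection x a p' v) ->
  (forall i (M : 'M[R]_(6, 8)),
    hodge2 (gram t nu a p) (orientation t nu a p) (su2_curvature A a i p) M =
    - dwedge (su2_curvature A a i) (Theta t nu a) p M) <->
  x' / t (Defs.radius p)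
  + 2 * (x (Defs.radius p) ^+ 2 - x (Defs.radius p)) / t (Defs.radius p) ^+ 2
  + 4 * x (Defs.radius p) / nu (Defs.radius p) ^+ 2 = 0.
Proof.
move=> hp hx hA.
set al := x' / _; set be := 2 * _ / _.
rewrite (_ : 4 * _ / _ = - (2 * (- 2 * x (Defs.radius p) / nu (Defs.radius p) ^+ 2))); last first.
  by rewrite !mulNr mulrN opprK !mulrA -natrM.
have hC := coframe_unit hs hnu0 hprof hp.
have EQ i := cayley_instanton al be (- 2 * x (Defs.radius p) / nu (Defs.radius p) ^+ 2)
  hC (ltn_ord i).
rewrite /orientation /dwedge (ThetaE8 hs hnu0 hprof hp) (gram_coframe hs hnu0 hprof hp).
split=> [/(_ 0)|h i].
  by rewrite (radial_curvature 0 hp hx hA) => h; apply/(EQ 0).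
by rewrite (radial_curvature i hp hx hA); apply/(EQ i).
Qed.

End RadialConnections.

(** * Smoothness of radial connections and of their extensions *)

Section QuaternionSmooth.
Variables (R : realType) (V : normedModType R) (D : set V) (oD : open D).
Implicit Types (f g : V -> 'rV[R]_4) (k : nat).

Lemma class_C_quat k f :
  class_C k D (fun p => f p 0 0 : R) -> class_C k D (fun p => f p 0 1 : R) ->
  class_C k D (fun p => f p 0 2 : R) -> class_C k D (fun p => f p 0 3 : R) ->
  class_C k D f.
Proof.
move=> h0 h1 h2 h3; apply: class_C_mx => // i j; rewrite (ord1 i).
case: j => -[|[|[|[|//]]]] hm.
- by rewrite (_ : Ordinal hm = 0) //; apply: val_inj.
- by rewrite (_ : Ordinal hm = 1) //; apply: val_inj.
- by rewrite (_ : Ordinal hm = 2) //; apply: val_inj.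
- by rewrite (_ : Ordinal hm = 3) //; apply: val_inj.
Qed.

Lemma class_C_scale k (x : V -> R) f : class_C k D x -> class_C k D f ->
  class_C k D (fun p => x p *: f p).
Proof.
move=> hx hf; apply: class_C_mx => // i j.
rewrite (_ : (fun p => _) = fun p => x p * f p i j).
  by apply: class_CM => //; exact: class_C_entry.
by apply/funext => p; rewrite mxE.
Qed.

Lemma class_C_qmul k f g : class_C k D f -> class_C k D g ->
  class_C k D (fun p => qmul (f p) (g p)).
Proof.
move=> hf hg.
have cf m : class_C k D (fun p => f p 0 m : R) by exact: class_C_entry.
have cg m : class_C k D (fun p => g p 0 m : R) by exact: class_C_entry.
apply: class_C_quat; [under eq_fun do rewrite qmul0|under eq_fun do rewrite qmul1
  |under eq_fun do rewrite qmul2|under eq_fun do rewrite qmul3].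
all: repeat first [exact: oD|exact: cf|exact: cg|apply: class_CN|apply: class_CD|apply: class_CM].
Qed.

Lemma class_C_qconj k f : class_C k D f -> class_C k D (fun p => qconj (f p)).
Proof.
move=> hf.
have cf m : class_C k D (fun p => f p 0 m : R) by exact: class_C_entry.
apply: class_C_quat; [under eq_fun do rewrite qconj0|under eq_fun do rewrite qconj1
  |under eq_fun do rewrite qconj2|under eq_fun do rewrite qconj3].
all: first [exact: cf|by apply: class_CN; [exact: oD|exact: cf]].
Qed.

Lemma class_C_qim k f : class_C k D f -> class_C k D (fun p => qim (f p)).
Proof.
move=> hf.
have cf m : class_C k D (fun p => f p 0 m : R) by exact: class_C_entry.
apply: class_C_quat; [under eq_fun do rewrite qim0|under eq_fun do rewrite qim1
  |under eq_fun do rewrite qim2|under eq_fun do rewrite qim3].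
all: first [exact: cf|exact: class_C_cst].
Qed.

End QuaternionSmooth.

Section QuaternionConjugation.
Variable R : realType.
Implicit Types q f : 'rV[R]_4.

Lemma qim_conj q f : qmul (qmul q (qim (qmul (qconj q) f))) (qconj q)
  = normsq q *: qim (qmul f (qconj q)).
Proof. by rewrite normsqE; apply: quatP; rewrite !quatE; ring. Qed.

Lemma qmul_conj q : qmul q (qconj q) = normsq q *: qone R.
Proof. by rewrite normsqE; apply: quatP; rewrite !quatE !qoneE; ring. Qed.

End QuaternionConjugation.

Definition radially_smooth (R : realType) (f : R -> R) :=
  forall k, class_C k setT (fun q : 'rV[R]_4 => f (qnorm q)).

Section SpinorForms.
Variables (R : realType) (s : R) (Z : asd_einstein_spin_orbifold s) (a : chart Z).
Local Notation V := 'rV[R]_4.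
Local Notation P := 'rV[R]_8.
Local Notation A := (spin_connection (lc a)).
Implicit Types (p v w : P) (D : set P) (B : P -> P -> V).

Lemma class_C_fibre k D : open D -> class_C k D (@fibre R).
Proof.
move=> oD; apply: class_C_mx => // i j.
rewrite (_ : (fun p => _) = fun p : P => p i (rshift 4 j : 'I_8)).
  exact: class_C_id_coord.
by apply/funext => p; rewrite mxE.
Qed.

Lemma class_C_radially k D (f : R -> R) : radially_smooth f ->
  class_C k D (fun p => f (Defs.radius p)).
Proof.
move=> hf; have h := @class_C_linear R k _ _ _ setT _ (fibreL R) openT
  (@continuous_fibre R) (hf k).
exact: (sub_class_C _ h).
Qed.

Lemma class_C_base_connection k v : class_C k (domE a) (fun p => A (base p) (base v)).
Proof.
have h := @class_C_linear R k _ _ _ (Defs.dom a) _ (baseL R) (@open_dom R s Z a)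
  (@continuous_base R) (spin_connection_smooth a (base v) k).
exact: h.
Qed.

Lemma eq_su2_1form D B B' : open D -> (forall p v, D p -> B p v = B' p v) ->
  su2_1form D B -> su2_1form D B'.
Proof.
move=> oD E [[h1 h2] h3]; split; last by move=> p v Dp; rewrite -E // h3.
split=> [p Dp c v w|v k]; first by rewrite -!E // h1.
by apply: eq_class_C (h2 v k) => // p Dp; exact: E.
Qed.

Lemma su2_1formZ D (x : P -> R) B : open D -> (forall k, class_C k D x) ->
  su2_1form D B -> su2_1form D (fun p v => x p *: B p v).
Proof.
move=> oD hx [[h1 h2] h3]; split; last by move=> p v Dp; rewrite mxZE h3 // mulr0.
split=> [p Dp c v w|v k]; last by apply: class_C_scale => //; exact: h2.
by rewrite h1 // scalerDr !scalerA mulrC.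
Qed.

Lemma su2_1formD D B B' : open D -> su2_1form D B -> su2_1form D B' ->
  su2_1form D (fun p v => B p v + B' p v).
Proof.
move=> oD [[h1 h2] h3] [[h1' h2'] h3']; split.
  split=> [p Dp c v w|v k]; last by apply: class_CD => //; [exact: h2|exact: h2'].
  by rewrite h1 // h1' // scalerDr addrACA.
by move=> p v Dp; rewrite mxDE h3 // h3' // addr0.
Qed.

Lemma sub_su2_1form D D' B : D `<=` D' -> su2_1form D' B -> su2_1form D B.
Proof.
move=> sD [[h1 h2] h3]; split; last by move=> p v /sD; exact: h3.
split=> [p /sD Dp c v w|v k]; first exact: h1.
exact: sub_class_C (h2 v k).
Qed.

Lemma su2_base_connection : su2_1form (domE a) (fun p v => A (base p) (base v)).
Proof.
split; last by move=> p v _; exact: spin_connection0.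
split=> [p Dp c v w|v k]; last exact: class_C_base_connection.
by rewrite base_linear spin_connection_linear.
Qed.

Let qimL (c : R) (x y : V) : qim (c *: x + y) = c *: qim x + qim y.
Proof. by apply: quatP; rewrite !quatE; ring. Qed.

Lemma su2_fibre_form :
  su2_1form (domE a) (fun p v => qim (qmul (fibre v) (qconj (fibre p)))).
Proof.
have oD := open_domE (a := a).
split; last by move=> p v _; exact: qim0.
split=> [p Dp c v w|v k].
  by rewrite fibre_linear qmulDl qmulZl qimL.
apply: class_C_qim => //; apply: class_C_qmul => //; first exact: class_C_cst.
by apply: class_C_qconj => //; exact: class_C_fibre.
Qed.

(* |q|^2 eta, which is smooth across the zero section *)
Definition scaled_eta p v : V := qim (qmul (qconj (fibre p)) (fibre v))
  + qmul (qmul (qconj (fibre p)) (A (base p) (base v))) (fibre p).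

Lemma etaH_scaled p v : etaH a p v = (Defs.radius p ^+ 2)^-1 *: scaled_eta p v.
Proof.
rewrite /etaH /qinv -/(Defs.radius p) /scaled_eta scalerDr !qmulZl.
by congr (_ + _); apply: quatP; rewrite !quatE ?mulr0.
Qed.

Lemma su2_scaled_eta : su2_1form (domE a) scaled_eta.
Proof.
have oD := open_domE (a := a).
split=> [|p v Dp]; last first.
  by rewrite /scaled_eta mxDE qim0 !quatE spin_connection0; ring.
split=> [p Dp c v w|v k].
  rewrite /scaled_eta fibre_linear base_linear spin_connection_linear //.
  by rewrite !qmulDr !qmulZr qmulDl qmulZl qimL scalerDr addrACA.
have hf : class_C k (domE a) (@fibre R) by exact: class_C_fibre.
have hc := class_C_qconj oD hf.
apply: class_CD => //.
  by apply: class_C_qim => //; apply: class_C_qmul => //; exact: class_C_cst.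
apply: class_C_qmul => //; apply: class_C_qmul => //.
exact: class_C_base_connection.
Qed.

Lemma su2_radial (x : R -> R) : (forall k, class_C k [set r : R | 0 < r] x) ->
  su2_1form (domE0 a) (radial_connection x a).
Proof.
move=> hx; have oD := open_domE0 (a := a).
have s0 : domE0 a `<=` domE a by move=> p [].
have r0 p : domE0 a p -> 0 < Defs.radius p by move=> [_ q0]; rewrite qnorm_gt0.
have hr k : class_C k (domE0 a) (@Defs.radius R).
  by apply: sub_class_C (@class_C_radius R k) => p [].
apply: (@eq_su2_1form _ (fun p v => (x (Defs.radius p) / Defs.radius p ^+ 2)
    *: scaled_eta p v)) => //.
  by move=> p v _; rewrite /radial_connection etaH_scaled scalerA.
apply: su2_1formZ => // [k|]; last exact: sub_su2_1form su2_scaled_eta.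
apply: class_CM => //.
  by apply: (@class_C_comp1 R k _ _ [set r : R | 0 < r]).
apply: class_CV => //; last exact: class_CX.
by move=> p /r0 h; rewrite sqrf_eq0 gt_eqF.
Qed.

End SpinorForms.

(** * Extension across the zero section *)

Section Extensions.
Variables (R : realType) (s : R) (Z : asd_einstein_spin_orbifold s).
Local Notation V := 'rV[R]_4.
Local Notation P := 'rV[R]_8.
Implicit Types (A : connection Z) (a : chart Z) (p v : P) (x y : R -> R).

Let one_gauge : chart Z -> P -> V := fun _ _ => qone R.

Let gauge_map_one : gauge_map one_gauge.
Proof.
split=> // [a k|a p _]; first exact: class_C_cst.
apply/eqP; rewrite -(@eqrXn2 _ 2) ?sqrtr_ge0 // qnorm_sq normsqE !qoneE.
by rewrite !expr0n /= !addr0.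
Qed.

Let gauge_transform_one A : gauge_transform one_gauge A = A.
Proof.
apply/funext => a; apply/funext => p; apply/funext => v.
rewrite /gauge_transform /one_gauge derive_cst qmul_1l.
have -> : qconj (qone R) = qone R by apply: quatP; rewrite !quatE !qoneE ?oppr0.
by rewrite !qmul_1r subr0.
Qed.

(** The factor [r^2] in [x] cancels the singularity of [eta], since [|q|^2 eta] is smooth; no change
    of gauge is required. *)
Lemma extends_on_trivial_radial A x y : connection_eq A (radial_connection x) ->
  (forall r, 0 < r -> x r = r ^+ 2 * y r) -> radially_smooth y ->
  extends_on_trivial A.
Proof.
move=> hA hxy hy; exists one_gauge; first exact: gauge_map_one.
rewrite gauge_transform_one => a; have oD := open_domE (a := a).
exists (fun p v => y (Defs.radius p) *: scaled_eta a p v).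
  by apply: su2_1formZ => // [k|]; [exact: class_C_radially|exact: su2_scaled_eta].
move=> p v hp; have [_ q0] := hp; have r0 : 0 < Defs.radius p by rewrite qnorm_gt0.
rewrite hA // /radial_connection etaH_scaled scalerA hxy // mulrAC divff ?mul1r //.
by rewrite sqrf_eq0 gt_eqF.
Qed.

Lemma der_taut_frame a p v : fibre p != 0 ->
  'D_v (@taut_frame R s Z a) p =
  (Defs.radius p)^-1 *: fibre v
  - ((\sum_m fibre p 0 m * fibre v 0 m) / Defs.radius p ^+ 3) *: fibre p.
Proof.
move=> q0; have r0 : Defs.radius p != 0 by rewrite gt_eqF // qnorm_gt0.
have [_ ->] := der_scale (derV r0 (der_radius v q0)) (der_fibre p v).
rewrite -/(Defs.radius p); move: (\sum_m _) => g.
by apply/rowP => m; rewrite !(mxDE, mxNE, mxZE); field.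
Qed.

(** Conjugation by [q / |q|] turns [eta] into [Im(dq qbar) / r^2 + A], and the inhomogeneous term of
    the gauge change subtracts [Im(dq qbar) / r^2]. The only singular coefficient left is
    [(x - 1) / r^2 = W]. *)
Lemma taut_gauge a p (x W : R) v (q := fibre p) (r := Defs.radius p) :
  q != 0 -> x - 1 = r ^+ 2 * W ->
  qmul (qmul (taut_frame a p) (x *: etaH a p v)) (qconj (taut_frame a p))
  - qmul ('D_v (@taut_frame R s Z a) p) (qconj (taut_frame a p))
  = W *: qim (qmul (fibre v) (qconj q))
    + x *: spin_connection (lc a) (base p) (base v).
Proof.
move=> q0 hx; have r0 : r != 0 by rewrite gt_eqF // qnorm_gt0.
have N : normsq q = r ^+ 2 by rewrite -qnorm_sq.
rewrite der_taut_frame // etaH_scaled /taut_frame -/r -/q /scaled_eta -/q.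
set A := spin_connection _ _ _; set f := fibre v; set g := \sum_m _.
have c (k : R) (y : V) : qconj (k *: y) = k *: qconj y.
  by apply: quatP; rewrite !quatE ?mulrN.
have id1 : qmul (qmul q (qim (qmul (qconj q) f) + qmul (qmul (qconj q) A) q)) (qconj q)
    = r ^+ 2 *: qim (qmul f (qconj q)) + r ^+ 4 *: A.
  rewrite qmulDr qmulDl qim_conj N; congr (_ + _).
  rewrite !qmulA qmul_conj -[LHS]qmulA qmul_conj N !qmulZl !qmulZr qmul_1l qmul_1r.
  by rewrite scalerA -exprD.
have id2 : qmul f (qconj q) = qim (qmul f (qconj q)) + g *: qone R.
  by apply: quatP; rewrite /g quat_sum !quatE !qoneE; ring.
have id3 : qmul q (qconj q) = r ^+ 2 *: qone R.
  by rewrite qmul_conj N.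
move: id1 id2; set I := qim (qmul f (qconj q)) => id1 id2.
rewrite c !qmulZr !qmulZl id1 qmulDl qmulNl !qmulZl id3 id2.
have -> : x = 1 + r ^+ 2 * W by rewrite -hx addrC subrK.
apply/rowP => m; rewrite !(mxDE, mxNE, mxZE).
by field.
Qed.

Lemma extends_on_pullback_radial A x W : connection_eq A (radial_connection x) ->
  (forall r, 0 < r -> x r - 1 = r ^+ 2 * W r) ->
  radially_smooth W -> radially_smooth x -> extends_on_pullback A.
Proof.
move=> hA hxW hW hx; exists one_gauge; first exact: gauge_map_one.
rewrite gauge_transform_one => a; have oD := open_domE (a := a).
exists (fun p v => W (Defs.radius p) *: qim (qmul (fibre v) (qconj (fibre p)))
  + x (Defs.radius p) *: spin_connection (lc a) (base p) (base v)).
  apply: su2_1formD => //.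
    by apply: su2_1formZ => // [k|]; [exact: class_C_radially|exact: su2_fibre_form].
  by apply: su2_1formZ => // [k|]; [exact: class_C_radially|exact: su2_base_connection].
move=> p v hp; have [_ q0] := hp; have r0 : 0 < Defs.radius p by rewrite qnorm_gt0.
by rewrite /gauge_transform hA // /radial_connection (taut_gauge a v q0 (hxW _ r0)).
Qed.

End Extensions.

(** * The two families of instantons *)

Section Asymptotics.
Variable R : realType.
Implicit Types f y : R -> R.

(** Analyticity is given as pointwise convergence. Convergence at points below [rho] bounds the
    terms there, hence gives [growth] with rate [1 / rho], and the sum of such a series is
    continuous at 0. *)
Lemma real_analytic_right_continuous y :
  real_analytic_on [set r : R | 0 <= r] y -> y @ 0^'+ --> y 0.
Proof.
move=> /(_ 0 (lexx 0)) [c [rho [rho0 hc]]].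
have hs r : 0 <= r < rho -> pseries c r @ \oo --> y r.
  by move=> /andP[r0 r1]; have := hc r r0; rewrite subr0 ger0_norm //; exact.
have gc : growth rho^-1 c.
  move=> B' hB'; have B0 : 0 < B' by apply: lt_trans hB'; rewrite invr_gt0.
  have hr : 0 <= B'^-1 < rho by rewrite invr_ge0 ltW //= invf_plt ?posrE.
  have /cvg_series_bounded [K [_ hK]] : cvgn (pseries c B'^-1).
    by apply/cvg_ex; exists (y B'^-1); exact: hs.
  exists (K + 1) => n; have := hK (K + 1) (ltr_pwDr ltr01 (lexx _)) n I.
  by rewrite /= normrM normrX normfV (gtr0_norm B0) exprVn ler_pdivrMr // exprn_gt0.
have h0 : [set x : R | `|x| < rho^-1^-1] 0 by rewrite /= normr0 invrK.
have hcont : {for (0 : R), continuous (fun x : R => limn (pseries c x))}.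
  by apply: (@class_C_pseries R 0 rho^-1 c) => //; rewrite invr_gt0.
have E r : 0 <= r < rho -> limn (pseries c r) = y r by move=> hr; apply/cvg_lim => //; exact: hs.
rewrite -(E 0); last by rewrite lexx.
apply: cvg_trans (cvg_at_right_filter hcont); apply: near_eq_cvg.
near=> r; apply: E; apply/andP; split; last by near: r; exact: nbhs_right_lt.
by apply: ltW; near: r; exact: nbhs_right_gt.
Unshelve. all: by end_near.
Qed.

Lemma class_C_id n (D : set R) : class_C n D (fun r : R => r).
Proof.
case: n => [|n]; first by move=> p _; exact: cvg_id.
split=> [p _|v]; first by apply/derivable1_diffP; exact: derivable_id.
rewrite (_ : (fun p => _) = fun=> v); first exact: class_C_cst.
by apply/funext => p; rewrite derive_id.
Qed.

Lemma qnorm_scale_one (r : R) : 0 <= r -> qnorm (r *: qone R) = r.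
Proof.
move=> r0; apply/eqP; rewrite -(@eqrXn2 _ 2) ?qnorm_ge0 // qnorm_sq normsqE.
by rewrite !rowZ !qoneE !mulr0 mulr1 expr0n /= !addr0.
Qed.

Lemma radially_smooth_right_continuous f : radially_smooth f -> f @ 0^'+ --> f 0.
Proof.
move=> hf; have h := @class_C_cont R 0 _ _ setT _ (hf 0) (0 *: qone R) I.
have hz : (fun r : R => r *: qone R) @ (0 : R) --> 0 *: qone R.
  exact: scalel_continuous.
have := continuous_comp hz h; rewrite /= => /cvg_at_right_filter.
rewrite /= qnorm_scale_one // => h'.
apply: cvg_trans h'; apply: near_eq_cvg; near=> r.
by rewrite /= qnorm_scale_one //; apply: ltW; near: r; exact: nbhs_right_gt.
Unshelve. all: by end_near.
Qed.

End Asymptotics.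

(** * Radial instantons and the differential equation *)

Section InstantonODE.
Variables (R : realType) (s : R) (hs : 0 < s) (Z : asd_einstein_spin_orbifold s).
Variables (nu0 : R) (t nu : R -> R).
Hypotheses (hnu0 : 0 < nu0) (hprof : spin7_profile nu0 t nu).
Implicit Types (A : connection Z) (x : R -> R).
Local Notation I := (tint nu0 nu).
Local Notation pos := [set r : R | 0 < r].

Let oP : open pos. Proof. exact: open_gt. Qed.

Lemma instanton_of_ode A x : (forall k, class_C k pos x) ->
  instanton_ode t nu x -> connection_eq A (radial_connection x) ->
  spin7_instanton t nu A.
Proof.
move=> sx ode hA; split=> [a|a p hp i M].
  apply: (@eq_su2_1form _ _ (radial_connection x a)); first exact: open_domE0.
    by move=> p v hp; rewrite hA.
  exact: su2_radial.
have [_ q0] := hp; have r0 : 0 < Defs.radius p by rewrite qnorm_gt0.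
have [x' hx E] := ode _ r0.
by apply: (radial_instanton_at hs hnu0 hprof hp hx (hA a)).2.
Qed.

(* A is evaluated on a vertical vector along a ray of a fibre to see that x is
   differentiable. *)
Lemma ode_of_instanton A x : spin7_instanton t nu A ->
  connection_eq A (radial_connection x) -> instanton_ode t nu x.
Proof.
move=> [sA inst] hA.
(* A point of Z provides a fibre; otherwise the conditions on [A] would say nothing about [x]. *)
have [z0 _] := space_nonempty Z; have [a [z hz _]] := proj_cover (atlas Z) z0.
pose pt (r : R) : 'rV[R]_8 := row_mx z (r *: qone R) : 'rV[R]_(4 + 4).
pose u : 'rV[R]_8 := row_mx 0 (qone R) : 'rV[R]_(4 + 4).
pose w : 'rV[R]_8 := row_mx 0 (basis_vec R (1 : 'I_4)) : 'rV[R]_(4 + 4).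
have fp r : fibre (pt r) = r *: qone R by exact: (@row_mxKr R 1 4 4).
have bp r : base (pt r) = z by exact: (@row_mxKl R 1 4 4).
have rp r : 0 < r -> Defs.radius (pt r) = r.
  by move=> r0; rewrite /Defs.radius fp qnorm_scale_one // ltW.
have hp r : 0 < r -> domE0 a (pt r).
  by move=> r0; split; rewrite ?bp // -qnorm_gt0 -/(Defs.radius _) rp.
(* On the ray [q = r] the first imaginary component of [eta] is [1 / r] on the constant vertical
   vector i, so [x] is [r] times a smooth component of [A]. *)
have hw r : 0 < r -> etaH a (pt r) w 0 1 = r^-1.
  move=> r0; rewrite etaH_scaled mxZE rp // /scaled_eta.
  have -> : base w = 0 by exact: (@row_mxKl R 1 4 4).
  have -> : fibre w = basis_vec R 1 by exact: (@row_mxKr R 1 4 4).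
  have -> : spin_connection (lc a) (base (pt r)) 0 = 0.
    have hz' : Defs.dom a (base (pt r)) by rewrite bp.
    by have := spin_connection_linear (-1) 0 0 hz'; rewrite scaler0 addr0 scaleN1r addNr.
  rewrite fp mxDE !quatE !qoneE !mxE /=.
  by field; rewrite gt_eqF.
pose F (p : 'rV[R]_8) := A a p w 0 1 : R.
have hF r : 0 < r -> r * F (pt r) = x r.
  move=> r0; rewrite /F hA; last exact: hp.
  by rewrite /radial_connection mxZE hw // rp // mulrC divfK // gt_eqF.
have ext (p p1 : 'rV[R]_8) (h : R) : base p = h *: base u + base p1 ->
    fibre p = h *: fibre u + fibre p1 -> p = h *: u + p1.
  rewrite -base_linear -fibre_linear => hb hf.
  rewrite -(hsubmxK (p : 'rV[R]_(4 + 4))) -/(base p) -/(fibre p) hb hf.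
  exact: (hsubmxK (h *: u + p1 : 'rV[R]_(4 + 4))).
have dF (r : R) : 0 < r -> is_derive r 1 (fun r : R => F (pt r)) ('D_u F (pt r)).
  move=> r0.
  have hdF : derivable F (pt r) u.
    have h := class_C_entry 0 1 (open_domE0 (a := a)) ((sA a).1.2 w 1%N).
    by have [h1 _] := class_CS h; apply: diff_derivable; apply: h1; exact: hp.
  have E : (fun h => h^-1 *: (((fun r : R => F (pt r)) \o shift r) (h *: (1 : R)) - F (pt r)))
      = (fun h => h^-1 *: ((F \o shift (pt r)) (h *: u) - F (pt r))).
    apply/funext => h /=; congr (_ *: (F _ - _)).
    rewrite -[h%:A]/(h * 1) mulr1; apply: ext.
      have -> : base u = 0 by exact: (@row_mxKl R 1 4 4).
      by rewrite !bp scaler0 add0r.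
    have -> : fibre u = qone R by exact: (@row_mxKr R 1 4 4).
    by rewrite !fp scalerDl.
  by apply: DeriveDef; rewrite /derivable /derive E.
move=> r r0.
have hx : is_derive r 1 (fun y : R => y * F (pt y)) (1 * F (pt r) + r * 'D_u F (pt r)).
  exact: derM (is_derive_id r 1) (dF r r0).
have {}hx : is_derive r 1 x (1 * F (pt r) + r * 'D_u F (pt r)).
  apply: near_eq_is_derive hx.
  by apply: (@open_eq_near R _ _ pos (fun y : R => y * F (pt y)) x r oP r0) => r' /hF.
exists (1 * F (pt r) + r * 'D_u F (pt r)) => //.
have := inst a (pt r) (hp r r0).
have hx' : is_derive (Defs.radius (pt r)) 1 x (1 * F (pt r) + r * 'D_u F (pt r)).
  by rewrite rp.
move/(radial_instanton_at hs hnu0 hprof (hp r r0) hx' (hA a)).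
by rewrite !rp.
Qed.

Section Solutions.
Variables (c k : R).
Let D r := c + 2 * k * I r.
Hypothesis D0 : forall r, 0 < r -> 0 < D r.

Lemma solution_class_C n : class_C n pos (fun r => k * t r ^+ 2 / D r).
Proof.
have ct := class_C_t hnu0 hprof n; have cI := class_C_tint hnu0 hprof n.
apply: class_CM => //; first by apply: class_CM; [| exact: class_C_cst | exact: class_CX].
apply: class_CV => // [r hr|]; first by rewrite gt_eqF // D0.
by apply: class_CD => //; [exact: class_C_cst | apply: class_CM => //; exact: class_C_cst].
Qed.

Lemma solution_ode : instanton_ode t nu (fun r => k * t r ^+ 2 / D r).
Proof.
move=> r r0; have d0 : D r != 0 by rewrite gt_eqF // D0.
have ht := t_derive hprof r0.
have hD : is_derive r 1 D (2 * k * t r).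
  apply: is_derive_eq (derD (derC c r 1) (derZ (2 * k) (tint_derive hprof r0))) _.
  by rewrite add0r.
have hx := derM (derZ k (derX 2 ht)) (derV d0 hD).
eexists; first exact: hx.
have t0 := t_neq0 hnu0 hprof r0; have n0 := nusq_neq0 hnu0 hprof (ltW r0).
move: n0; rewrite sqrf_eq0 => n0.
by field; rewrite t0 n0 d0.
Qed.

(** The limit at 0 fixes the integration constant: [x / t^2 * D - k] tends to 0, hence vanishes
    identically. *)
Lemma solution_unique x : instanton_ode t nu x ->
  x r / t r ^+ 2 * D r @[r --> 0^'+] --> k ->
  forall r, 0 < r -> x r = k * t r ^+ 2 / D r.
Proof.
move=> ode hk r r0.
have h0 : (fun r => x r / t r ^+ 2 * D r - k) @ 0^'+ --> 0.
  by rewrite -[X in _ --> X](subrr k); apply: cvgB => //; exact: cvg_cst.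
have /eqP := instanton_ode_unique hnu0 hprof ode h0 r0.
rewrite subr_eq0 => /eqP <-.
have t0 := t_neq0 hnu0 hprof r0; have d0 : D r != 0 by rewrite gt_eqF // D0.
by rewrite -/(D r); field; rewrite t0 d0.
Qed.

End Solutions.

End InstantonODE.

(** * Identification of the two families *)

Section InstantonFamilies.
Variables (R : realType) (s : R) (hs : 0 < s) (Z : asd_einstein_spin_orbifold s).
Variables (nu0 : R) (t nu : R -> R).
Hypotheses (hnu0 : 0 < nu0) (hprof : spin7_profile nu0 t nu).
Implicit Types (A : connection Z) (x : R -> R).
Local Notation I := (tint nu0 nu).
Local Notation pos := [set r : R | 0 < r].

Let oP : open pos. Proof. exact: open_gt. Qed.
Let I0 (r : R) : 0 < r -> 0 < I r. Proof. exact: (tint_gt0 hnu0 hprof). Qed.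
Let t0 (r : R) : 0 < r -> t r != 0. Proof. exact: (t_neq0 hnu0 hprof). Qed.
Let neq0 (r : R) : 0 < r -> r != 0. Proof. by move=> r0; rewrite gt_eqF. Qed.

Lemma radial_connection_congr A x x' : (forall r : R, 0 < r -> x r = x' r) ->
  connection_eq A (radial_connection x) -> connection_eq A (radial_connection x').
Proof.
move=> E h a p v hp; rewrite h // /radial_connection E //.
by have [_ q0] := hp; rewrite qnorm_gt0.
Qed.

Let class_C_div_sq n (f : R -> R) :
  class_C n pos f -> class_C n pos (fun r => f r / r ^+ 2).
Proof.
move=> hf; apply: class_CM => //; apply: class_CV => //.
  by move=> r r0; rewrite sqrf_eq0 neq0.
by apply: class_CX => //; exact: class_C_id.
Qed.

(** Since [t / r] tends to 1, asymptotics of [x] in powers of [r] translate into those in powers of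
    [t]. *)
Lemma cvg_div_t_sq (y : R -> R) (l : R) : y @ 0^'+ --> l ->
  y r / (t r / r) ^+ 2 @[r --> 0^'+] --> l.
Proof.
move=> hy; have h := t_over_r_cvg hnu0 hprof.
rewrite -[X in _ --> X]divr1 -[X in _ / X](expr1n R 2).
apply: cvgM => //; apply: cvgV; first by rewrite expr1n oner_eq0.
by rewrite !expr2; apply: cvgM.
Qed.

Section Trivial.
Variables (y0 : R) (y00 : 0 <= y0).
Let D r := 1 + 2 * y0 * I r.
Let D0 (r : R) : 0 < r -> 0 < D r.
Proof. by move=> r0; apply: (den_gt0 hnu0 hprof y00); exact: ltW. Qed.
Let Y := quot_fun nu0 t nu y0.

Lemma is_A_y0_radial A : is_A_y0 t nu y0 A ->
  connection_eq A (radial_connection (fun r => y0 * t r ^+ 2 / D r)).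
Proof.
move=> [inst _ [x [y [hA hxy an yy0]]]].
apply: radial_connection_congr (hA) => r r0.
have ode := ode_of_instanton hs hnu0 hprof inst hA.
apply: (solution_unique hnu0 hprof D0 ode) r0.
have h1 := cvg_div_t_sq (real_analytic_right_continuous an).
have h2 : D @ 0^'+ --> 1 + 2 * y0 * 0.
  apply: cvgD; first exact: cvg_cst.
  by apply: cvgM; [exact: cvg_cst|exact: tint_cvg0 hprof].
have : y r / (t r / r) ^+ 2 * D r @[r --> 0^'+] --> y 0 * (1 + 2 * y0 * 0).
  exact: (cvgM h1 h2).
rewrite mulr0 addr0 mulr1 yy0.
apply: cvg_trans; apply: near_eq_cvg; near=> q.
have q0 : 0 < q by near: q; exact: nbhs_right_gt.
rewrite /= hxy //; congr (_ * _).
by field; rewrite t0 // neq0.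
Unshelve. all: by end_near.
Qed.

Let smooth_Y : radially_smooth (fun r => y0 * Y r).
Proof.
move=> n; apply: class_CM; [exact: openT|exact: class_C_cst|].
apply: class_C_even; first exact: quot_fun_even.
apply: (@eq_class_C R n _ _ _ (fun r => t r ^+ 2 * (D r)^-1 / r ^+ 2)) => //.
  by move=> r r0; rewrite /Y /quot_fun (negPf (neq0 r0)).
apply: class_C_div_sq; apply: class_CM => //.
  by apply: class_CX => //; exact: (class_C_t hnu0 hprof).
apply: class_CV => // [r r0|]; first by rewrite gt_eqF // D0.
apply: class_CD => //; first exact: class_C_cst.
by apply: class_CM => //; [exact: class_C_cst|exact: (class_C_tint hnu0 hprof)].
Qed.

Lemma radial_is_A_y0 A :
  connection_eq A (radial_connection (fun r => y0 * t r ^+ 2 / D r)) ->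
  is_A_y0 t nu y0 A.
Proof.
have EY (r : R) : 0 < r -> y0 * t r ^+ 2 / D r = r ^+ 2 * (y0 * Y r).
  move=> r0; rewrite /Y /quot_fun (negPf (neq0 r0)) -/(D r).
  by field; rewrite neq0 // gt_eqF // D0.
move=> hA; split.
- apply: (instanton_of_ode hs hnu0 hprof _ _ hA) => [n|].
    exact: (solution_class_C hnu0 hprof D0).
  exact: (solution_ode hnu0 hprof D0).
- exact: extends_on_trivial_radial hA EY smooth_Y.
- exists (fun r => y0 * t r ^+ 2 / D r), (fun r => y0 * Y r); split=> //.
    exact: quot_fun_analytic.
  by rewrite /Y /quot_fun eqxx mulr1.
Qed.

End Trivial.

Let D r := 0 + 2 * 1 * I r.
Let D0 (r : R) : 0 < r -> 0 < D r.
Proof. by move=> r0; rewrite /D add0r mulr1 mulr_gt0 // I0. Qed.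

Lemma is_A_lim_radial A : is_A_lim t nu A ->
  connection_eq A (radial_connection (fun r => 1 * t r ^+ 2 / D r)).
Proof.
move=> [inst _ [x [hA [C hC]]]].
apply: radial_connection_congr (hA) => r r0.
have ode := ode_of_instanton hs hnu0 hprof inst hA.
apply: (solution_unique hnu0 hprof D0 ode) r0.
have hx : x @ 0^'+ --> (1 : R).
  have hz : (fun r : R => C * r ^+ 2) @ 0^'+ --> (0 : R).
    apply: cvg_at_right_filter; rewrite -[X in _ --> X](mulr0 C).
    apply: cvgM; first exact: cvg_cst.
    rewrite -[X in _ --> X](expr0n R 2); exact: exprn_continuous.
  apply/cvgrPdist_lt => e e0; move/cvgrPdist_lt : hz => /(_ e e0) he.
  near=> q; rewrite distrC.
  have h1 : `|x q - 1| <= C * q ^+ 2 by near: q.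
  have h2 : `|0 - C * q ^+ 2| < e by near: q.
  by apply: le_lt_trans h1 (le_lt_trans _ h2); rewrite sub0r normrN ler_norm.
(* With [c = 0] the quantity [x / t^2 * 2 I] is 0 times infinity at the origin; inserting [r^2]
   splits it into two factors, each tending to 1. *)
have : x r / (t r / r) ^+ 2 * (2 * I r / r ^+ 2) @[r --> 0^'+] --> (1 : R) * 1.
  exact: (cvgM (cvg_div_t_sq hx) (tint_over_rsq_cvg hnu0 hprof)).
rewrite mulr1.
apply: cvg_trans; apply: near_eq_cvg; near=> q.
have q0 : 0 < q by near: q; exact: nbhs_right_gt.
by rewrite /= /D add0r mulr1; field; rewrite t0 // neq0.
Unshelve. all: by end_near.
Qed.

(** For [k = 0] the factor [J] inside [quot_fun] is 1, so [T] is [t^2 / r^2]. The limiting solution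
    is then [T] over [2 I / r^2], a quotient of even functions whose denominator vanishes
    nowhere. *)
Let T := quot_fun nu0 t nu 0.
Let J r := if r == 0 then 1 else 2 * I r / r ^+ 2.

Let J1 r : (1 + 2 * 0 * I r)^-1 = 1.
Proof. by rewrite mulr0 mul0r addr0 invr1. Qed.

Let smooth_T : radially_smooth T.
Proof.
move=> n; apply: class_C_even; first exact: quot_fun_even.
apply: (@eq_class_C R n _ _ _ (fun r => t r ^+ 2 / r ^+ 2)) => // [r r0|].
  by rewrite /T /quot_fun (negPf (neq0 r0)) J1 mulr1.
by apply: class_C_div_sq; apply: class_CX => //; exact: (class_C_t hnu0 hprof).
Qed.

Let smooth_invJ : radially_smooth (fun r => (J r)^-1).
Proof.
move=> n; apply: class_CV; first exact: openT.
  move=> q _; rewrite /J; case: (eqVneq (qnorm q) 0) => [_|q0]; first by rewrite oner_eq0.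
  have r0 : 0 < qnorm q by rewrite lt_def q0 qnorm_ge0.
  apply: mulf_neq0; last by rewrite invr_eq0 sqrf_eq0.
  by apply: mulf_neq0; [rewrite pnatr_eq0|rewrite gt_eqF // I0].
apply: class_C_even; first exact: (tint_quot_even hnu0 hprof (lexx 0)).
apply: (@eq_class_C R n _ _ _ (fun r => 2 * I r / r ^+ 2)) => // [r r0|].
  by rewrite /J (negPf (neq0 r0)).
apply: class_C_div_sq; apply: class_CM => //; first exact: class_C_cst.
exact: (class_C_tint hnu0 hprof).
Qed.

Let smooth_X : radially_smooth (fun r => T r / J r).
Proof.
by move=> n; apply: class_CM; [exact: openT|exact: smooth_T|exact: smooth_invJ].
Qed.

(** Numerator and denominator of the solution agree at 0 and are even, so their difference is
    divisible by [r^2] with smooth quotient; [W] is that quotient over the denominator. *)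
Let defect_quotient : exists2 W : R -> R, radially_smooth W &
  forall r : R, 0 < r -> T r / J r - 1 = r ^+ 2 * W r.
Proof.
have [w hw] := tint_defect_even hnu0 hprof (lexx (0 : R)).
set W := (X in even_germ X) in hw.
exists (fun r => - (W r / J r)) => [n|r r0]; last first.
  rewrite /T /J /W /quot_fun (negPf (neq0 r0)) J1 !mulr1.
  by field; rewrite neq0 // gt_eqF // I0.
apply: class_CN; first exact: openT.
apply: class_CM; [exact: openT| |exact: smooth_invJ].
apply: class_C_even; first exact: hw.
apply: (@eq_class_C R n _ _ _
    (fun r => (2 * I r - t r ^+ 2) / r ^+ 2 / r ^+ 2)) => // [r r0|].
  by rewrite /W (negPf (neq0 r0)) J1 mulr1; field; rewrite neq0.
do 2 apply: class_C_div_sq; apply: class_CB => //.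
  by apply: class_CM => //; [exact: class_C_cst|exact: (class_C_tint hnu0 hprof)].
by apply: class_CX => //; exact: (class_C_t hnu0 hprof).
Qed.

Lemma radial_is_A_lim A :
  connection_eq A (radial_connection (fun r => 1 * t r ^+ 2 / D r)) ->
  is_A_lim t nu A.
Proof.
have E (r : R) : 0 < r -> 1 * t r ^+ 2 / D r = T r / J r.
  move=> r0; rewrite /T /J /quot_fun /D (negPf (neq0 r0)) J1 add0r !mulr1 mul1r.
  by field; rewrite neq0 // gt_eqF // I0.
have [W sW hW] := defect_quotient.
move=> hA; have hA' := radial_connection_congr E hA.
split.
- apply: (instanton_of_ode hs hnu0 hprof _ _ hA) => [n|].
    exact: (solution_class_C hnu0 hprof D0).
  exact: (solution_ode hnu0 hprof D0).
- exact: extends_on_pullback_radial hA' hW sW smooth_X.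
(* Near 0 the continuous function [W] stays within 1 of [W 0], which gives the constant of the
   quadratic estimate. *)
- exists (fun r => T r / J r); split=> //; exists (`|W 0| + 1).
  have /cvgrPdist_lt/(_ 1 ltr01) hb := radially_smooth_right_continuous sW.
  near=> r; have r0 : 0 < r by near: r; exact: nbhs_right_gt.
  rewrite hW // normrM (ger0_norm (sqr_ge0 _)) [leLHS]mulrC.
  apply: ler_wpM2r; first exact: sqr_ge0.
  have : `|W 0 - W r| < 1 by near: r.
  move=> /ltW; rewrite distrC => h; rewrite -[W r](subrK (W 0)) addrC.
  by apply: le_trans (ler_normD _ _) _; rewrite lerD2l.
Unshelve. all: by end_near.
Qed.

End InstantonFamilies.

Theorem proposition9 (R : realType) (s : R) (hs : 0 < s)
    (Z : asd_einstein_spin_orbifold s)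
    (nu0 : R) (hnu0 : 0 < nu0) (t nu : R -> R)
    (hprofile : spin7_profile nu0 t nu) :
  (forall y0 : R, 0 <= y0 -> forall A : connection Z,
     is_A_y0 t nu y0 A <->
     connection_eq A (radial_connection
       (fun r => y0 * t r ^+ 2 / (1 + 2 * y0 * \int[lebesgue_measure]_(u in `[0, r]) t u)))) /\
  (forall A : connection Z,
     is_A_lim t nu A <->
     connection_eq A (radial_connection
       (fun r => t r ^+ 2 / (2 * \int[lebesgue_measure]_(u in `[0, r]) t u)))).
Proof.
have intE := tint_integral hprofile.
split=> [y0 y00 A|A].
- split=> [/(is_A_y0_radial hs hnu0 hprofile y00)|hA].
    by apply: radial_connection_congr => r r0; rewrite intE.
  apply: (radial_is_A_y0 hs hnu0 hprofile y00).
  by apply: radial_connection_congr hA => r r0; rewrite intE.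
- split=> [/(is_A_lim_radial hs hnu0 hprofile)|hA].
    by apply: radial_connection_congr => r r0; rewrite intE // add0r mulr1 mul1r.
  apply: (radial_is_A_lim hs hnu0 hprofile).
  by apply: radial_connection_congr hA => r r0; rewrite intE // add0r mulr1 mul1r.
Qed.
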